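(* Let $f$ be a one-periodic function with wavelet coefficient sequence $\vec c$ such that $p_0(f)>0$. Then, for every $0<p<p_0(f)$ and every real $h\ge -\frac1p$, \[ \mathscr{D}_f^{(p)}(h)\le \min\left(\max\left(\sup_{\alpha\in[h,0)}\left(\frac{(\rho_{\vec c}(\alpha)-1)h}{\alpha}+1\right),\ \left(h+\frac1p\right)\sup_{\alpha\in(-\frac1p,h]}\frac{\rho_{\vec c}(\alpha)}{\alpha+\frac1p}\right),\,1\right). \] In particular, for every $h\ge 0$, \[ \mathscr{D}_f^{(p)}(h)\le \min\left(\left(h+\frac1p\right)\sup_{\alpha\in(-\frac1p,h]}\frac{\rho_{\vec c}(\alpha)}{\alpha+\frac1p},\,1\right). \]
   Context: Conventions: $\mathbb N_0=\{0,1,2,\dots\}$; $\sup\emptyset=-\infty$; $\log_2 0=-\infty$; $0\cdot(-\infty)=-\infty$; the Hausdorff dimension of the empty set is $-\infty$. Wavelets. Fix a mother wavelet $\psi$ in the Schwartz class such that the functions $2^{j/2}\psi_{j,k}$, $j\in\mathbb N_0$, $0\le k\le 2^j-1$, with $\psi_{j,k}(x)=\sum_{l\in\mathbb Z}\psi(2^j(x-l)-k)$, together with the constant function $1$, form an orthonormal basis of $L^2([0,1])$. The wavelet coefficients of a one-periodic function $f$ are $c_{j,k}=2^j\int_0^1\psi_{j,k}(x)f(x)\,dx$ (understood as a duality pairing when needed), and $f$ is identified with the sequence $\vec c=(c_{j,k})$ via $f=\sum_{j,k}c_{j,k}\psi_{j,k}$ (the constant component plays no role). Dyadic intervals are $\lambda_{j,k}=[k2^{-j},(k+1)2^{-j})$;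 $\Lambda_j=\{\lambda_{j,k}:0\le k\le 2^j-1\}$; $c_{\lambda_{j,k}}=c_{j,k}$; $\lambda_j(x_0)$ is the interval of $\Lambda_j$ containing $x_0$ (modulo 1); $3\lambda_{j,k}$ is the union of $\lambda_{j,k-1},\lambda_{j,k},\lambda_{j,k+1}$ (modulo 1). Scaling function: for $p>0$, $\eta_f(p)=\liminf_{j\to+\infty}-\frac1j\log_2\left(2^{-j}\sum_{k=0}^{2^j-1}|c_{j,k}|^p\right)$, and $p_0(f)=\sup\{p>0:\eta_f(p)>0\}$. Wavelet density: for $\alpha\in\mathbb R$, \[\rho_{\vec c}(\alpha)=\lim_{\varepsilon\to0^+}\limsup_{j\to+\infty}\frac1j\log_2\#\{k\in\{0,\dots,2^j-1\}:2^{-(\alpha+\varepsilon)j}\le|c_{j,k}|\le2^{-(\alpha-\varepsilon)j}\}.\] $p$-exponent. For $p\ge1$, $f\in L^p_{\mathrm{loc}}(\mathbb R)$, $\alpha\ge-\frac1p$ and $x_0\in\mathbb R$, $f\in T^p_\alpha(x_0)$ if there exist $C>0$, a polynomial $P$ of degree less than $\alpha$ and $R>0$ with $\left(\frac1r\int_{B(x_0,r)}|f(x)-P(x)|^p\,dx\right)^{1/p}\le Cr^\alpha$ for all $0<r\le R$; and $h^{(p)}_f(x_0)=\sup\{\alpha\ge-\frac1p:f\in T^p_\alpha(x_0)\}$. The $p$-leaders are, for $\lambda\in\Lambda_j$, \[l^{(p)}_\lambda=\sup_{j'\ge j}\left(\sum_{\lambda'\in\Lambda_{j'},\,\lambda'\subseteq3\lambda}|c_{\lambda'}|^p2^{-(j'-j)}\right)^{1/p}.\]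 If $p\ge1$ and $\eta_f(p)>0$, then $f\in L^p_{\mathrm{loc}}$ and it is known that $h_f^{(p)}(x_0)=\liminf_{j\to+\infty}\frac{\log l^{(p)}_{\lambda_j(x_0)}}{\log 2^{-j}}$; for $0<p<1$ with $\eta_f(p)>0$ this formula is the definition of $h_f^{(p)}(x_0)$. $p$-spectrum: $\mathscr D_f^{(p)}(h)=\dim_{\mathcal H}\{x_0\in\mathbb R:h_f^{(p)}(x_0)=h\}$. *)

(* Defs.v *)
From HB Require Import structures.
From mathcomp Require Import all_boot all_order all_algebra.
From mathcomp Require Import all_classical all_reals all_analysis.

Set Implicit Arguments.
Unset Strict Implicit.
Unset Printing Implicit Defensive.

Import Order.TTheory GRing.Theory Num.Theory.
Import numFieldNormedType.Exports.

Local Open Scope classical_set_scope.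
Local Open Scope ring_scope.

(* [lne] is [-oo] at [0], so [log2e 0 = -oo]. *)
Definition log2e {R : realType} (x : \bar R) : \bar R :=
  (lne x * ((ln 2)^-1)%:E)%E.

(* The convention [0 * -oo = -oo]; the library's product gives [0]. *)
Definition mul_ninfty {R : realType} (x y : \bar R) : \bar R :=
  if (x == 0%E) && (y == -oo%E) then -oo%E else (x * y)%E.

(* The maximum with [0] gives the empty set diameter [0]. *)
Definition ediam {R : realType} (U : set R) : \bar R :=
  maxe 0%E (ereal_sup [set (`|x - y|)%:E | x in U & y in U]).

Definition hausdorff_premeasure {R : realType} (s delta : R) (A : set R) :
    \bar R :=
  ereal_inf [set (\sum_(0 <= i <oo) poweR (ediam (U i)) s)%E
            | U in [set U : nat -> set R |
                A `<=` \bigcup_i U i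
                /\ forall i, (ediam (U i) <= delta%:E)%E]].

Definition hausdorff_measure {R : realType} (s : R) (A : set R) : \bar R :=
  ereal_sup [set hausdorff_premeasure s delta A
            | delta in [set delta : R | 0 < delta]].

(* The exponent [s = 0], for which a nonempty set has nonzero measure, does not
   affect the infimum and is left out, which avoids a convention for the [0]-th
   power of the diameter of the empty set. *)
Definition hausdorff_dim {R : realType} (A : set R) : \bar R :=
  if A == set0 then -oo%E
  else ereal_inf [set s%:E
                 | s in [set s : R | 0 < s /\ hausdorff_measure s A = 0%E]].

Definition smooth {R : realType} (phi : R -> R) : Prop :=
  forall (n : nat) (x : R), derivable (derive1n n phi) x 1.

Definition schwartz {R : realType} (phi : R -> R) : Prop :=
  smooth phi /\
  forall m n : nat, exists C : R, forall x : R, `|x| ^+ m * `|derive1n n phi x| <= C.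

Definition periodic_test {R : realType} (phi : R -> R) : Prop :=
  smooth phi /\ periodic phi 1.

(* Continuous linear functionals on the space of smooth one-periodic functions.
   The values of [f] outside of this space are irrelevant. *)
Definition periodic_distribution {R : realType} (f : (R -> R) -> R) : Prop :=
  (forall (a : R) (phi chi : R -> R), periodic_test phi -> periodic_test chi ->
     f (fun x => a * phi x + chi x) = a * f phi + f chi) /\
  exists (N : nat) (C : R), forall (phi : R -> R) (M : R),
    periodic_test phi ->
    (forall (n : nat) (x : R), (n <= N)%N -> `|derive1n n phi x| <= M) ->
    `|f phi| <= C * M.

(* The sum over [l] in [Z], as the limit of the sums over [-n <= l <= n]. *)
Definition wavelet {R : realType} (psi : R -> R) (j k : nat) (x : R) : R :=
  limn (fun n : nat =>
    \sum_(i < n.*2.+1) psi (2 ^+ j * (x - (i%:R - n%:R)) - k%:R)).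

Definition wavelet_unit {R : realType} (psi : R -> R) (j k : nat) (x : R) : R :=
  2 `^ (j%:R / 2) * wavelet psi j k x.

Definition inner01 {R : realType} (g h : R -> R) : R :=
  \int[lebesgue_measure]_(x in `[0, 1]) (g x * h x).

Definition square_integrable01 {R : realType} (g : R -> R) : Prop :=
  measurable_fun (`[0, 1]%classic : set R) g /\
  (\int[lebesgue_measure]_(x in `[0%R, 1%R]) (g x ^+ 2)%:E < +oo)%E.

Definition wavelet_partial_sum {R : realType} (psi g : R -> R) (n : nat)
    (x : R) : R :=
  inner01 g (cst 1) +
  \sum_(j < n) \sum_(k < 2 ^ j)
     inner01 g (wavelet_unit psi j k) * wavelet_unit psi j k x.

(* [1] and the [wavelet_unit psi j k], [k < 2 ^ j], form an orthonormal basis of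
   L^2([0, 1]): they are orthonormal ([1] trivially has norm [1]) and the
   expansion of every square-integrable function converges to it in L^2. *)
Definition mother_wavelet {R : realType} (psi : R -> R) : Prop :=
  [/\ schwartz psi,
      (forall j k : nat, (k < 2 ^ j)%N ->
         inner01 (wavelet_unit psi j k) (cst 1) = 0) /\
      (forall j k j' k' : nat, (k < 2 ^ j)%N -> (k' < 2 ^ j')%N ->
         inner01 (wavelet_unit psi j k) (wavelet_unit psi j' k')
         = ((j == j') && (k == k'))%:R)
    & forall g : R -> R, square_integrable01 g ->
        (fun n : nat => \int[lebesgue_measure]_(x in `[0%R, 1%R])
           ((g x - wavelet_partial_sum psi g n x) ^+ 2)%:E)%E @ \oo --> 0%E].

Definition wavelet_coef {R : realType} (psi : R -> R) (f : (R -> R) -> R)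
    (j k : nat) : R :=
  2 ^+ j * f (wavelet psi j k).

Definition scaling_function {R : realType} (c : nat -> nat -> R) (p : R) :
    \bar R :=
  limn_einf (fun j : nat =>
    - ((j%:R^-1)%:E
       * log2e (2 ^- j * \sum_(k < 2 ^ j) `|c j k| `^ p)%:E))%E.

Definition critical_exponent {R : realType} (c : nat -> nat -> R) : \bar R :=
  ereal_sup [set p%:E
            | p in [set p : R | 0 < p /\ (0 < scaling_function c p)%E]].

Definition wavelet_count {R : realType} (c : nat -> nat -> R)
    (alpha eps : R) (j : nat) : nat :=
  #|[pred k : 'I_(2 ^ j) |
      2 `^ (- (alpha + eps) * j%:R) <= `|c j k| <= 2 `^ (- (alpha - eps) * j%:R)]|.

Definition wavelet_density {R : realType} (c : nat -> nat -> R) (alpha : R) :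
    \bar R :=
  lim (limn_esup (fun j : nat =>
         (j%:R^-1)%:E * log2e ((wavelet_count c alpha eps j)%:R)%:E)%E
       @[eps --> 0^'+]).

Definition dyadic {R : realType} (j k : nat) : set R :=
  [set` `[k%:R / 2 ^+ j, k.+1%:R / 2 ^+ j[ ].

(* [3 lambda_(j, k)], with neighbours taken modulo 1, as a subset of [0, 1). *)
Definition dyadic3 {R : realType} (j k : nat) : set R :=
  dyadic j ((k + (2 ^ j).-1) %% 2 ^ j)%N `|` dyadic j k
  `|` dyadic j (k.+1 %% 2 ^ j)%N.

Definition pleader {R : realType} (c : nat -> nat -> R) (p : R) (j k : nat) :
    \bar R :=
  ereal_sup
    [set ((\sum_(k' < 2 ^ j' | `[< @dyadic R j' k' `<=` dyadic3 j k >])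
             `|c j' k'| `^ p * 2 ^- (j' - j)) `^ p^-1)%:E
    | j' in [set j' : nat | (j <= j')%N]].

(* The [k] such that [lambda_(j, k)] contains [x] modulo 1. *)
Definition dyadic_index {R : realType} (j : nat) (x : R) : nat :=
  Num.truncn (2 ^+ j * (x - (Num.floor x)%:~R)).

Definition locally_Lp {R : realType} (p : R) (F : R -> R) : Prop :=
  measurable_fun setT F /\
  forall a b : R,
    (\int[lebesgue_measure]_(x in `[a, b]) (`|F x| `^ p)%:E < +oo)%E.

Definition represents {R : realType} (F : R -> R) (f : (R -> R) -> R) : Prop :=
  periodic F 1 /\
  forall phi : R -> R, periodic_test phi -> f phi = inner01 phi F.

(* The zero polynomial has degree [-oo]; in particular [P = 0] if
   [alpha <= 0]. *)
Definition Tspace {R : realType} (p alpha x0 : R) (F : R -> R) : Prop :=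
  exists (C : R) (P : {poly R}) (r0 : R),
    [/\ 0 < C, P != 0 -> ((size P).-1)%:R < alpha, 0 < r0
      & forall r : R, 0 < r -> r <= r0 ->
          (poweR ((r^-1)%:E * \int[lebesgue_measure]_(x in ball x0 r)
                     (`|F x - P.[x]| `^ p)%:E) p^-1
           <= (C * r `^ alpha)%:E)%E].

(* For [1 <= p] the exponent is the one of a function in L^p_loc representing
   [f]; such a function is unique up to a null set. *)
Definition pexponent {R : realType} (psi : R -> R) (f : (R -> R) -> R)
    (p x0 : R) : \bar R :=
  if 1 <= p then
    ereal_sup [set alpha%:E | alpha in [set alpha : R |
      - p^-1 <= alpha /\
      exists F : R -> R, [/\ locally_Lp p F, represents F f
                           & Tspace p alpha x0 F]]]
  else
    limn_einf (fun j : nat =>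
      lne (pleader (wavelet_coef psi f) p j (dyadic_index j x0))
      * ((ln (2 ^- j))^-1)%:E)%E.

Definition pspectrum {R : realType} (psi : R -> R) (f : (R -> R) -> R)
    (p h : R) : \bar R :=
  hausdorff_dim [set x0 : R | pexponent psi f p x0 = h%:E].

(* Main.v *)
Require Import Defs.
From HB Require Import structures.
From mathcomp Require Import all_boot all_order all_algebra.
From mathcomp Require Import all_classical all_reals all_analysis.
From mathcomp Require Import ring lra zify.
From mathcomp Require Import measurable_realfun.

(** The bound follows from a count of dyadic intervals. Let [c] be the wavelet
    coefficients of [f]. Since [p] is below the critical exponent, the [p]-th
    moments decay: [\sum_k |c_(j, k)|^p <= 2^((1 - eta) j)] for large [j] and
    some [eta > 0] ([critical_exponent_gt]).

    If the [p]-exponent of [f] at [x] is [h] and [g > h], then for infinitely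
    many [j] the [p]-leader of the interval of scale [j] containing [x] is larger
    than [2^(- g j)] ([large_leader_io]). Hence, if for every [s] above the right
    hand side there is [g > h] such that at most [2^(s j)] intervals of scale [j]
    have such a large leader, covering the points of exponent [h] by these
    intervals bounds the Hausdorff dimension by [s] ([hausdorff_dim_limsup]).

    The count is [large_leader_count]. A large leader comes from a scale
    [j' >= j], and [j' <= K j] because of the decay of the moments. The
    coefficients are sorted, according to their size, into finitely many windows
    around [2^(- alpha j')], with at most about [2^(rho(alpha) j')] coefficients
    in such a window. Each of them is in the enlargement of at most three intervals
    of scale [j], which gives the count [2^(rho(alpha) j')]; by Markov's
    inequality for the sums in the leaders, the count is also at most
    [2^(rho(alpha) j' + h p j - alpha p j' - (j' - j))]. As [rho(alpha) <= alpha p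
    + 1 - eta], the second bound decreases in [j']. For [alpha <= h] the two
    bounds meet at [j' = j (h p + 1) / (alpha p + 1)], which yields the supremum
    over [(- 1 / p, h]] ([window_left]). For [h < alpha < 0], a coefficient of the
    window can make a leader large only if [alpha j' <= h j], and the second bound
    at [j' = j h / alpha] yields the supremum over [[h, 0)] ([window_right]).

    For [p < 1] the exponent is defined by the leaders. For [p >= 1] it is
    defined by local approximation of a function representing [f], and what is
    needed is that leaders at most [2^(- g j)] along [x0] give an exponent larger
    than [h] ([pexponent_gt]). The function is the sum of the wavelet series. It
    represents [f] because the expansion of a test function converges with all
    its derivatives ([recon_cvg]). This rests on the rapid decay of the wavelet
    coefficients of a test function, hence on the vanishing of all moments of the
    wavelet, which follows from the orthogonality ([moment_eq0]).

    Around [x0] the blocks of the series are split into the part of the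
    coefficients near [x0] at a slightly coarser scale, which are controlled by
    the leaders, and the others, which are damped by the decay of the wavelet.
    For some noninteger [a] with [h < a < g], this bounds the derivatives of order
    [m] of the block of scale [j] by [2^((m - a) j)] within the distance [2^(- j)]
    of [x0], and the integral of the [p]-th power of the tail of the series over
    a ball of radius [2^(- i)] by [2^(- (a p + 1) i)] ([local_block_derive_le],
    [local_tail_integral_le]). The sum of the Taylor polynomials of the blocks is
    then the polynomial in the definition of the exponent ([Tspace_series]). *)

Import Order.TTheory GRing.Theory Num.Theory.
Import numFieldNormedType.Exports.

Local Open Scope classical_set_scope.
Local Open Scope ring_scope.

Set Implicit Arguments.
Unset Strict Implicit.
Unset Printing Implicit Defensive.

(** * Powers of two *)

Definition exp2 {R : realType} (x : R) : R := 2 `^ x.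

Section Exp2.
Context {R : realType}.
Implicit Types (x y a b C : R) (n j : nat).

Lemma exp2_gt0 x : 0 < exp2 x. Proof. exact: powR_gt0. Qed.

Lemma exp2_ge0 x : 0 <= exp2 x. Proof. exact: powR_ge0. Qed.

Lemma exp2D x y : exp2 (x + y) = exp2 x * exp2 y.
Proof. by rewrite /exp2 powRD// pnatr_eq0 implybT. Qed.

Lemma exp2N x : exp2 (- x) = (exp2 x)^-1. Proof. exact: powRN. Qed.

Lemma exp2B x y : exp2 (x - y) = exp2 x / exp2 y.
Proof. by rewrite exp2D exp2N. Qed.

Lemma exp20 : exp2 0 = 1 :> R. Proof. exact: powRr0. Qed.

Lemma exp21 : exp2 1 = 2 :> R. Proof. exact: powRr1. Qed.

Lemma exp2_nat n : exp2 n%:R = 2 ^+ n :> R. Proof. exact: powR_mulrn. Qed.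

Lemma exp2_natN n : exp2 (- n%:R) = 2 ^- n :> R.
Proof. by rewrite exp2N exp2_nat. Qed.

Lemma exp2_powR x y : exp2 x `^ y = exp2 (x * y).
Proof. by rewrite /exp2 powRrM. Qed.

Lemma exp2E x : exp2 x = expR (x * ln 2).
Proof. by rewrite /exp2 /powR pnatr_eq0. Qed.

Lemma ln2_gt0 : 0 < ln 2 :> R. Proof. by rewrite ln_gt0// ltr1n. Qed.

Lemma ler_exp2 x y : (exp2 x <= exp2 y) = (x <= y).
Proof. by rewrite !exp2E ler_expR ler_pM2r// ln2_gt0. Qed.

Lemma ltr_exp2 x y : (exp2 x < exp2 y) = (x < y).
Proof. by rewrite !exp2E ltr_expR ltr_pM2r// ln2_gt0. Qed.

Lemma exp2_ex C : 0 < C -> exists x, C = exp2 x.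
Proof.
move=> C0; exists (ln C / ln 2).
by rewrite exp2E divfK ?lnK// gt_eqF// ln2_gt0.
Qed.

Lemma ln_exp2 x : ln (exp2 x) = x * ln 2. Proof. by rewrite exp2E expRK. Qed.

(** An exponential beats a polynomial: the square of the Bernoulli bound
    [1 + e j <= exp (e j)] already dominates the linear factor. *)
Lemma exp2_dominates a b C : a < b ->
  exists J : nat, forall j, (J <= j)%N ->
    C * j.+1%:R * exp2 (a * j%:R) <= exp2 (b * j%:R).
Proof.
move=> ab; pose e := (b - a) * ln 2 / 2.
have e0 : 0 < e by rewrite /e divr_gt0// mulr_gt0 ?subr_gt0 ?ln2_gt0.
pose m := Num.min 1 e.
have m0 : 0 < m by rewrite lt_min ltr01.
exists (Num.truncn (`|C| / m ^+ 2)).+1 => j jJ.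
have -> : b * j%:R = (b - a) * j%:R + a * j%:R by ring.
rewrite exp2D; apply: ler_wpM2r; first exact: exp2_ge0.
have -> : exp2 ((b - a) * j%:R) = expR (e * j%:R) ^+ 2.
  by rewrite exp2E expr2 -expRD; congr expR; rewrite /e; field.
have h1 : m * j.+1%:R <= expR (e * j%:R).
  apply: le_trans (expR_ge1Dx _); rewrite -natr1 mulrDr mulr1 addrC lerD//.
    by rewrite ge_min lexx.
  by apply: ler_wpM2r => //; rewrite ge_min lexx orbT.
have h2 : (m * j.+1%:R) ^+ 2 <= expR (e * j%:R) ^+ 2.
  by rewrite ler_pXn2r// ?nnegrE ?expR_ge0// mulr_ge0// ltW.
apply: le_trans h2; rewrite exprMn expr2 mulrA -ler_pdivrMr ?ltr0n//.
rewrite mulfK ?pnatr_eq0//.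
have h3 : `|C| <= m ^+ 2 * j.+1%:R.
  rewrite mulrC -ler_pdivrMr ?exprn_gt0//.
  apply: le_trans (ltW (truncnS_gt _)) _.
  by rewrite ler_nat (leq_trans jJ).
by have := ler_norm C; move: h3; rewrite expr2 -!mulrA; lra.
Qed.

Lemma exp2_dominates0 a C : 0 < a ->
  exists J : nat, forall j, (J <= j)%N -> C <= exp2 (a * j%:R).
Proof.
move=> a0; have [J HJ] := exp2_dominates `|C| a0.
exists J => j /HJ; rewrite mul0r exp20 mulr1; apply: le_trans.
have : 1 <= j.+1%:R :> R by rewrite ler1n.
by have := ler_norm C; have := normr_ge0 C; nra.
Qed.

Lemma geometric_exp2_le a (n m : nat) : 0 < a ->
  \sum_(n <= j < m) exp2 (- (a * j%:R)) <=
    exp2 (- (a * n%:R)) / (1 - exp2 (- a)).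
Proof.
move=> a0.
have q1 : 0 < 1 - exp2 (- a) by rewrite subr_gt0 -exp20 ltr_exp2 oppr_lt0.
rewrite ler_pdivlMr// mulr_suml.
have [nm|mn] := leqP n m; last by rewrite big_geq ?exp2_ge0// ltnW.
rewrite (eq_bigr (fun j => - (exp2 (- (a * j.+1%:R)) - exp2 (- (a * j%:R))))).
  by rewrite sumrN telescope_sumr// opprB gerBl exp2_ge0.
move=> j _; have -> : - (a * j.+1%:R) = - (a * j%:R) - a.
  by rewrite -natr1; ring.
by rewrite exp2D; ring.
Qed.

End Exp2.

(** * Hausdorff dimension of limsup sets of dyadic intervals *)

Section DyadicIndex.
Context {R : realType}.
Implicit Types (x : R) (j k : nat).

Definition frac_part x : R := x - (Num.floor x)%:~R.

Lemma frac_part_ge0 x : 0 <= frac_part x.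
Proof. by rewrite subr_ge0 floor_le. Qed.

Lemma frac_part_lt1 x : frac_part x < 1.
Proof. by have := floorD1_gt x; rewrite intrD /frac_part; lra. Qed.

Lemma dyadic_index_lt j x : (dyadic_index j x < 2 ^ j)%N.
Proof.
rewrite /dyadic_index truncn_lt_nat ?mulr_ge0 ?exprn_ge0 ?frac_part_ge0//.
by rewrite natrX -[ltRHS]mulr1 ltr_pM2l ?exprn_gt0// frac_part_lt1.
Qed.

Lemma dyadic_index_itv j x :
  (dyadic_index j x)%:R / 2 ^+ j <= frac_part x
    < (dyadic_index j x).+1%:R / 2 ^+ j.
Proof.
rewrite ler_pdivrMr ?exprn_gt0// ltr_pdivlMr ?exprn_gt0// (mulrC (frac_part x)).
by rewrite truncn_itv// mulr_ge0 ?exprn_ge0 ?frac_part_ge0.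
Qed.

End DyadicIndex.

Section Covering.
Context {R : realType}.
Implicit Types (A : set R) (s delta a : R).

Lemma ediam_ge0 (U : set R) : (0 <= ediam U)%E.
Proof. by rewrite /ediam le_max lexx. Qed.

Lemma ediam0 : ediam set0 = 0%E :> \bar R.
Proof.
rewrite /ediam; apply: max_idPl.
by apply: ge_ereal_sup => _ /= [x []].
Qed.

Lemma ediam_itv (u v : R) : u <= v -> (ediam `[u, v[ <= (v - u)%:E)%E.
Proof.
move=> uv; rewrite /ediam ge_max lee_fin subr_ge0 uv /=.
apply: ge_ereal_sup => _ /= [x + [y + <-]].
rewrite !in_itv/= => /andP[? ?] /andP[? ?].
by rewrite lee_fin ler_norml; apply/andP; split; lra.
Qed.

Lemma hausdorff_premeasure_ge0 s delta A : (0 <= hausdorff_premeasure s delta A)%E.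
Proof.
apply: le_ereal_inf_tmp => _ [U _ <-].
  by apply: nneseries_ge0 => *; exact: poweR_ge0.
Qed.

(** Covers indexed by pairs give the same premeasure, as [nat * nat] is
    countable. *)
Lemma hausdorff_premeasure_le2 s delta A (V : nat -> nat -> set R) :
  (forall x, A x -> exists j m, V j m x) ->
  (forall j m, (ediam (V j m) <= delta%:E)%E) ->
  (hausdorff_premeasure s delta A <=
    \sum_(j <oo) \sum_(m <oo) poweR (ediam (V j m)) s)%E.
Proof.
move=> AV Vdelta.
have /card_esym/ppcard_eqP[e] := card_nat2.
have e_bij : set_bij [set: nat] [set: nat * nat] e by [].
apply: ereal_inf_lbound; exists (fun i => V (e i).1 (e i).2).
  split=> [x /AV[j [m Vx]]|i]; last exact: Vdelta.
  have [i _ ei] : (e @` setT) (j, m) by apply: (surj (f := e)).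
  by exists i => //; rewrite ei.
have w0 j m : (0 <= poweR (ediam (V j m)) s)%E by exact: poweR_ge0.
rewrite [LHS]nneseries_esumT; last by move=> i; exact: poweR_ge0.
rewrite [RHS]nneseries_esumT; last first.
  by move=> i; apply: nneseries_ge0 => *; exact: poweR_ge0.
rewrite (eq_esum (fun j _ => nneseries_esumT (w0 j))).
rewrite esum_esum; last by move=> *; exact: poweR_ge0.
rewrite (_ : _ `*`` _ = setT); last by apply/seteqP; split.
by rewrite (reindex_esum setT setT e).
Qed.

Lemma sum_modn (N M : nat) (F : nat -> R) :
  \sum_(0 <= m < N * M) F (m %% M)%N = N%:R * \sum_(k < M) F k.
Proof.
elim: N => [|N IH]; first by rewrite mul0n big_geq// mul0r.
rewrite mulSn addnC (@big_cat_nat _ _ _ (N * M))//= ?leq_addr// IH.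
rewrite -[X in \sum_(X <= _ < _) _]add0n big_addn addKn big_mkord.
rewrite -natr1 mulrDl mul1r; congr (_ + _); apply: eq_bigr => i _.
by rewrite addnC modnMDl modn_small.
Qed.

Lemma nat_of_shifted_int (z : int) (j : nat) : (`|z| <= j)%N ->
  exists2 n : nat, n%:Z = z + j%:Z & (n < j.*2.+1)%N.
Proof. by move=> zj; exists (absz (z + j%:Z)%R); lia. Qed.

Lemma nneseries_le (u : nat -> \bar R) (M : \bar R) :
  (forall i, 0 <= u i)%E ->
  (forall n, \sum_(0 <= i < n) u i <= M)%E -> (\sum_(i <oo) u i <= M)%E.
Proof.
move=> u0 uM; apply: lime_le; first by apply: is_cvg_nneseries => *; exact: u0.
by apply: nearW => n; exact: uM.
Qed.

(** A point met at infinitely many scales by selected intervals is covered, for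
    every [J], by the selected intervals of scale [j >= J] shifted by the
    integers of absolute value at most [j]; the shifts only cost a factor
    linear in [j]. *)
Lemma hausdorff_measure_limsup A (B : nat -> nat -> bool) a s :
  0 < s -> a < s ->
  (forall x, A x -> forall J, exists2 j, (J <= j)%N & B j (dyadic_index j x)) ->
  (exists J, forall j, (J <= j)%N ->
     #|[pred k : 'I_(2 ^ j) | B j k]|%:R <= exp2 (a * j%:R)) ->
  hausdorff_measure s A = 0%E.
Proof.
move=> s0 as_ AB [J0 HJ0]; apply/eqP; rewrite eq_le; apply/andP; split; last first.
  apply: (@le_trans _ _ (hausdorff_premeasure s 1 A)).
    exact: hausdorff_premeasure_ge0.
  by apply: ereal_sup_ubound; exists 1 => //=; exact: ltr01.
apply: ge_ereal_sup => _ /= [delta delta0 <-].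
(* one half of the gap [s - a] absorbs the number of shifts, the other half
   makes the series over the scales converge *)
pose c := (s - a) / 2.
have c0 : 0 < c by rewrite /c divr_gt0// subr_gt0.
have [J1 HJ1] := @exp2_dominates R (a - s) (- c) 2 ltac:(rewrite /c; lra).
have q0 : 0 < 1 - exp2 (- c) by rewrite subr_gt0 -exp20 ltr_exp2 oppr_lt0.
apply/lee_addgt0Pr => eps eps0; rewrite add0e.
have [J2 HJ2] := @exp2_dominates0 R c (eps * (1 - exp2 (- c)))^-1 c0.
have [J3 HJ3] := @exp2_dominates0 R 1 delta^-1 ltr01.
pose J := maxn (maxn J0 J1) (maxn J2 J3).
have [JJ0 JJ1 JJ2 JJ3] : [/\ J0 <= J, J1 <= J, J2 <= J & J3 <= J]%N.
  by rewrite /J !leq_max !leqnn !orbT.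
pose sel j m := [&& (J <= j)%N, (m < j.*2.+1 * 2 ^ j)%N & B j (m %% 2 ^ j)%N].
pose left_end j m : R := (m %/ 2 ^ j)%:R - j%:R + (m %% 2 ^ j)%:R / 2 ^+ j.
pose V j m : set R :=
  if sel j m then `[left_end j m, left_end j m + exp2 (- j%:R)[%classic else set0.
have Vdiam j m : sel j m -> (ediam (V j m) <= (exp2 (- j%:R))%:E)%E.
  rewrite /V => ->.
  apply: le_trans (ediam_itv _) _; first by rewrite lerDl exp2_ge0.
  by rewrite lee_fin addrAC subrr add0r.
apply: le_trans (hausdorff_premeasure_le2 (V := V) s _ _) _.
- move=> x Ax.
  pose K := maxn J (`|Num.floor x|)%N.
  have [j Kj Bj] := AB x Ax K.
  have Jj : (J <= j)%N by apply: leq_trans Kj; rewrite leq_maxl.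
  have fj : (`|Num.floor x| <= j)%N by apply: leq_trans Kj; rewrite leq_maxr.
  have [n nE nj] := nat_of_shifted_int fj.
  have nE' : n%:R - j%:R = (Num.floor x)%:~R :> R.
    by rewrite -[n%:R]/(n%:Z%:~R) nE intrD addrK.
  exists j, (n * 2 ^ j + dyadic_index j x)%N.
  have Dl := dyadic_index_lt j x.
  have -> : V j (n * 2 ^ j + dyadic_index j x)%N =
      `[(Num.floor x)%:~R + (dyadic_index j x)%:R / 2 ^+ j,
        (Num.floor x)%:~R + (dyadic_index j x)%:R / 2 ^+ j + exp2 (- j%:R)[%classic.
    rewrite /V /sel /left_end modnMDl modn_small// Bj Jj andbT /=.
    rewrite divnMDl ?expn_gt0// divn_small// addn0 nE'.
    rewrite ifT//; apply: (@leq_trans (n.+1 * 2 ^ j)); last by rewrite leq_mul2r nj orbT.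
    by rewrite mulSn addnC ltn_add2r.
  have /andP[h1 h2] := dyadic_index_itv j x.
  rewrite /= in_itv/= exp2_natN; move: h1 h2; rewrite /frac_part -(natr1 (dyadic_index j x)) mulrDl mul1r.
  by move=> h1 h2; apply/andP; split; lra.
- move=> j m; have [sjm|nsjm] := boolP (sel j m).
    apply: le_trans (Vdiam _ _ sjm) _; rewrite lee_fin exp2N.
    have Jj : (J3 <= j)%N by case/and3P: sjm => /(leq_trans JJ3).
    by rewrite -[leRHS]invrK lef_pV2 ?posrE ?exp2_gt0 ?invr_gt0// -[j%:R]mul1r HJ3.
  by rewrite /V (negbTE nsjm) ediam0 lee_fin ltW.
have Vw j m : (poweR (ediam (V j m)) s <= (if sel j m then exp2 (- (s * j%:R)) else 0)%:E)%E.
  case: ifPn => sjm; last first.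
    by rewrite /V (negbTE sjm) ediam0 poweR0r ?gt_eqF.
  rewrite -mulrN mulrC -exp2_powR -poweR_EFin.
  apply: gt0_ler_poweR (Vdiam _ _ sjm); rewrite ?ltW// in_itv/= ?andbT ?leey ?ediam_ge0//.
  by rewrite lee_fin exp2_ge0.
have inner j : (\sum_(m <oo) poweR (ediam (V j m)) s <=
    (if (J <= j)%N then exp2 (- (c * j%:R)) else 0)%:E)%E.
  apply: nneseries_le => [m|n]; first exact: poweR_ge0.
  apply: (@le_trans _ _ (\sum_(0 <= m < n) (if sel j m then exp2 (- (s * j%:R)) else 0)%:E)%E).
    by apply: lee_sum => m _; exact: Vw.
  rewrite sumEFin lee_fin.
  case: (leqP J j) => Jj; last first.
    by rewrite big1// => m _; rewrite /sel leqNgt Jj.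
  apply: (@le_trans _ _ (\sum_(0 <= m < j.*2.+1 * 2 ^ j)
      (if B j (m %% 2 ^ j)%N then exp2 (- (s * j%:R)) else 0))).
    pose G m : R := if sel j m then exp2 (- (s * j%:R)) else 0.
    have G0 m : 0 <= G m by rewrite /G; case: ifP => // _; exact: exp2_ge0.
    apply: (@le_trans _ _ (\sum_(0 <= m < maxn n (j.*2.+1 * 2 ^ j)) G m)).
      rewrite [leRHS](@big_cat_nat _ _ _ n)//= ?leq_maxl// lerDl.
      by apply: sumr_ge0 => *; exact: G0.
    rewrite [leLHS](@big_cat_nat _ _ _ (j.*2.+1 * 2 ^ j))//= ?leq_maxr//.
    rewrite [X in _ + X]big_nat_cond [X in _ + X]big1 ?addr0; last first.
      by move=> m /andP[/andP[h _] _]; rewrite /G /sel ltnNge h andbF.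
    rewrite big_nat_cond [leRHS]big_nat_cond; apply: ler_sum => m /andP[/andP[_ h] _].
    by rewrite /G /sel Jj h.
  rewrite (@sum_modn _ _ (fun k => if B j k then exp2 (- (s * j%:R)) else 0)).
  rewrite -big_mkcond/= sumr_const -[X in _ * X]mulr_natl.
  have := HJ0 j (leq_trans JJ0 Jj); set b := (X in X%:R <= _) => Hb.
  apply: (@le_trans _ _ (2 * j.+1%:R * (exp2 (a * j%:R) * exp2 (- (s * j%:R))))).
    apply: ler_pM => //; first by rewrite mulr_ge0 ?exp2_ge0.
      by rewrite -natrM ler_nat; lia.
    by rewrite ler_wpM2r ?exp2_ge0.
  rewrite -exp2D -mulrBl -[X in _ <= exp2 X]mulNr; exact: HJ1 (leq_trans JJ1 Jj).
apply: nneseries_le => [j|n].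
  by apply: nneseries_ge0 => *; exact: poweR_ge0.
apply: (le_trans (lee_sum _ (fun j _ => inner j))).
rewrite sumEFin lee_fin.
apply: (@le_trans _ _ (\sum_(J <= j < maxn n J) exp2 (- (c * j%:R)))).
  apply: (@le_trans _ _ (\sum_(0 <= j < maxn n J)
     (if (J <= j)%N then exp2 (- (c * j%:R)) else 0))).
    rewrite [leRHS](@big_cat_nat _ _ _ n)//= ?leq_maxl// lerDl.
    by apply: sumr_ge0 => j _; case: ifP => // _; exact: exp2_ge0.
  rewrite [leLHS](@big_cat_nat _ _ _ J)//= ?leq_maxr//.
  rewrite [X in X + _]big_nat_cond [X in X + _]big1 ?add0r; last first.
    by move=> j /andP[/andP[_ h] _]; rewrite leqNgt h.
  by rewrite big_nat_cond [leRHS]big_nat_cond; apply: ler_sum => j /andP[/andP[-> _] _].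
apply: le_trans (geometric_exp2_le _ _ c0) _.
rewrite ler_pdivrMr// exp2N -[leRHS]invrK lef_pV2 ?posrE ?exp2_gt0 ?invr_gt0 ?mulr_gt0//.
exact: HJ2.
Qed.

(** A negative [a] is covered too: then no interval is selected at large
    scales, so the set is empty. *)
Lemma hausdorff_dim_limsup A (B : nat -> nat -> bool) a :
  (forall x, A x -> forall J, exists2 j, (J <= j)%N & B j (dyadic_index j x)) ->
  (exists J, forall j, (J <= j)%N ->
     #|[pred k : 'I_(2 ^ j) | B j k]|%:R <= exp2 (a * j%:R)) ->
  (hausdorff_dim A <= a%:E)%E.
Proof.
move=> AB Bcard; rewrite /hausdorff_dim; case: ifPn => [_|/set0P[x Ax]].
  exact: leNye.
have a0 : 0 <= a.
  rewrite leNgt; apply/negP => a0; have [J HJ] := Bcard.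
  have [j Jj Bj] := AB x Ax (maxn J 1).
  have : #|[pred k : 'I_(2 ^ j) | B j k]|%:R < 1 :> R.
    apply: le_lt_trans (HJ j _) _; first by apply: leq_trans Jj; rewrite leq_maxl.
    rewrite -[ltRHS]exp20 ltr_exp2 nmulr_rlt0// ltr0n.
    by apply: leq_trans Jj; rewrite leq_maxr.
  rewrite -[ltRHS]/(1%:R) ltr_nat ltnS leqn0 => /eqP card0.
  by have := card0_eq card0 (Ordinal (dyadic_index_lt j x)); rewrite inE/= Bj.
apply/lee_addgt0Pr => e e0; rewrite -EFinD.
apply: ereal_inf_lbound; exists (a + e) => //; split; first by lra.
by apply: (@hausdorff_measure_limsup A B a) => //; lra.
Qed.

(** Select all the dyadic intervals. *)
Lemma hausdorff_dim_le1 A : (hausdorff_dim A <= 1)%E.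
Proof.
apply: (@hausdorff_dim_limsup A (fun _ _ => true)) => [x _ J|].
  by exists J.
exists 0%N => j _; rewrite mul1r exp2_nat -natrX ler_nat.
by apply: leq_trans (max_card _) _; rewrite card_ord.
Qed.

End Covering.

(** * Scaling function and wavelet density as eventual bounds *)

Section EventualBounds.
Context {R : realType}.
Implicit Types (u : (\bar R)^nat) (c : nat -> nat -> R).

Lemma limn_esup_lt u (a : \bar R) : (limn_esup u < a)%E ->
  exists N, forall n, (N <= n)%N -> (u n < a)%E.
Proof.
rewrite limn_esup_lim (cvg_lim _ (@cvg_esups_inf _ u))// => /ereal_inf_lt.
move=> [_ [N _ <-] uNa]; exists N => n Nn; apply: le_lt_trans uNa.
by apply: ereal_sup_ubound; exists n.
Qed.

Lemma limn_esup_le u (a : \bar R) N : (forall n, (N <= n)%N -> (u n <= a)%E) ->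
  (limn_esup u <= a)%E.
Proof.
move=> ua; rewrite limn_esup_lim (cvg_lim _ (@cvg_esups_inf _ u))//.
apply: (@le_trans _ _ (esups u N)); first by apply: ereal_inf_lbound; exists N.
by apply: ge_ereal_sup => _ [n Nn <-]; exact: ua.
Qed.

Lemma limn_einf_gt u (a : \bar R) : (a < limn_einf u)%E ->
  exists N, (a < einfs u N)%E /\ forall n, (N <= n)%N -> (einfs u N <= u n)%E.
Proof.
rewrite limn_einf_lim (cvg_lim _ (@cvg_einfs_sup _ u))// => /ereal_sup_gt.
move=> [_ [N _ <-] uNa]; exists N; split=> // n Nn.
by apply: ereal_inf_lbound; exists n.
Qed.

Lemma limn_einf_ge u (a : \bar R) N : (forall n, (N <= n)%N -> (a <= u n)%E) ->
  (a <= limn_einf u)%E.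
Proof.
move=> ua; rewrite limn_einf_lim (cvg_lim _ (@cvg_einfs_sup _ u))//.
apply: (@le_trans _ _ (einfs u N)); last by apply: ereal_sup_ubound; exists N.
by apply: le_ereal_inf_tmp => _ [n Nn <-]; exact: ua.
Qed.

(** The form in which all asymptotic hypotheses are used. It includes [X = 0],
    where the logarithm is [-oo]. *)
Lemma log2e_le (j : nat) (X b : R) : (0 < j)%N -> 0 <= X ->
  ((j%:R^-1)%:E * log2e X%:E <= b%:E)%E = (X <= exp2 (b * j%:R)).
Proof.
move=> j0 X0; have j0' : 0 < j%:R :> R by rewrite ltr0n.
have [X1|X1] := leP X 0.
  have -> : X = 0 by apply/eqP; rewrite eq_le X1.
  rewrite exp2_ge0 /log2e le0_lneNy// gt0_mulNye ?lte_fin ?invr_gt0 ?ln2_gt0//.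
  by rewrite gt0_muleNy ?lte_fin ?invr_gt0// leNye.
rewrite /log2e lne_EFin// -!EFinM lee_fin -{2}[X]lnK ?posrE// exp2E ler_expR.
by rewrite mulrC ler_pdivrMr// ler_pdivrMr ?ln2_gt0.
Qed.

Lemma scaling_function_gt0 c (q : R) : (0 < scaling_function c q)%E ->
  exists2 eta, 0 < eta & exists J, forall j, (J <= j)%N ->
    2 ^- j * \sum_(k < 2 ^ j) `|c j k| `^ q <= exp2 (- eta * j%:R).
Proof.
move=> /limn_einf_gt[N [e0 eu]].
have [eta eta0 etae] : exists2 eta, 0 < eta & (eta%:E <= einfs (fun j : nat =>
    - ((j%:R^-1)%:E
       * log2e (2 ^- j * \sum_(k < 2 ^ j) `|c j k| `^ q)%:E))%E N)%E.
  move: e0; case: (einfs _ _) => [r r0|_|//]; first by exists r.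
  by exists 1 => //; rewrite leey.
exists eta => //; exists N.+1 => j Nj.
rewrite -log2e_le; last 2 first.
- by apply: leq_trans Nj.
- by rewrite mulr_ge0 ?invr_ge0 ?exprn_ge0// sumr_ge0// => *; exact: powR_ge0.
rewrite EFinN leeNr; apply: le_trans etae _; exact: eu (ltnW Nj).
Qed.

(** Below the critical exponent the [p]-th moments decay too. Jensen's
    inequality is replaced by [u `^ p <= B `^ p + B `^ (p - q) * u `^ q]. *)
Lemma critical_exponent_gt c (p : R) : 0 < p ->
  (p%:E < critical_exponent c)%E ->
  exists2 eta, 0 < eta & exists J, forall j, (J <= j)%N ->
    \sum_(k < 2 ^ j) `|c j k| `^ p <= exp2 ((1 - eta) * j%:R).
Proof.
move=> p0 /ereal_sup_gt[_ [q [q0 /scaling_function_gt0[eta eta0 [J HJ]]] <-]].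
rewrite lte_fin => pq.
pose e := eta * p / q.
have e0 : 0 < e by rewrite divr_gt0// mulr_gt0.
have [J1 HJ1] := @exp2_dominates0 R (e / 2) 2 ltac:(by rewrite divr_gt0).
exists (e / 2); first by rewrite divr_gt0.
exists (maxn J J1) => j; rewrite geq_max => /andP[/HJ Hj /HJ1 Hj1].
pose B := exp2 (- (eta / q) * j%:R) : R.
have B0 : 0 < B by exact: exp2_gt0.
have step (u : R) : 0 <= u -> u `^ p <= B `^ p + B `^ (p - q) * u `^ q.
  move=> u0; have [uB|Bu] := leP u B.
    apply: le_trans (ge0_ler_powR (ltW p0) _ _ uB) _; rewrite ?nnegrE ?(ltW B0)//.
    by rewrite lerDl mulr_ge0 ?powR_ge0.
  rewrite -[leLHS]add0r lerD ?powR_ge0//.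
  have u1 : 0 < u by exact: lt_trans Bu.
  have -> : p = (p - q) + q by ring.
  rewrite powRD; last by rewrite (gt_eqF u1) implybT.
  rewrite addrK ler_wpM2r ?powR_ge0//.
  rewrite -(opprB q p) !powRN lef_pV2 ?posrE ?powR_gt0//.
  by apply: ge0_ler_powR; rewrite ?nnegrE ?subr_ge0 ?ltW.
have sq : \sum_(k < 2 ^ j) `|c j k| `^ q <= 2 ^+ j * exp2 (- eta * j%:R).
  by rewrite mulrC -ler_pdivrMr ?exprn_gt0// mulrC.
apply: (@le_trans _ _ (\sum_(k < 2 ^ j) (B `^ p + B `^ (p - q) * `|c j k| `^ q))).
  by apply: ler_sum => k _; exact: step.
rewrite big_split/= -mulr_sumr sumr_const card_ord -[_ *+ _]mulr_natl natrX.
apply: (@le_trans _ _ (2 ^+ j * (2 * exp2 (- e * j%:R)))).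
  have -> : exp2 (- e * j%:R) = B `^ p.
    by rewrite exp2_powR /e; congr exp2; field; rewrite gt_eqF.
  rewrite mulr_natl mulr2n mulrDr lerD//.
  apply: le_trans (ler_wpM2l (powR_ge0 _ _) sq) _.
  rewrite mulrCA ler_pM2l ?exprn_gt0// exp2_powR -exp2D exp2_powR ler_exp2.
  rewrite le_eqVlt; apply/orP; left; apply/eqP; field.
  by rewrite gt_eqF.
rewrite -exp2_nat.
apply: (@le_trans _ _ (exp2 j%:R * (exp2 (e / 2 * j%:R) * exp2 (- e * j%:R)))).
  by rewrite ler_pM2l ?exp2_gt0// ler_pM2r ?exp2_gt0.
rewrite -!exp2D ler_exp2 le_eqVlt; apply/orP; left; apply/eqP; by field.
Qed.

Definition density_at c (alpha eps : R) : \bar R :=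
  limn_esup (fun j : nat =>
    (j%:R^-1)%:E * log2e ((wavelet_count c alpha eps j)%:R)%:E)%E.

Lemma wavelet_count_mono c (alpha e e' : R) j : e <= e' ->
  (wavelet_count c alpha e j <= wavelet_count c alpha e' j)%N.
Proof.
move=> ee'; apply: subset_leq_card; apply/fintype.subsetP => k; rewrite !inE.
move=> /andP[h1 h2]; apply/andP; split.
  by apply: le_trans h1; rewrite -/(exp2 _) -/(exp2 _) ler_exp2 ler_wpM2r//; lra.
by apply: (le_trans h2); rewrite -/(exp2 _) -/(exp2 _) ler_exp2 ler_wpM2r//; lra.
Qed.

Lemma log2e_mono (j : nat) (X Y : R) : 0 <= X -> X <= Y ->
  ((j%:R^-1)%:E * log2e X%:E <= (j%:R^-1)%:E * log2e Y%:E)%E.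
Proof.
move=> X0 XY; apply: lee_wpmul2l; first by rewrite lee_fin invr_ge0.
apply: lee_wpmul2r; first by rewrite lee_fin invr_ge0 ltW ?ln2_gt0.
have [X1|X1] := leP X 0; first by rewrite le0_lneNy ?leNye ?lee_fin.
by rewrite !lne_EFin ?(lt_le_trans X1)// lee_fin ler_ln ?posrE ?(lt_le_trans X1).
Qed.

Lemma density_at_mono c (alpha e e' : R) : e <= e' ->
  (density_at c alpha e <= density_at c alpha e')%E.
Proof.
move=> ee'; rewrite /density_at !limn_esup_lim.
apply: lee_lim; [exact: is_cvg_esups|exact: is_cvg_esups|].
apply: nearW => n; apply: ge_ereal_sup => _ [k nk <-].
apply: (@le_trans _ _ ((k%:R^-1)%:E * log2e ((wavelet_count c alpha e' k)%:R)%:E)%E).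
  by apply: log2e_mono => //; rewrite ler_nat wavelet_count_mono.
by apply: ereal_sup_ubound; exists k.
Qed.

Lemma wavelet_densityE c (alpha : R) :
  wavelet_density c alpha = ereal_inf (density_at c alpha @` `]0, +oo[).
Proof.
have mono : {in `]0, +oo[ &, {homo density_at c alpha : x y / x <= y >-> (x <= y)%E}}.
  by move=> x y _ _ xy; exact: density_at_mono.
have lim0 := @nondecreasing_at_right_cvge R _ 0 (BInfty _ false) isT mono.
exact: (cvg_lim (@ereal_hausdorff R) lim0).
Qed.

Lemma wavelet_density_lt c (alpha a : R) : (wavelet_density c alpha < a%:E)%E ->
  exists2 eps, 0 < eps & exists J, forall j, (J <= j)%N ->
    (wavelet_count c alpha eps j)%:R <= exp2 (a * j%:R).
Proof.
rewrite wavelet_densityE => /ereal_inf_lt[_ [eps + <-]].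
rewrite /= in_itv/= andbT => eps0 /limn_esup_lt[N HN].
exists eps => //; exists N.+1 => j Nj.
by rewrite -log2e_le ?(leq_trans _ Nj)//; apply: ltW; exact: HN (ltnW Nj).
Qed.

(** A coefficient of size [2^(- (alpha + eps) j)] uses up at least
    [2^(- (alpha + eps) p j)] of the [p]-th moment. *)
Lemma wavelet_density_le c (p eta alpha : R) : 0 < p ->
  (exists J, forall j, (J <= j)%N ->
    \sum_(k < 2 ^ j) `|c j k| `^ p <= exp2 ((1 - eta) * j%:R)) ->
  (wavelet_density c alpha <= (alpha * p + 1 - eta)%:E)%E.
Proof.
move=> p0 [J HJ]; apply/lee_addgt0Pr => e e0.
rewrite wavelet_densityE -EFinD.
apply: (@le_trans _ _ (density_at c alpha (e / p))).
  apply: ereal_inf_lbound; exists (e / p) => //.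
  by rewrite /= in_itv/= andbT divr_gt0.
apply: (@limn_esup_le _ _ J.+1) => j Jj.
rewrite log2e_le ?(leq_trans _ Jj)//.
have := HJ j (ltnW Jj) => {}HJ.
rewrite -(ler_pM2r (exp2_gt0 (- ((alpha + e / p) * p * j%:R)))) -exp2D.
apply: le_trans (le_trans HJ _); last first.
  rewrite ler_exp2 le_eqVlt; apply/orP; left; apply/eqP; field.
  by rewrite gt_eqF.
rewrite (bigID [pred k : 'I_(2 ^ j) |
   2 `^ (- (alpha + e / p) * j%:R) <= `|c j k| <= 2 `^ (- (alpha - e / p) * j%:R)])/=.
apply: ler_wpDr; first by apply: sumr_ge0 => *; exact: powR_ge0.
rewrite /wavelet_count mulr_natl -sumr_const.
apply: ler_sum => k; rewrite inE => /andP[h _].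
have -> : exp2 (- ((alpha + e / p) * p * j%:R)) = (exp2 (- (alpha + e / p) * j%:R)) `^ p.
  by rewrite exp2_powR; congr exp2; ring.
by apply: ge0_ler_powR; rewrite ?nnegrE ?exp2_ge0 ?(ltW p0).
Qed.

End EventualBounds.

(** * Counting large leaders *)

(** The arithmetic form of the inclusion of a dyadic interval in the
    threefold enlargement of another one. *)
Definition near3 (j k j' k' : nat) : bool :=
  (k' %/ 2 ^ (j' - j))%N \in
    [:: ((k + (2 ^ j).-1) %% 2 ^ j)%N; k; (k.+1 %% 2 ^ j)%N].

Lemma prev_modE M k : (k < M)%N ->
  ((k + M.-1) %% M)%N = (if k == 0%N then M.-1 else k.-1).
Proof.
move=> kM; case: eqP => [->|k0]; first by rewrite add0n modn_small//; lia.
have -> : (k + M.-1 = M + k.-1)%N by lia.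
by rewrite modnDl modn_small//; lia.
Qed.

Lemma next_modE M k : (k < M)%N ->
  (k.+1 %% M)%N = (if k.+1 == M then 0%N else k.+1).
Proof.
move=> kM; case: eqP => [->|k0]; first by rewrite modnn.
by rewrite modn_small//; lia.
Qed.

Lemma near3_sym j k j' k' : (k < 2 ^ j)%N -> near3 j k j' k' ->
  (k' %/ 2 ^ (j' - j) < 2 ^ j)%N ->
  k \in [:: ((k' %/ 2 ^ (j' - j) + (2 ^ j).-1) %% 2 ^ j)%N;
            (k' %/ 2 ^ (j' - j))%N; ((k' %/ 2 ^ (j' - j)).+1 %% 2 ^ j)%N].
Proof.
rewrite /near3; set q := (k' %/ _)%N; set M := (2 ^ j)%N => kM + qM.
rewrite !inE !prev_modE// !next_modE//.
by do ![case: ifP => [/eqP|/eqP]]; lia.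
Qed.

Lemma div_near_lt j j' k' : (j <= j')%N -> (k' < 2 ^ j')%N ->
  (k' %/ 2 ^ (j' - j) < 2 ^ j)%N.
Proof.
by move=> jj' k'j'; rewrite ltn_divLR ?expn_gt0// -expnD subnKC.
Qed.

Lemma card_near_out j j' k' : (j <= j')%N -> (k' < 2 ^ j')%N ->
  (#|[pred k : 'I_(2 ^ j) | near3 j k j' k']| <= 3)%N.
Proof.
move=> jj' k'j'; have qM := div_near_lt jj' k'j'.
rewrite cardE -(size_map val).
set q := (k' %/ 2 ^ (j' - j))%N in qM *.
apply: (@uniq_leq_size _ _ [:: ((q + (2 ^ j).-1) %% 2 ^ j)%N; q;
                               (q.+1 %% 2 ^ j)%N]).
  by rewrite map_inj_uniq ?enum_uniq//; exact: val_inj.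
by move=> _ /mapP[k + ->]; rewrite mem_enum inE => /near3_sym; exact.
Qed.

Lemma card_near_in j j' k : 
  (#|[pred k' : 'I_(2 ^ j') | near3 j k j' k']| <= 3 * 2 ^ (j' - j))%N.
Proof.
rewrite cardE -(size_map val); set D := (2 ^ (j' - j))%N.
have D0 : (0 < D)%N by rewrite expn_gt0.
set a := ((k + (2 ^ j).-1) %% 2 ^ j)%N; set b := (k.+1 %% 2 ^ j)%N.
apply: (@leq_trans (size (iota (a * D) D ++ iota (k * D) D ++ iota (b * D) D))).
  apply: uniq_leq_size.
    by rewrite map_inj_uniq ?enum_uniq//; exact: val_inj.
  move=> _ /mapP[k' + ->]; rewrite mem_enum inE /near3 -/D -/a -/b !inE.
  have h q : ((k' %/ D)%N == q) -> (val k' \in iota (q * D) D).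
    by move=> /eqP <-; rewrite mem_iota leq_divM addnC -mulSn ltn_ceil.
  by rewrite !mem_cat => /or3P[] /h ->; rewrite ?orbT.
by rewrite !size_cat !size_iota; lia.
Qed.

Section LeaderSums.
Context {R : realType} (c : nat -> nat -> R) (p : R).

(** Restricting the sum in a [p]-leader to [W] allows to sort the coefficients
    by their sizes. *)
Definition leader_part (W : pred nat) (j k j' : nat) : R :=
  \sum_(k' < 2 ^ j' | near3 j k j' k' && W k') `|c j' k'| `^ p * 2 ^- (j' - j).

Definition leader_sum := leader_part predT.

Lemma leader_part_ge0 (W : pred nat) j k j' : 0 <= leader_part W j k j'.
Proof.
by apply: sumr_ge0 => k' _; rewrite mulr_ge0 ?powR_ge0// invr_ge0 exprn_ge0.
Qed.

Lemma leader_part_le (W : pred nat) j k j' (M : R) : (j <= j')%N -> 0 <= M ->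
  (forall k', (k' < 2 ^ j')%N -> W k' -> `|c j' k'| `^ p <= M) ->
  leader_part W j k j' <= 3 * M.
Proof.
move=> jj' M0 cM.
apply: (@le_trans _ _ (\sum_(k' < 2 ^ j' | near3 j k j' k') M * 2 ^- (j' - j))).
  rewrite /leader_part big_mkcondr/=.
  apply: ler_sum => k' _; case: ifPn => [Wk'|_].
    by rewrite ler_wpM2r ?invr_ge0 ?exprn_ge0// cM.
  by rewrite mulr_ge0// invr_ge0 exprn_ge0.
rewrite sumr_const -[leLHS]mulr_natl.
apply: (@le_trans _ _ ((3 * 2 ^ (j' - j))%:R * (M * 2 ^- (j' - j)))).
  by rewrite ler_wpM2r ?ler_nat ?card_near_in// mulr_ge0// invr_ge0 exprn_ge0.
by rewrite natrM natrX mulrACA mulfV ?mulr1 ?expf_neq0.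
Qed.

Section DoubleCounting.
Variables (W : pred nat) (j j' : nat) (t M : R).
Hypotheses (jj' : (j <= j')%N) (t0 : 0 < t) (M0 : 0 <= M).
Hypothesis cM : forall k', (k' < 2 ^ j')%N -> W k' -> `|c j' k'| `^ p <= M.

Let B := [pred k : 'I_(2 ^ j) | t < leader_part W j k j'].
Let N := #|[pred k' : 'I_(2 ^ j') | W k']|.

(** Each [k'] is near at most three [k]. *)
Lemma sum_near_le (F : nat -> R) : (forall k', 0 <= F k') ->
  \sum_(k | B k) \sum_(k' < 2 ^ j' | near3 j k j' k' && W k') F k' <=
  3 * \sum_(k' < 2 ^ j' | W k') F k'.
Proof.
move=> F0.
apply: (@le_trans _ _
  (\sum_(k < 2 ^ j) \sum_(k' < 2 ^ j' | near3 j k j' k' && W k') F k')).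
  rewrite big_mkcond/=; apply: ler_sum => k _; case: ifP => // _.
  by apply: sumr_ge0 => *; exact: F0.
rewrite (exchange_big_dep (fun k' : 'I_(2 ^ j') => W k'))/=; last first.
  by move=> k k' _ /andP[].
rewrite mulr_sumr; apply: ler_sum => k' Wk'.
rewrite (eq_bigl (fun k : 'I_(2 ^ j) => near3 j k j' k')); last first.
  by move=> k; rewrite Wk' andbT.
rewrite sumr_const -[leLHS]mulr_natl ler_wpM2r// ler_nat.
exact: card_near_out.
Qed.

Lemma card_large_le : (#|B|%:R <= 3 * N%:R :> R).
Proof.
apply: (@le_trans _ _
  (\sum_(k | B k) \sum_(k' < 2 ^ j' | near3 j k j' k' && W k') (1:R))).
  rewrite -sum1_card natr_sum; apply: ler_sum => k Bk.
  rewrite sumr_const ler_nat lt0n; apply/negP => /eqP card0.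
  have := Bk; rewrite inE /leader_part big_pred0 ?ltNge ?(ltW t0)// => k'.
  by have := card0_eq card0 k'; rewrite inE.
apply: le_trans (@sum_near_le (fun _ => 1) _) _ => //.
by rewrite sumr_const ler_pM2l.
Qed.

(** Markov's inequality for the sums, each coefficient being counted at most
    three times. *)
Lemma card_large_mass_le : #|B|%:R * t <= 3 * N%:R * (M * 2 ^- (j' - j)).
Proof.
apply: (@le_trans _ _ (\sum_(k | B k) leader_part W j k j')).
  by rewrite mulr_natl -sumr_const; apply: ler_sum => k /ltW.
apply: le_trans (@sum_near_le (fun k' => `|c j' k'| `^ p * 2 ^- (j' - j)) _) _.
  by move=> k'; rewrite mulr_ge0 ?powR_ge0// invr_ge0 exprn_ge0.
rewrite -mulrA ler_pM2l// mulr_natl -sumr_const; apply: ler_sum => k' Wk'.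
by rewrite ler_wpM2r ?invr_ge0 ?exprn_ge0// cM.
Qed.

Lemma large_threshold_le k : B k -> t <= 3 * M.
Proof. by move=> /ltW h; apply: le_trans h _; exact: leader_part_le. Qed.

End DoubleCounting.
End LeaderSums.

Section WindowCounting.
Context {R : realType} (c : nat -> nat -> R) (p eta h s0 s : R).
Hypotheses (p0 : 0 < p) (eta0 : 0 < eta).
Hypothesis moment_le : exists J, forall j, (J <= j)%N ->
  \sum_(k < 2 ^ j) `|c j k| `^ p <= exp2 ((1 - eta) * j%:R).
Hypothesis s0_ge_left : forall alpha r : R,
  wavelet_density c alpha = r%:E -> 0 <= r -> - p^-1 < alpha <= h ->
  (h + p^-1) * (r / (alpha + p^-1)) <= s0.
Hypothesis s0_ge_right : forall alpha r : R,
  wavelet_density c alpha = r%:E -> 0 <= r -> h <= alpha < 0 ->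
  (r - 1) * (h / alpha) + 1 <= s0.
Hypothesis s0s : s0 < s.

Definition window (alpha e : R) (j : nat) : pred nat := fun k =>
  2 `^ (- (alpha + e) * j%:R) <= `|c j k| <= 2 `^ (- (alpha - e) * j%:R).

Lemma card_windowE alpha e j :
  #|[pred k : 'I_(2 ^ j) | window alpha e j k]| = wavelet_count c alpha e j.
Proof. by []. Qed.

(** The factor [L] leaves room for adding up several windows. *)
Definition window_bad (alpha e L g : R) (j j' : nat) : nat :=
  #|[pred k : 'I_(2 ^ j) |
      exp2 (- (g * p) * j%:R) / L < leader_part c p (window alpha e j') j k j']|.

Lemma window_powR_le alpha e j k : window alpha e j k ->
  `|c j k| `^ p <= exp2 (- ((alpha - e) * p) * j%:R).
Proof.
move=> /andP[_ h2].
have -> : exp2 (- ((alpha - e) * p) * j%:R) = (exp2 (- (alpha - e) * j%:R)) `^ p.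
  by rewrite exp2_powR; congr exp2; ring.
by apply: ge0_ler_powR; rewrite ?nnegrE ?exp2_ge0 ?(ltW p0).
Qed.

Lemma window_bad_le (a alpha e L g : R) (j j' : nat) : (j <= j')%N -> 1 <= L ->
  (wavelet_count c alpha e j')%:R <= exp2 (a * j'%:R) ->
  (window_bad alpha e L g j j')%:R <= 3 * exp2 (a * j'%:R) /\
  (window_bad alpha e L g j j')%:R <= 3 * L *
    exp2 (a * j'%:R + g * p * j%:R - (alpha - e) * p * j'%:R - (j'%:R - j%:R)).
Proof.
move=> jj' L1 Na; have L0 : 0 < L by exact: lt_le_trans L1.
have t0 : 0 < exp2 (- (g * p) * j%:R) / L by rewrite divr_gt0 ?exp2_gt0.
have M0 := exp2_ge0 (- ((alpha - e) * p) * j'%:R).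
have cM k : (k < 2 ^ j')%N -> window alpha e j' k ->
  `|c j' k| `^ p <= exp2 (- ((alpha - e) * p) * j'%:R).
  by move=> _; exact: window_powR_le.
split.
  apply: le_trans (card_large_le c p (window alpha e j') jj' t0) _.
  by rewrite card_windowE ler_pM2l.
have := card_large_mass_le (exp2 (- (g * p) * j%:R) / L) jj' cM.
rewrite card_windowE -/(window_bad alpha e L g j j') => H.
rewrite -(ler_pM2r t0); apply: (le_trans H).
apply: (@le_trans _ _ (3 * exp2 (a * j'%:R) *
   (exp2 (- ((alpha - e) * p) * j'%:R) * 2 ^- (j' - j)))).
  by rewrite ler_wpM2r ?ler_pM2l// mulr_ge0 ?exp2_ge0// invr_ge0 exprn_ge0.
have -> : 2 ^- (j' - j) = exp2 (- (j'%:R - j%:R)) :> R.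
  by rewrite -exp2_natN natrB.
have -> : forall X Y : R, 3 * L * X * (Y / L) = 3 * (X * Y).
  by move=> X Y; field; rewrite gt_eqF.
rewrite -mulrA -!exp2D.
by rewrite ler_pM2l// ler_exp2 le_eqVlt; apply/orP; left; apply/eqP; ring.
Qed.

(** One large sum bounds the ratio [j' / j] for the windows with negative
    [alpha], because the coefficients of a window have comparable sizes. *)
Lemma window_bad_gt0 (alpha e L g : R) (j j' : nat) : (j <= j')%N -> 1 <= L ->
  (0 < window_bad alpha e L g j j')%N ->
  exp2 (- (g * p) * j%:R) <= 3 * L * exp2 (- ((alpha - e) * p) * j'%:R).
Proof.
move=> jj' L1 /card_gt0P[k]; have L0 : 0 < L by exact: lt_le_trans L1.
have t0 : 0 < exp2 (- (g * p) * j%:R) / L by rewrite divr_gt0 ?exp2_gt0.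
rewrite inE => Bk.
rewrite mulrAC -ler_pdivrMr//.
apply: (large_threshold_le jj' (exp2_ge0 _) _ Bk).
by move=> k' _; exact: window_powR_le.
Qed.

Lemma window_empty alpha : (wavelet_density c alpha < 0)%E ->
  exists2 e, 0 < e & forall L, 1 <= L -> exists J, forall g j j',
    (J <= j)%N -> (j <= j')%N -> window_bad alpha e L g j j' = 0%N.
Proof.
move=> rho0.
have [a a0 rhoa] : exists2 a, a < 0 & (wavelet_density c alpha < a%:E)%E.
  move: rho0; case: (wavelet_density c alpha) => [r|//|_].
    by rewrite lte_fin => r0; exists (r / 2); rewrite ?lte_fin; lra.
  by exists (- 1); rewrite ?ltNyr//; lra.
have [e e0 [J HJ]] := wavelet_density_lt rhoa.
exists e => // L L1; exists (maxn J 1) => g j j'; rewrite geq_max => /andP[Jj j1] jj'.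
have N1 : (wavelet_count c alpha e j')%:R < 1 :> R.
  apply: le_lt_trans (HJ _ (leq_trans Jj jj')) _.
  rewrite -[ltRHS]exp20 ltr_exp2 nmulr_rlt0// ltr0n.
  exact: leq_trans jj'.
have N0 : wavelet_count c alpha e j' = 0%N.
  by move: N1; rewrite -[ltRHS]/(1%:R) ltr_nat ltnS leqn0 => /eqP.
have t0 : 0 < exp2 (- (g * p) * j%:R) / L.
  by rewrite divr_gt0 ?exp2_gt0// (lt_le_trans _ L1).
have := card_large_le c p (window alpha e j') jj' t0.
by rewrite card_windowE N0 mulr0 lern0 => /eqP.
Qed.

(** For [alpha <= h] the two bounds on the count, increasing and decreasing in
    [j'], cross at [j' = j (h p + 1) / (alpha p + 1)]. *)
Lemma window_left alpha r : wavelet_density c alpha = r%:E -> 0 <= r ->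
  - p^-1 < alpha <= h ->
  exists2 e, 0 < e & forall L, 1 <= L -> exists J, forall g, g <= h + e ->
    forall j j', (J <= j)%N -> (j <= j')%N ->
    (window_bad alpha e L g j j')%:R <= 3 * L * exp2 (s * j%:R).
Proof.
have [pgt0 etagt0 lts] := And3 p0 eta0 s0s.
move=> rhoE r0 /andP[palpha alphah].
have A1 := s0_ge_left rhoE r0 _.
have r_le : r <= alpha * p + 1 - eta.
  by have := wavelet_density_le alpha p0 moment_le; rewrite rhoE lee_fin.
have ap0 : 0 < alpha * p + 1.
  by move: palpha; rewrite -subr_gt0 opprK -(pmulr_lgt0 _ p0) mulrDl mulVf ?gt_eqF.
have hp0 : alpha * p <= h * p by rewrite ler_pM2r.
have {}A1 : r * (h * p + 1) <= s0 * (alpha * p + 1).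
  have := A1 _; rewrite palpha alphah => /(_ isT).
  have -> : (h + p^-1) * (r / (alpha + p^-1)) =
            (r * (h * p + 1)) / (alpha * p + 1).
    by field; rewrite !gt_eqF//; move: palpha; rewrite -subr_gt0 opprK.
  by rewrite ler_pdivrMr.
clear palpha.
have s00 : 0 <= s0.
  by rewrite -(pmulr_lge0 _ ap0); apply: le_trans A1; apply: mulr_ge0 => //; lra.
pose Q := h * p + 1 + r * p + p + s * p.
have Q0 : 0 < Q.
  rewrite /Q; have := mulr_ge0 r0 (ltW p0).
  have := mulr_ge0 (le_trans s00 (ltW s0s)) (ltW p0).
  lra.
pose m := (s - s0) * (alpha * p + 1).
have m0 : 0 < m by rewrite /m mulr_gt0// subr_gt0.
pose e1 := Num.min 1 (Num.min (eta / (1 + p)) (m / Q)).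
have e10 : 0 < e1.
  by rewrite /e1 !lt_min ltr01 !divr_gt0//; lra.
have e1_1 : e1 <= 1 by rewrite /e1 ge_min lexx.
have e1_eta : e1 * (1 + p) <= eta.
  rewrite -ler_pdivlMr; last lra.
  by rewrite /e1 !ge_min lexx !orbT.
have e1_m : e1 * Q <= m.
  by rewrite -ler_pdivlMr// /e1 !ge_min lexx !orbT.
have [eps eps0 [J HJ]] : exists2 eps, 0 < eps & exists J, forall j, (J <= j)%N ->
    (wavelet_count c alpha eps j)%:R <= exp2 ((r + e1) * j%:R).
  by apply: wavelet_density_lt; rewrite rhoE lte_fin; lra.
pose e := Num.min eps e1.
have ee1 : e <= e1 by rewrite /e ge_min lexx orbT.
exists e; first by rewrite /e lt_min eps0.
move=> L L1; exists J => g gh j j' Jj jj'.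
have Na : (wavelet_count c alpha e j')%:R <= exp2 ((r + e1) * j'%:R).
  apply: le_trans (HJ j' (leq_trans Jj jj')).
  by rewrite ler_nat wavelet_count_mono// /e ge_min lexx.
have [B1 B2] := window_bad_le g jj' L1 Na.
have L0 : 0 < L by exact: lt_le_trans L1.
have [ax|ax] := leP ((r + e1) * j'%:R) (s * j%:R).
  apply: (le_trans B1); rewrite -mulrA ler_pM2l//.
  apply: (@le_trans _ _ (exp2 (s * j%:R))); first by rewrite ler_exp2.
  by rewrite ler_peMl ?exp2_ge0.
apply: (le_trans B2); rewrite ler_pM2l ?mulr_gt0// ler_exp2.
have yx : j%:R <= j'%:R :> R by rewrite ler_nat.
have y0 : 0 <= j%:R :> R by rewrite ler0n.
set x : R := j'%:R in ax yx *; set y : R := j%:R in ax yx y0 *.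
set a := r + e1 in ax *.
have a0 : 0 < a by rewrite /a; lra.
rewrite -(ler_pM2l a0).
pose D := (alpha - e) * p + 1; pose G := g * p + 1.
have -> : a * (a * x + g * p * y - (alpha - e) * p * x - (x - y)) =
  (a - D) * (a * x) + a * G * y by rewrite /D /G; ring.
have e1p : e * p <= e1 * p by rewrite ler_pM2r.
have aD : a - D <= 0.
  rewrite /a /D; move: e1_eta r_le; rewrite mulrDr mulr1; lra.
have h1 : (a - D) * (a * x) <= (a - D) * (s * y).
  by rewrite ler_wnM2l// ltW.
have h2 : a * G <= s * D.
  have gp : g * p <= h * p + e * p by rewrite -mulrDl ler_pM2r.
  apply: (@le_trans _ _ (a * (h * p + 1 + e1 * p))).
    by rewrite ler_pM2l// /G; lra.
  apply: (@le_trans _ _ (s * (alpha * p + 1 - e1 * p))); last first.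
    rewrite ler_pM2l; last lra.
    by rewrite /D; lra.
  have e12 : e1 * e1 * p <= e1 * p.
    by rewrite -mulrA ger_pMl ?mulr_gt0.
  move: e1_m A1; rewrite /Q /m /a; lra.
have := ler_wpM2r y0 h2; lra.
Qed.

(** For [h < alpha < 0] the windows matter only when [alpha j' <= h j], up to a
    constant, and the count is then largest at [j' = (h / alpha) j]. *)
Lemma window_right alpha r : wavelet_density c alpha = r%:E -> 0 <= r ->
  h < alpha < 0 ->
  exists2 e, 0 < e & forall L, 1 <= L -> exists C J, forall g, g <= h + e ->
    forall j j', (J <= j)%N -> (j <= j')%N ->
    (window_bad alpha e L g j j')%:R <= C * exp2 (s * j%:R).
Proof.
have [pgt0 etagt0 lts] := And3 p0 eta0 s0s.
move=> rhoE r0 /andP[halpha alpha0].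
have A2 := s0_ge_right rhoE r0 _.
have r_le : r <= alpha * p + 1 - eta.
  by have := wavelet_density_le alpha p0 moment_le; rewrite rhoE lee_fin.
have alphap : alpha * p < 0 by rewrite nmulr_rlt0.
have {}A2 : (1 - s0) * alpha + (r - 1) * h >= 0.
  have := A2 _; rewrite (ltW halpha) alpha0 => /(_ isT).
  rewrite -lerBrDr mulrA ler_ndivrMr//; lra.
have h0 : h < 0 by exact: lt_trans alpha0.
pose m := (s - s0) * - alpha.
have m0 : 0 < m by rewrite /m mulr_gt0//; lra.
pose Q := `|1 - s| - h + 1.
have Q0 : 0 < Q by rewrite /Q; have := normr_ge0 (1 - s); lra.
pose e1 := Num.min (Num.min 1 (- h / 2)) (Num.min (eta / (1 + p)) (m / (Q + 1))).
have e10 : 0 < e1.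
  rewrite /e1 !lt_min ltr01 !divr_gt0//; lra.
have e1_1 : e1 <= 1 by rewrite /e1 !ge_min lexx.
have e1_h : e1 <= - h / 2 by rewrite /e1 !ge_min lexx !orbT.
have e1_eta : e1 * (1 + p) <= eta.
  rewrite -ler_pdivlMr; last lra.
  by rewrite /e1 !ge_min lexx !orbT.
have e1_m : e1 * (Q + 1) <= m.
  rewrite -ler_pdivlMr; last lra.
  by rewrite /e1 !ge_min lexx !orbT.
have [eps eps0 [J HJ]] : exists2 eps, 0 < eps & exists J, forall j, (J <= j)%N ->
    (wavelet_count c alpha eps j)%:R <= exp2 ((r + e1) * j%:R).
  by apply: wavelet_density_lt; rewrite rhoE lte_fin; lra.
pose e := Num.min eps e1.
have ee1 : e <= e1 by rewrite /e ge_min lexx orbT.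
have e0 : 0 < e by rewrite /e lt_min eps0.
exists e => // L L1.
have L0 : 0 < L by exact: lt_le_trans L1.
have [l lE] := @exp2_ex R (3 * L) ltac:(by rewrite mulr_gt0).
have l0 : 0 <= l by rewrite -ler_exp2 -lE exp20; lra.
set a := r + e1 in HJ.
have ap : a <= (alpha - e1) * p + 1.
  by rewrite /a; move: e1_eta r_le; rewrite mulrDr mulr1; lra.
have e1p : 0 < e1 * p by rewrite mulr_gt0.
pose l' := l * ((alpha * p + 1 - a) / (- (alpha * p))).
exists (exp2 (l + l')), J => g gh j j' Jj jj'.
have Na : (wavelet_count c alpha e j')%:R <= exp2 (a * j'%:R).
  apply: le_trans (HJ j' (leq_trans Jj jj')).
  by rewrite ler_nat wavelet_count_mono// /e ge_min lexx.
have [_ B2] := window_bad_le g jj' L1 Na.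
have [->|B0] := posnP (window_bad alpha e L g j j').
  by rewrite mulr_ge0 ?exp2_ge0.
have := window_bad_gt0 jj' L1 B0; rewrite lE -exp2D ler_exp2 => H.
apply: (le_trans B2); rewrite lE -!exp2D ler_exp2 -[leRHS]addrA lerD2l.
have yx : j%:R <= j'%:R :> R by rewrite ler_nat.
have y0 : 0 <= j%:R :> R by rewrite ler0n.
set x : R := j'%:R in H yx *; set y : R := j%:R in H yx y0 *.
pose beta := alpha - e.
have ep : e * p <= e1 * p by rewrite ler_pM2r.
have ep0 : 0 < e * p by rewrite mulr_gt0.
have beta0 : beta < 0 by rewrite /beta; lra.
have betap : beta * p < 0 by rewrite nmulr_rlt0.
pose D := beta * p + 1.
have aD : 0 <= D - a by rewrite /D /beta; lra.
have -> : a * x + g * p * y - (alpha - e) * p * x - (x - y) =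
  - ((D - a) * x) + (g * p + 1) * y by rewrite /D /beta; ring.
(* the lower bound on [x] given by the threshold *)
have xge : (g * p * y + l) / (beta * p) <= x.
  by rewrite ler_ndivrMr//; move: H; rewrite /beta; lra.
have h1 := ler_wpM2l aD xge.
have gneg : g < 0 by lra.
have hb : (1 - s) <= (1 - a) * (g / beta).
  have hb1 : (1 - a) * ((h + e1) / (alpha - e1)) <= (1 - a) * (g / beta).
    apply: ler_wpM2l; first by rewrite /a; lra.
    rewrite ler_ndivrMr; last lra.
    rewrite mulrAC ler_ndivrMr//.
    apply: (@le_trans _ _ ((h + e1) * (alpha - e1))).
      by rewrite ler_wnM2l//; [lra|rewrite /beta; lra].
    by rewrite ler_wnM2r//; lra.
  apply: le_trans hb1; rewrite mulrA ler_ndivlMr; last lra.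
  have : e1 * e1 <= e1 by rewrite ger_pMl.
  have q1 : (1 - s) * e1 <= `|1 - s| * e1 by rewrite ler_wpM2r ?ler_norm// ltW.
  have : e1 * r <= e1 * 1 by rewrite ler_pM2l//; lra.
  move: e1_m A2; rewrite /m /Q /a; nra.
have l'E : (D - a) / (- (beta * p)) * l <= l'.
  rewrite /l' mulrC ler_wpM2l// ler_pM ?invr_ge0//.
  - lra.
  - by rewrite /D /beta; lra.
  - rewrite lef_pV2 ?posrE; try lra.
    by rewrite /beta; lra.
have hb' := ler_wpM2r y0 hb.
have h1E : (D - a) * ((g * p * y + l) / (beta * p)) =
  g * p * y + (1 - a) * (g / beta) * y - (D - a) / (- (beta * p)) * l.
  by rewrite /D; field; rewrite (lt_eqF beta0) (gt_eqF pgt0).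
rewrite h1E in h1; lra.
Qed.

End WindowCounting.

Section LargeLeaderCount.
Context {R : realType}.

Lemma segment_finite_cover (a b : R) (e : R -> R) :
  (forall x, a <= x <= b -> 0 < e x) ->
  exists2 s : seq R, (forall y, y \in s -> a <= y <= b) &
    forall x, a <= x <= b -> exists2 y, y \in s & `|x - y| < e y.
Proof.
move=> e0.
have := @segment_compact R a b; rewrite compact_cover.
move=> /(_ _ `[a, b]%classic (fun y => ball y (e y))).
case=> [y _|x|D Dab cover].
- exact: ball_open.
- rewrite /= in_itv/= => xab; exists x; first by rewrite /= in_itv.
  exact/ballxx/e0.
exists (finmap.enum_fset D) => [y yD|x xab].
  by have := Dab _ yD; rewrite inE /= in_itv.
have [|y yD] := cover x; first by rewrite /= in_itv.
by rewrite /ball/= distrC => yx; exists y.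
Qed.

Lemma seq_lower_bound (s : seq R) (e : R -> R) :
  (forall y, y \in s -> 0 < e y) ->
  exists2 m, 0 < m & forall y, y \in s -> m <= e y.
Proof.
elim: s => [|x s IH] es; first by exists 1.
have [m m0 ms] := IH (fun y ys => es y (@mem_behead _ (x :: s) y ys)).
have ex0 := es x (mem_head _ _).
exists (Num.min m (e x)); first by rewrite lt_min m0.
move=> y; rewrite inE => /orP[/eqP ->|/ms ym]; first by rewrite ge_min lexx orbT.
by rewrite ge_min ym.
Qed.

Variables (c : nat -> nat -> R) (p : R).

(** A condition on the sums entering the [p]-leader, which makes sense for an
    infinite leader as well. *)
Definition large_leader (g : R) (j k : nat) : bool :=
  `[< exists2 j', (j <= j')%N & exp2 (- (g * p) * j%:R) < leader_sum c p j k j' >].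

(** The constant depends on [L], which will be a multiple of the number of
    windows and is chosen only after the windows. *)
Definition good_window (h s alpha e : R) : Prop := forall L, 1 <= L ->
  exists C J, forall g, g <= h + e -> forall j j', (J <= j)%N -> (j <= j')%N ->
    (window_bad c p alpha e L g j j')%:R <= C * exp2 (s * j%:R).

Lemma good_window_sum (h s L g : R) (K : nat) (e : R -> R) (r : seq R) :
  1 <= L ->
  (forall alpha, alpha \in r -> good_window h s alpha (e alpha)) ->
  (forall alpha, alpha \in r -> g <= h + e alpha) ->
  exists C J, forall j, (J <= j)%N ->
    (\sum_(alpha <- r) \sum_(j <= j' < (K * j).+1)
        window_bad c p alpha (e alpha) L g j j')%:R <=
    C * j.+1%:R * exp2 (s * j%:R).
Proof.
move=> L1; elim: r => [|x r IH] rgood rg.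
  by exists 0, 0%N => j _; rewrite big_nil !mul0r.
have [C [J HJ]] := IH (fun y yr => rgood y (@mem_behead _ (x :: r) y yr))
                     (fun y yr => rg y (@mem_behead _ (x :: r) y yr)).
have [C' [J' HJ']] := rgood x (mem_head _ _) L L1.
exists (`|C'| * K.+1%:R + C), (maxn J J') => j; rewrite geq_max => /andP[Jj J'j].
rewrite big_cons natrD.
rewrite mulrDl mulrDl; apply: lerD; last exact: HJ.
apply: (@le_trans _ _ (\sum_(j <= j' < (K * j).+1) `|C'| * exp2 (s * j%:R))).
  rewrite natr_sum big_nat_cond [leRHS]big_nat_cond.
  apply: ler_sum => j' /andP[/andP[jj' _] _].
  apply: (le_trans (HJ' g (rg x (mem_head _ _)) j j' J'j jj')).
  by rewrite ler_wpM2r ?exp2_ge0 ?ler_norm.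
rewrite sumr_const_nat -[leLHS]mulr_natl mulrA ler_wpM2r ?exp2_ge0//.
rewrite mulrC -mulrA ler_wpM2l// -natrM ler_nat.
apply: (@leq_trans (K * j).+1); first exact: leq_subr.
by rewrite mulnS !mulSn; lia.
Qed.

End LargeLeaderCount.

Section LargeLeaderBound.
Context {R : realType}.
Variables (c : nat -> nat -> R) (p eta h s0 : R).
Hypotheses (p0 : 0 < p) (eta0 : 0 < eta).
Hypothesis moment_le : exists J, forall j, (J <= j)%N ->
  \sum_(k < 2 ^ j) `|c j k| `^ p <= exp2 ((1 - eta) * j%:R).

Lemma coef_le : exists J, forall j k, (J <= j)%N -> (k < 2 ^ j)%N ->
  `|c j k| <= exp2 (- (- p^-1 + eta / p) * j%:R).
Proof.
have [J HJ] := moment_le; exists J => j k Jj kj.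
have h1 : `|c j k| `^ p <= exp2 ((1 - eta) * j%:R).
  apply: le_trans (HJ j Jj).
  rewrite (bigD1 (Ordinal kj))//= lerDl.
  by apply: sumr_ge0 => *; exact: powR_ge0.
have -> : exp2 (- (- p^-1 + eta / p) * j%:R) = exp2 ((1 - eta) * j%:R) `^ p^-1.
  by rewrite exp2_powR; congr exp2; field; rewrite gt_eqF.
have -> : `|c j k| = (`|c j k| `^ p) `^ p^-1.
  by rewrite -powRrM mulfV ?gt_eqF// powRr1.
by apply: ge0_ler_powR; rewrite ?nnegrE ?invr_ge0 ?(ltW p0) ?powR_ge0 ?exp2_ge0.
Qed.

(** Scales much finer than [j] never produce a large leader, because of the
    decay of the moments. *)
Lemma leader_sum_fine (K : nat) : 1 + (h + 1) * p <= eta * K%:R ->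
  exists J, forall g j j' k, g <= h + 1 -> (J <= j)%N -> (j <= j')%N ->
    (K * j <= j')%N -> leader_sum c p j k j' <= exp2 (- (g * p) * j%:R).
Proof.
move=> etaK; have [J HJ] := moment_le; exists J => g j j' k gh Jj jj' Kj.
apply: (@le_trans _ _ (exp2 ((1 - eta) * j'%:R) * 2 ^- (j' - j))).
  apply: le_trans (_ : (\sum_(k' < 2 ^ j') `|c j' k'| `^ p) * 2 ^- (j' - j) <= _).
    rewrite mulr_suml /leader_sum /leader_part [leLHS]big_mkcond/=.
    apply: ler_sum => k' _; case: ifP => _; first exact: lexx.
    by rewrite mulr_ge0 ?powR_ge0// invr_ge0 exprn_ge0.
  by rewrite ler_wpM2r ?invr_ge0 ?exprn_ge0// HJ// (leq_trans Jj).
rewrite -exp2_natN natrB// -exp2D ler_exp2.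
have Kj' : K%:R * j%:R <= j'%:R :> R by rewrite -natrM ler_nat.
have h1 : eta * (K%:R * j%:R) <= eta * j'%:R by rewrite ler_pM2l.
have h2 := ler_wpM2r (ler0n R j) etaK.
have gp : g * p <= (h + 1) * p by rewrite ler_pM2r.
have h3 := ler_wpM2r (ler0n R j) gp.
lra.
Qed.

Hypothesis s0_ge_left : forall alpha r : R,
  wavelet_density c alpha = r%:E -> 0 <= r -> - p^-1 < alpha <= h ->
  (h + p^-1) * (r / (alpha + p^-1)) <= s0.
Hypothesis s0_ge_right : forall alpha r : R,
  wavelet_density c alpha = r%:E -> 0 <= r -> h <= alpha < 0 ->
  (r - 1) * (h / alpha) + 1 <= s0.

Lemma good_window_ex s alpha : s0 < s -> - p^-1 < alpha ->
  alpha <= h \/ (h < alpha < 0) ->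
  exists2 e, 0 < e & good_window c p h s alpha e.
Proof.
move=> s0s palpha alphah.
case: (ltP (wavelet_density c alpha) 0%E) => [rho0|].
  have [e e0 He] := window_empty p rho0.
  exists e => // L L1; have [J HJ] := He L L1.
  by exists 0, J => g _ j j' Jj jj'; rewrite HJ// mul0r.
case rhoE : (wavelet_density c alpha) => [r||//]; last first.
  by have := wavelet_density_le alpha p0 moment_le; rewrite rhoE.
rewrite lee_fin => r0; case: alphah => [alphah|alphah].
  have [|e e0 He] := window_left p0 eta0 moment_le s0_ge_left s0s rhoE r0.
    by rewrite palpha.
  by exists e => // L L1; have [J HJ] := He L L1; exists (3 * L), J.
by have [e e0 He] := window_right p0 eta0 moment_le s0_ge_right s0s rhoE r0 alphah;
  exists e.
Qed.

(** A finite family of windows containing every size [2^(- x j)] of a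
    coefficient with [x <= tau]; the smaller coefficients are negligible at the
    scales [j' <= K j], as [g0 j <= tau j']. *)
Lemma window_cover s (K : nat) : s0 < s -> (0 < K)%N ->
  exists (r : seq R) (e : R -> R) (tau g0 : R),
  [/\ forall alpha, alpha \in r -> 0 < e alpha /\ good_window c p h s alpha (e alpha),
      forall x, - p^-1 + eta / p <= x -> x <= tau ->
        exists2 alpha, alpha \in r & `|x - alpha| < e alpha,
      h < g0
    & forall j j', (j <= j')%N -> (j' <= K * j)%N -> g0 * j%:R <= tau * j'%:R].
Proof.
move=> s0s K0; set amin := - p^-1 + eta / p.
have pamin : - p^-1 < amin by rewrite /amin ltrDl divr_gt0.
have K0' : 0 < K%:R :> R by rewrite ltr0n.
have cover_to (a : R) : a <= h \/ a < 0 -> exists (r : seq R) (e : R -> R),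
    (forall alpha, alpha \in r -> 0 < e alpha /\ good_window c p h s alpha (e alpha)) /\
    (forall x, amin <= x <= a -> exists2 alpha, alpha \in r & `|x - alpha| < e alpha).
  move=> ah.
  have /boolp.choice[e He] : forall x, exists e, amin <= x <= a ->
      0 < e /\ good_window c p h s x e.
    move=> x; have [/andP[aminx xa]|_] := boolP (amin <= x <= a); last by exists 0.
    have [||e e0 ge] := @good_window_ex s x s0s.
    - exact: lt_le_trans aminx.
    - case: (leP x h) => hx; [by left|right].
      by case: ah => ah; [have := le_trans xa ah; rewrite leNgt hx
                         |exact: le_lt_trans ah].
    - by exists e.
  have [r ra rcover] := @segment_finite_cover R amin a e (fun x xa => (He x xa).1).
  by exists r, e; split=> // alpha /ra; exact: He.
have [h0|h0] := leP 0 h.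
  have [ah|ha] := leP amin h; last first.
    exists [::], (fun=> 1), ((h + amin) / 2), ((h + amin) / 2); split=> //.
    - by move=> x ax xt; exfalso; move: ha; rewrite ltNge => /negP; apply; lra.
    - lra.
    - move=> j j' jj' _; apply: ler_wpM2l; first lra.
      by rewrite ler_nat.
  have [|r [e [rgood rcover]]] := cover_to h; first by left.
  have [|alpha alphar halpha] := rcover h; first by rewrite ah lexx.
  pose d := (e alpha - `|h - alpha|) / 2.
  have d0 : 0 < d by rewrite divr_gt0// subr_gt0.
  exists r, e, (h + d), (h + d); split=> //.
  - move=> x ax xt; have [xh|hx] := leP x h; first by apply: rcover; rewrite ax.
    exists alpha => //.
    have : `|x - alpha| <= `|x - h| + `|h - alpha|.
      by rewrite -[x - alpha](subrKA h); exact: ler_normD.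
    rewrite (gtr0_norm (_ : 0 < x - h)) ?subr_gt0//.
    by rewrite /d in xt; lra.
  - lra.
  - move=> j j' jj' _; apply: ler_wpM2l; first lra.
    by rewrite ler_nat.
pose a := h / (2 * K%:R).
have a0 : a < 0 by rewrite /a ltr_pdivrMr ?mul0r// mulr_gt0.
have [|r [e [rgood rcover]]] := cover_to a; first by right.
exists r, e, a, (h / 2); split=> //.
- by move=> x ax xa; apply: rcover; rewrite ax.
- lra.
- move=> j j' _ j'K.
  have -> : h / 2 * j%:R = a * (K * j)%:R.
    by rewrite natrM /a; field; rewrite gt_eqF.
  by rewrite ler_wnM2l ?(ltW a0)// ler_nat.
Qed.

(** A large leader comes from one of finitely many windows at one of the
    scales [j, ..., K j]. *)
Theorem large_leader_count s : s0 < s ->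
  exists2 g, h < g & exists J, forall j, (J <= j)%N ->
    #|[pred k : 'I_(2 ^ j) | large_leader c p g j k]|%:R <= exp2 (s * j%:R).
Proof.
move=> s0s; have [pgt0 etagt0] := conj p0 eta0.
pose K := (Num.truncn ((1 + (h + 1) * p) / eta)).+1.
have etaK : 1 + (h + 1) * p <= eta * K%:R.
  by rewrite [leRHS]mulrC -ler_pdivrMr//; apply: ltW; exact: truncnS_gt.
pose s1 := (s0 + s) / 2.
have [s01 s1s] : s0 < s1 /\ s1 < s by rewrite /s1; split; lra.
have [r [e [tau [g0 [rgood rcover hg0 tau_g0]]]]] := @window_cover s1 K s01 (ltn0Sn _).
have [m m0 me] := seq_lower_bound (fun y yr => (rgood y yr).1).
pose g := h + Num.min (Num.min m 1) ((g0 - h) / 2).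
have hg : h < g.
  by rewrite /g ltrDl !lt_min m0 ltr01/= divr_gt0// subr_gt0.
have gh1 : g <= h + 1 by rewrite lerD2l !ge_min lexx orbT.
have gg0 : g < g0.
  have : g <= h + (g0 - h) / 2 by rewrite lerD2l !ge_min lexx orbT.
  lra.
have ge alpha : alpha \in r -> g <= h + e alpha.
  by move=> /me mea; rewrite lerD2l; apply: le_trans mea; rewrite !ge_min lexx.
exists g => //.
pose L : R := (size r).*2.+1%:R.
have L1 : 1 <= L by rewrite /L ler1n.
have [C [J1 HJ1]] := good_window_sum K L1 (fun y yr => (rgood y yr).2) ge.
have [J2 HJ2] := leader_sum_fine etaK.
have [J3 HJ3] := coef_le.
have [J4 HJ4] := @exp2_dominates0 R ((g0 - g) * p) 6 ltac:(rewrite mulr_gt0// subr_gt0//).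
have [J5 HJ5] := @exp2_dominates R s1 s C s1s.
exists (maxn (maxn J1 J2) (maxn (maxn J3 1) (maxn J4 J5))) => j.
rewrite !geq_max => /andP[/andP[J1j J2j] /andP[/andP[J3j j0] /andP[J4j J5j]]].
apply: le_trans (HJ5 j J5j); apply: le_trans (HJ1 j J1j); rewrite ler_nat.
have wit k : large_leader c p g j k -> exists2 alpha, alpha \in r &
    exists2 j', (j' \in index_iota j (K * j).+1) &
      exp2 (- (g * p) * j%:R) / L < leader_part c p (window c alpha (e alpha) j') j k j'.
  move=> /asboolP[j' jj' large].
  have j'K : (j' <= K * j)%N.
    rewrite leqNgt; apply/negP => /ltnW Kj'.
    by have := HJ2 g j j' k gh1 J2j jj' Kj'; rewrite leNgt large.
  apply: contrapT => noWin.
  have {}noWin alpha : alpha \in r ->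
      leader_part c p (window c alpha (e alpha) j') j k j' <=
      exp2 (- (g * p) * j%:R) / L.
    move=> alphar; rewrite leNgt; apply/negP => h1; apply: noWin.
    by exists alpha => //; exists j' => //; rewrite mem_index_iota jj' ltnS.
  pose small : pred nat := fun k' => `|c j' k'| <= exp2 (- tau * j'%:R).
  have small_le : leader_part c p small j k j' <= exp2 (- (g * p) * j%:R) / 2.
    apply: le_trans (leader_part_le k (M := exp2 (- (tau * p) * j'%:R)) jj' (exp2_ge0 _) _) _.
      move=> k' _ sk'.
      have -> : exp2 (- (tau * p) * j'%:R) = exp2 (- tau * j'%:R) `^ p.
        by rewrite exp2_powR; congr exp2; ring.
      by apply: ge0_ler_powR; rewrite ?nnegrE ?exp2_ge0 ?(ltW p0).
    rewrite ler_pdivlMr// mulrAC -[3 * 2]/(3%:R * 2%:R) -natrM.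
    apply: (@le_trans _ _ (exp2 ((g0 - g) * p * j%:R) * exp2 (- (tau * p) * j'%:R))).
      by rewrite ler_wpM2r ?exp2_ge0// HJ4.
    rewrite -exp2D ler_exp2.
    have := ler_wpM2r (ltW p0) (tau_g0 j j' jj' j'K); lra.
  have split_le : leader_sum c p j k j' <= leader_part c p small j k j' +
      \sum_(alpha <- r) leader_part c p (window c alpha (e alpha) j') j k j'.
    rewrite /leader_sum /leader_part [leLHS]big_mkcond/=.
    under [X in _ <= _ + X]eq_bigr do rewrite big_mkcond/=.
    rewrite exchange_big/= [X in _ <= X + _]big_mkcond -big_split/=.
    apply: ler_sum => k' _.
    have F0 : 0 <= `|c j' k'| `^ p / 2 ^+ (j' - j).
      by rewrite mulr_ge0 ?powR_ge0// invr_ge0 exprn_ge0.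
    have [nk|nk] /= := boolP (near3 j k j' k'); last first.
      by rewrite add0r sumr_ge0.
    have rest0 (q : seq R) : 0 <= \sum_(alpha <- q)
        (if window c alpha (e alpha) j' k' then `|c j' k'| `^ p / 2 ^+ (j' - j) else 0).
      by apply: sumr_ge0 => alpha _; case: ifP.
    case: ifPn => [_|]; first by rewrite lerDl.
    rewrite /small -ltNge add0r => big_coef.
    have [y yE] := @exp2_ex R `|c j' k'| (le_lt_trans (exp2_ge0 _) big_coef).
    have j'0 : 0 < j'%:R :> R by rewrite ltr0n (leq_trans j0).
    have [alpha alphar walpha] := rcover (- y / j'%:R) ltac:(
      have := HJ3 j' k' (leq_trans J3j jj') (ltn_ord k');
      rewrite yE ler_exp2 ler_pdivlMr//; lra) ltac:(
      move: big_coef; rewrite yE ltr_exp2 ler_pdivrMr//; lra).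
    rewrite (big_rem alpha)//= ifT ?lerDl//.
    have yj : y = - (- y / j'%:R) * j'%:R by field; rewrite gt_eqF.
    move: walpha; rewrite ltr_norml => /andP[w1 w2].
    rewrite /window yE yj -/(exp2 _) -/(exp2 _) !ler_exp2; apply/andP; split.
      by rewrite ler_wpM2r ?(ltW j'0)//; lra.
    by rewrite ler_wpM2r ?(ltW j'0)//; lra.
  have sum_le : \sum_(alpha <- r) leader_part c p (window c alpha (e alpha) j') j k j' <=
      (size r)%:R * (exp2 (- (g * p) * j%:R) / L).
    rewrite big_seq; apply: le_trans (ler_sum _ noWin) _.
    by rewrite -big_seq big_const_seq count_predT iter_addr_0 mulr_natl.
  have : (size r)%:R * (exp2 (- (g * p) * j%:R) / L) <= exp2 (- (g * p) * j%:R) / 2.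
    have sL : (size r)%:R * 2 <= L by rewrite /L -natrM ler_nat muln2 leqnSn.
    rewrite mulrCA ler_pM2l ?exp2_gt0// ler_pdivrMr ?(lt_le_trans _ L1)//; lra.
  move=> half; suff : leader_sum c p j k j' <= exp2 (- (g * p) * j%:R) by rewrite leNgt large.
  apply: (le_trans split_le); apply: (le_trans (lerD small_le (le_trans sum_le half))).
  by rewrite -splitr.
apply: (@leq_trans (\sum_(k < 2 ^ j | large_leader c p g j k) 1)).
  by rewrite sum1_card.
rewrite /window_bad.
under eq_bigr do under eq_bigr do rewrite -sum1_card big_mkcond/=.
under eq_bigr do rewrite exchange_big/=.
rewrite exchange_big/= big_mkcond/=; apply: leq_sum => k _.
case: ifPn => [/wit[alpha alphar [j' j'r lp]]|_]; last exact: leq0n.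
rewrite (big_rem alpha)//= (big_rem j')//= inE lp.
by rewrite -addnA leq_addr.
Qed.

End LargeLeaderBound.

(** * From leaders to spectra *)

Section LeadersAndExponents.
Context {R : realType}.
Implicit Types (c : nat -> nat -> R) (p g h : R).

Lemma dyadicE (j i : nat) (x : R) :
  dyadic j i x <-> i%:R <= 2 ^+ j * x < i.+1%:R.
Proof.
have j0 : 0 < 2 ^+ j :> R by rewrite exprn_gt0.
by rewrite /dyadic /= in_itv/= ler_pdivrMr// ltr_pdivlMr// mulrC.
Qed.

Lemma dyadic_subP j j' k k' : (j <= j')%N -> (k < 2 ^ j)%N ->
  `[< @dyadic R j' k' `<=` dyadic3 j k >] = near3 j k j' k'.
Proof.
move=> jj' kj; set D := (2 ^ (j' - j))%N.
have D0 : (0 < D)%N by rewrite expn_gt0.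
have DR : 0 < D%:R :> R by rewrite ltr0n.
have E : 2 ^+ j' = 2 ^+ j * D%:R :> R by rewrite /D natrX -exprD subnKC.
have j0 : 0 < 2 ^+ j :> R by rewrite exprn_gt0.
have j'0 : 0 < 2 ^+ j' :> R by rewrite exprn_gt0.
have left_end i : @dyadic R j i (k'%:R / 2 ^+ j') -> (k' %/ D)%N == i.
  rewrite dyadicE; have -> : 2 ^+ j * (k'%:R / 2 ^+ j') = k'%:R / D%:R :> R.
    by rewrite E; field; rewrite !gt_eqF.
  rewrite ler_pdivlMr// ltr_pdivrMr// -!natrM ler_nat ltr_nat => /andP[h1 h2].
  by rewrite eqn_leq -ltnS ltn_divLR// h2 leq_divRL.
have sub : @dyadic R j' k' `<=` dyadic j (k' %/ D)%N.
  move=> x; rewrite !dyadicE E => /andP[h1 h2].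
  rewrite -(ler_pM2r DR) -(ltr_pM2r DR) mulrAC; apply/andP; split.
    by apply: le_trans h1; rewrite -natrM ler_nat leq_divM.
  by apply: (lt_le_trans h2); rewrite -natrM ler_nat ltn_ceil.
apply/asboolP/idP => [sub3|].
  have : dyadic3 j k (k'%:R / 2 ^+ j' : R).
    apply: sub3; apply/dyadicE; rewrite mulrC divfK ?gt_eqF//.
    by rewrite lexx ltr_nat/=.
  rewrite /near3 -/D !inE => -[[]|] /left_end ->; rewrite ?orbT//.
rewrite /near3 -/D !inE => /or3P[] /eqP h x /sub; rewrite h => dx; [left|left|right] => //.
  by left.
by right.
Qed.

Lemma pleaderE c p j k : (k < 2 ^ j)%N -> pleader c p j k =
  ereal_sup [set (leader_sum c p j k j' `^ p^-1)%:E
            | j' in [set j' : nat | (j <= j')%N]].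
Proof.
move=> kj; rewrite /pleader; congr ereal_sup; apply: eq_imagel => j' /= jj'.
congr (_ `^ _)%:E; rewrite /leader_sum /leader_part; apply: eq_bigl => k'.
by rewrite andbT dyadic_subP.
Qed.

Lemma pleader_exponent_ge c p g (x : R) J : 0 < p ->
  (forall j, (J <= j)%N -> ~~ large_leader c p g j (dyadic_index j x)) ->
  (g%:E <= limn_einf (fun j : nat =>
     lne (pleader c p j (dyadic_index j x)) * ((ln (2 ^- j))^-1)%:E))%E.
Proof.
move=> p0 small; apply: (@limn_einf_ge _ _ _ J.+1) => j Jj.
have ln0 : ln (2 ^- j) = - (j%:R * ln 2) :> R.
  by rewrite -exp2_natN ln_exp2 mulNr.
have j0 : 0 < j%:R * ln 2 :> R.
  by rewrite mulr_gt0 ?ln2_gt0// ltr0n (leq_trans _ Jj).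
have ub : (pleader c p j (dyadic_index j x) <= (exp2 (- g * j%:R))%:E)%E.
  rewrite pleaderE ?dyadic_index_lt//; apply: ge_ereal_sup => _ [j' /= jj' <-].
  rewrite lee_fin.
  have -> : exp2 (- g * j%:R) = exp2 (- (g * p) * j%:R) `^ p^-1.
    by rewrite exp2_powR; congr exp2; field; rewrite gt_eqF.
  apply: ge0_ler_powR; rewrite ?nnegrE ?leader_part_ge0 ?exp2_ge0 ?invr_ge0 ?(ltW p0)//.
  rewrite leNgt; apply/negP => h1; move/negP: (small j (ltnW Jj)); apply.
  by apply/asboolP; exists j'.
rewrite ln0 invrN EFinN muleN leeNr.
have : (0 <= pleader c p j (dyadic_index j x))%E.
  rewrite pleaderE ?dyadic_index_lt//.
  apply: le_trans (_ : ((leader_sum c p j (dyadic_index j x) j `^ p^-1)%:E <= _)%E).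
    by rewrite lee_fin powR_ge0.
  by apply: ereal_sup_ubound; exists j => //=.
move: ub; case: (pleader _ _ _ _) => [r|//|//]; rewrite !lee_fin => rb r0.
have [r1|r1] := leP r 0.
  by rewrite le0_lneNy ?lee_fin// gt0_mulNye ?lte_fin ?invr_gt0// leNye.
rewrite lne_EFin// -EFinM lee_fin ler_pdivrMr//.
rewrite -ler_expR lnK ?posrE//; apply: le_trans rb _.
by rewrite exp2E ler_expR mulrA.
Qed.

End LeadersAndExponents.

(** * Smooth functions *)

Section Calculus.
Context {R : realType}.
Implicit Types (f g phi : R -> R) (x y a b : R) (n m : nat).

Lemma is_derive_smooth phi n x : smooth phi ->
  is_derive x 1 (derive1n n phi) (derive1n n.+1 phi x).
Proof. by move=> sphi; rewrite derive1nS derive1E; apply/derivableP/sphi. Qed.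

(** Identifying all derivatives at once from a candidate family. *)
Lemma derive1n_family (F : nat -> R -> R) :
  (forall n x, is_derive x 1 (F n) (F n.+1 x)) ->
  forall n, derive1n n (F 0%N) = F n.
Proof.
move=> dF; elim=> [//|n IH].
apply/funext => x; rewrite derive1nS IH derive1E.
exact: derive_val.
Qed.

Lemma smooth_family (F : nat -> R -> R) :
  (forall n x, is_derive x 1 (F n) (F n.+1 x)) -> smooth (F 0%N).
Proof. by move=> dF n x; rewrite derive1n_family//; exact: ex_derive. Qed.

Lemma derive1n_iter phi n m : derive1n n (derive1n m phi) = derive1n (n + m) phi.
Proof. by rewrite /derive1n iterD. Qed.

Lemma smooth_derive1n phi m : smooth phi -> smooth (derive1n m phi).
Proof. by move=> sphi n x; rewrite derive1n_iter. Qed.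

Lemma is_derive_lincomb f g a (df dg x : R) :
  is_derive x 1 f df -> is_derive x 1 g dg ->
  is_derive x 1 (fun y => a * f y + g y) (a * df + dg).
Proof.
move=> hf hg.
have h1 := is_deriveZ a hf.
exact: (is_deriveD h1 hg).
Qed.

Lemma is_derive_affine f a b (df x : R) :
  is_derive (a * x + b) 1 f df -> is_derive x 1 (fun y => f (a * y + b)) (a * df).
Proof.
move=> hf.
have h1 : is_derive x 1 (fun y : R => a * y + b) (a * 1 + 0).
  exact: is_derive_lincomb.
rewrite mulr1 addr0 in h1.
have := @is_derive1_comp _ f (fun y : R => a * y + b) x df a hf h1.
by rewrite mulrC.
Qed.

Lemma smooth_lincomb f g a : smooth f -> smooth g ->
  smooth (fun y => a * f y + g y).
Proof.
move=> sf sg; pose F n y := a * derive1n n f y + derive1n n g y.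
apply: (@smooth_family F) => n x.
by apply: is_derive_lincomb; exact: is_derive_smooth.
Qed.

Lemma derive1n_lincomb f g a n : smooth f -> smooth g ->
  derive1n n (fun y => a * f y + g y) =
  (fun y => a * derive1n n f y + derive1n n g y).
Proof.
move=> sf sg; pose F n y := a * derive1n n f y + derive1n n g y.
apply: (@derive1n_family F) => k x.
by apply: is_derive_lincomb; exact: is_derive_smooth.
Qed.

Lemma smooth_cst a : smooth (cst a : R -> R).
Proof.
pose F n (y : R) : R := if n is 0%N then a else 0.
by apply: (@smooth_family F) => -[|n] x; exact: is_derive_cst.
Qed.

Lemma derive1n_cst a n : derive1n n.+1 (cst a : R -> R) = cst 0.
Proof.
pose F n (y : R) : R := if n is 0%N then a else 0.
have dF k x : is_derive x 1 (F k) (F k.+1 x) by case: k => [|k]; exact: is_derive_cst.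
by rewrite (derive1n_family dF).
Qed.

Lemma is_derive_continuous f df x : is_derive x 1 f df -> {for x, continuous f}.
Proof.
by move=> hf; apply: differentiable_continuous; apply/derivable1_diffP.
Qed.

Lemma smooth_continuous phi : smooth phi -> continuous phi.
Proof. by move=> sphi x; exact: is_derive_continuous (is_derive_smooth 0 x sphi). Qed.

Lemma mvt_le f (df : R -> R) a b (M : R) :
  (forall x, is_derive x 1 f (df x)) ->
  (forall x, `|x - a| <= `|b - a| -> `|df x| <= M) ->
  `|f b - f a| <= M * `|b - a|.
Proof.
move=> hf dfM.
have cf : continuous f by move=> x; exact: is_derive_continuous (hf x).
have [ab|/ltW ba] := leP a b.
  have [z + ->] := MVT_segment ab (fun x _ => hf x) (continuous_subspaceT cf).
  rewrite in_itv/= => /andP[az zb].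
  rewrite normrM ler_wpM2r//; apply: dfM.
  by rewrite !ger0_norm ?subr_ge0//; lra.
have [z + zE] := MVT_segment ba (fun x _ => hf x) (continuous_subspaceT cf).
rewrite in_itv/= => /andP[az zb].
rewrite distrC zE normrM [`|b - a|]distrC ler_wpM2r//; apply: dfM.
by rewrite distrC [`|b - a|]distrC !ger0_norm ?subr_ge0//; lra.
Qed.

Definition taylor_poly phi x n : {poly R} :=
  \sum_(m < n) (derive1n m phi x / m`!%:R) *: ('X - x%:P) ^+ m.

Lemma deriv_taylor_poly phi x n :
  (taylor_poly phi x n.+1)^`() = taylor_poly (derive1n 1 phi) x n.
Proof.
rewrite /taylor_poly raddf_sum /= big_ord_recl/= expr0 derivZ derivC scaler0 add0r.
apply: eq_bigr => m _; rewrite /bump/= add1n derivZ deriv_exp derivB derivX derivC.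
rewrite subr0 mul1r /=.
have -> : derive1n m (derive1n 1 phi) = derive1n m.+1 phi.
  by rewrite derive1n_iter addn1.
rewrite -[X in _ *: X = _]scaler_nat scalerA; congr (_ *: _).
rewrite -[derive1 _ x]/(derive1n m.+1 phi x); set d := derive1n _ _ _.
rewrite factS natrM; field.
by rewrite addrC natr1 !pnatr_eq0 -lt0n fact_gt0.
Qed.

Lemma taylor_poly_center phi x n : (taylor_poly phi x n.+1).[x] = phi x.
Proof.
rewrite /taylor_poly big_ord_recl/= hornerD horner_sum big1 => [|m _].
  by rewrite addr0 expr0 hornerZ hornerC mulr1 divr1.
by rewrite hornerZ horner_exp hornerXsubC subrr /bump/= add1n expr0n/= mulr0.
Qed.

(** By induction on [n], as the derivative of the remainder of [phi] is the
    remainder of its derivative. *)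
Lemma taylor_remainder_le phi x y n (M : R) : smooth phi ->
  (forall z, `|z - x| <= `|y - x| -> `|derive1n n phi z| <= M) ->
  `|phi y - (taylor_poly phi x n).[y]| <= M * `|y - x| ^+ n.
Proof.
elim: n phi y => [|n IH] phi y sphi phiM.
  by rewrite /taylor_poly big_ord0 horner0 subr0 expr0 mulr1; apply: phiM.
pose rem (z : R) : R := phi z - (taylor_poly phi x n.+1).[z].
pose drem (z : R) : R := derive1n 1 phi z - (taylor_poly (derive1n 1 phi) x n).[z].
have hrem (z : R) : is_derive z 1 rem (drem z).
  apply: is_deriveB; first exact: (is_derive_smooth 0 z sphi).
  by rewrite -deriv_taylor_poly; exact: is_derive_poly.
have rem0 : rem x = 0 by rewrite /rem taylor_poly_center subrr.
rewrite -/(rem y) -[rem y]subr0 -rem0 exprSr mulrA.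
apply: (mvt_le hrem) => z zy.
apply: le_trans (IH (derive1n 1 phi) z _ _) _.
- exact: smooth_derive1n.
- by move=> w wz; rewrite derive1n_iter addn1; apply: phiM; apply: le_trans zy.
- apply: ler_wpM2l.
    by apply: le_trans (phiM x _); rewrite ?subrr ?normr0.
  by rewrite lerXn2r ?nnegrE.
Qed.

(** The derivatives are only required to converge uniformly at distance at
    most [1] from [x], as the sums defining a periodized wavelet do not
    converge uniformly on the line. *)
Lemma is_derive_lim (f_ df_ : nat -> R -> R) f g (e : nat -> R) x :
  (forall n y, is_derive y 1 (f_ n) (df_ n y)) ->
  (forall y, `|y - x| <= 1 -> f_ n y @[n --> \oo] --> f y) ->
  (forall n y, `|y - x| <= 1 -> `|df_ n y - g y| <= e n) ->
  e n @[n --> \oo] --> 0 ->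
  is_derive x 1 f (g x).
Proof.
move=> hf fcvg dfg e0.
have x1 : `|x - x| <= 1 by rewrite subrr normr0.
(* the difference quotients of [f - f_ n] are at most [e n] *)
have key n y : `|y - x| <= 1 ->
    `|(f y - f_ n y) - (f x - f_ n x)| <= e n * `|y - x|.
  move=> yx1.
  have h1 m : `|(f_ m y - f_ n y) - (f_ m x - f_ n x)| <= (e m + e n) * `|y - x|.
    apply: (@mvt_le (fun y => f_ m y - f_ n y) (fun y => df_ m y - df_ n y)).
    move=> z zy; have zx1 := le_trans zy yx1.
    have -> : df_ m z - df_ n z = (df_ m z - g z) - (df_ n z - g z) by ring.
    by apply: le_trans (ler_normB _ _) _; rewrite lerD ?dfg.
  have lhs : `|(f_ m y - f_ n y) - (f_ m x - f_ n x)| @[m --> \oo] -->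
      `|(f y - f_ n y) - (f x - f_ n x)|.
    apply: cvg_norm; apply: cvgB; (apply: cvgB; last exact: cvg_cst); exact: fcvg.
  have rhs : (e m + e n) * `|y - x| @[m --> \oo] --> (0 + e n) * `|y - x|.
    apply: cvgM; last exact: cvg_cst.
    by apply: cvgD => //; exact: cvg_cst.
  rewrite add0r in rhs.
  by apply: (ler_cvg_to lhs rhs); exact: nearW.
suff H : h^-1 *: (f (h *: 1 + x) - f x) @[h --> 0^'] --> g x.
  exact: (DeriveDef (cvgP _ H) (cvg_lim _ H)).
apply/cvgrPdist_le => eps eps0.
have e3 : 0 < eps / 3 by rewrite divr_gt0.
have [n en] : exists n, e n <= eps / 3.
  have /cvgrPdist_le/(_ _ e3)[n _ Hn] := e0.
  exists n; have := Hn n (leqnn n).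
  by rewrite /= sub0r normrN; apply: le_trans; exact: ler_norm.
have := @ex_derive _ _ _ _ _ _ _ (hf n x).
have := @derive_val _ _ _ _ _ _ _ (hf n x).
rewrite /derive => dn cn.
have : h^-1 *: (f_ n (h *: 1 + x) - f_ n x) @[h --> 0^'] --> df_ n x.
  by rewrite -dn.
move=> /cvgrPdist_le/(_ _ e3) near_n.
near=> h.
have h0 : h != 0 by near: h; exact: nbhs_dnbhs_neq.
have h1 : `|h| <= 1.
  near: h; apply: nbhs_dnbhs; apply/nbhs_ballP; exists 1 => //= z.
  by rewrite /ball/= sub0r normrN => /ltW.
have hx : `|h *: 1 + x - x| <= 1 by rewrite addrK [h *: 1]mulr1.
have k1 := key n _ hx.
have k2 := dfg n x x1.
have k3 : `|df_ n x - h^-1 *: (f_ n (h *: 1 + x) - f_ n x)| <= eps / 3.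
  by near: h.
set fy := f (h *: 1 + x) in k1 *; set fny := f_ n (h *: 1 + x) in k1 k3 *.
have -> : g x - h^-1 *: (fy - f x) =
   - (df_ n x - g x) + (df_ n x - h^-1 *: (fny - f_ n x))
   - h^-1 * ((fy - fny) - (f x - f_ n x)).
  by rewrite /GRing.scale/=; ring.
apply: le_trans (ler_normB _ _) _.
have k4 : `|h^-1 * ((fy - fny) - (f x - f_ n x))| <= eps / 3.
  rewrite normrM normfV mulrC ler_pdivrMr ?normr_gt0//.
  apply: (le_trans k1); rewrite addrK [h *: 1]mulr1 ler_wpM2r//.
have -> : eps = (eps / 3 + eps / 3) + eps / 3 by field.
apply: lerD => //; apply: le_trans (ler_normD _ _) _.
by rewrite normrN lerD// (le_trans k2).
Unshelve. all: by end_near. Qed.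

End Calculus.

(** * Periodized wavelets *)

Section LatticeSums.
Context {R : realType}.
Implicit Types (x y z t C : R) (j k n m N : nat).

(** Distance to the nearest integer. *)
Definition distZ y : R := Num.min (frac_part y) (1 - frac_part y).

Lemma distZ_ge0 y : 0 <= distZ y.
Proof. by rewrite le_min frac_part_ge0 subr_ge0 ltW ?frac_part_lt1. Qed.

Lemma distZ_ex y : exists2 l : int, distZ y = `|y - l%:~R| &
  l = Num.floor y \/ l = Num.floor y + 1.
Proof.
have := frac_part_ge0 y; have := frac_part_lt1 y; rewrite /distZ /frac_part => h1 h0.
case: leP => _; [exists (Num.floor y)|exists (Num.floor y + 1)]; [|by left| |by right].
  by rewrite ger0_norm.
by rewrite distrC intrD ger0_norm; lra.
Qed.

Lemma distZ_le y (l : int) : distZ y <= `|y - l%:~R|.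
Proof.
have := frac_part_ge0 y; have := frac_part_lt1 y; rewrite /distZ /frac_part => h1 h0.
have [ly|yl] := leP l (Num.floor y).
  have lyR : l%:~R <= (Num.floor y)%:~R :> R by rewrite ler_int.
  by rewrite ge_min; apply/orP; left; apply: le_trans (ler_norm _); lra.
have ylR : (Num.floor y)%:~R + 1 <= l%:~R :> R by rewrite -[1]/(1%:~R) -intrD ler_int; lia.
by rewrite ge_min; apply/orP; right; rewrite distrC; apply: le_trans (ler_norm _); lra.
Qed.

Lemma distZ_shift y (l : int) : distZ (y + l%:~R) = distZ y.
Proof.
rewrite /distZ /frac_part floorDrz ?intr_int// intrKfloor intrD.
by have -> : y + l%:~R - ((Num.floor y)%:~R + l%:~R) = y - (Num.floor y)%:~R by ring.
Qed.

Lemma distZ_lip y z : distZ y <= distZ z + `|y - z|.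
Proof.
have [l -> _] := distZ_ex z; apply: le_trans (distZ_le y l) _.
have -> : y - l%:~R = (z - l%:~R) + (y - z) by ring.
exact: ler_normD.
Qed.

Definition decay t : R := (1 + t ^+ 2)^-1.

Lemma decay_gt0 t : 0 < decay t.
Proof. by rewrite /decay invr_gt0 ltr_pwDl ?ltr01// sqr_ge0. Qed.

Lemma decay_ge0 t : 0 <= decay t. Proof. exact/ltW/decay_gt0. Qed.

Lemma decay_le1 t : decay t <= 1.
Proof. by rewrite /decay invf_le1 ?ltr_pwDl ?ltr01 ?sqr_ge0// lerDl sqr_ge0. Qed.

Lemma decay_mono t u : `|t| <= `|u| -> decay u <= decay t.
Proof.
move=> tu; rewrite /decay lef_pV2 ?posrE ?ltr_pwDl ?ltr01 ?sqr_ge0//.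
by rewrite lerD2l -(real_normK (num_real t)) -(real_normK (num_real u)) lerXn2r ?nnegrE.
Qed.

(** Comparison of the lattice sums of [decay] with a telescoping sum of its
    primitive, which bounds them independently of the number of terms. *)
Lemma decay_le_atan t : decay t <= 3 * (atan (t + 1) - atan t).
Proof.
have [||z] := @MVT_segment _ atan (fun z => (1 + z ^+ 2)^-1) t (t + 1).
- by rewrite lerDl.
- apply: derivable_within_continuous => x _.
  exact: (@ex_derive _ _ _ _ _ _ _ (is_derive1_atan x)).
rewrite in_itv/= => /andP[tz zt] ->; rewrite addrAC subrr add0r mulr1.
rewrite /decay -[leLHS]mulr1 mulrC ler_pdivrMr ?ltr_pwDl ?ltr01 ?sqr_ge0//.
rewrite mulrAC ler_pdivlMr ?ltr_pwDl ?ltr01 ?sqr_ge0//.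
have h1 : 0 <= (2 * t - z) ^+ 2 by exact: sqr_ge0.
have h2 : (z - t) ^+ 2 <= 1 by rewrite expr_le1//; lra.
rewrite mul1r; have := sqr_ge0 t; lra.
Qed.

Lemma lattice_sum_le y n : \sum_(i < n) decay (y - i%:R) <= 3 * pi.
Proof.
apply: (@le_trans _ _ (\sum_(i < n) - (3 * (atan (y + 1 - i.+1%:R) - atan (y + 1 - i%:R))))).
  apply: ler_sum => i _; apply: le_trans (decay_le_atan _) _.
  have -> : y + 1 - i.+1%:R = y - i%:R by rewrite -natr1; ring.
  by rewrite -mulrN opprB addrAC.
rewrite sumrN -mulr_sumr -(big_mkord xpredT (fun i =>
  atan (y + 1 - i.+1%:R) - atan (y + 1 - i%:R))) telescope_sumr//.
rewrite -mulrN opprB ler_pM2l//.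
have := atan_ltpi2 (y + 1 - 0%:R); have := atan_gtNpi2 (y + 1 - n%:R).
lra.
Qed.

Lemma sym_lattice_sum_le y n :
  \sum_(i < n.*2.+1) decay (y - (i%:R - n%:R)) <= 3 * pi.
Proof.
under eq_bigr do rewrite opprB addrA.
exact: lattice_sum_le.
Qed.

(** The periodic weight localizing around [k / 2^j] at scale [2^(- j)]. *)
Definition weight j k x : R := decay (2 ^+ j * distZ (x - k%:R / 2 ^+ j)).

Lemma weight_ge0 j k x : 0 <= weight j k x. Proof. exact: decay_ge0. Qed.

Lemma weight_le1 j k x : weight j k x <= 1. Proof. exact: decay_le1. Qed.

Lemma weight_shift j k x (l : int) : weight j k (x + l%:~R) = weight j k x.
Proof. by rewrite /weight addrAC distZ_shift. Qed.

Lemma sum_weight_le j x : \sum_(k < 2 ^ j) weight j k x <= 9 * pi.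
Proof.
rewrite (eq_bigr (fun k : 'I_(2 ^ j) => weight j k (frac_part x))) => [|k _]; last first.
  by rewrite /frac_part -mulrNz weight_shift.
set u := frac_part x.
have u0 : 0 <= u by exact: frac_part_ge0.
have u1 : u < 1 by exact: frac_part_lt1.
have j0 : 0 < 2 ^+ j :> R by rewrite exprn_gt0.
pose S l := \sum_(k < 2 ^ j) decay (2 ^+ j * u - 2 ^+ j * l - k%:R) : R.
apply: (@le_trans _ _ (S (- 1) + S 0 + S 1)); last first.
  have SS l : S l <= 3 * pi by exact: lattice_sum_le.
  by have := SS (- 1); have := SS 0; have := SS 1; lra.
rewrite /S -!big_split/=; apply: ler_sum => k _.
have k1 : k%:R / 2 ^+ j < 1 :> R.
  by rewrite ltr_pdivrMr// mul1r -natrX ltr_nat.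
have k0 : 0 <= k%:R / 2 ^+ j :> R by rewrite divr_ge0// ltW.
rewrite /weight; have [l -> lE] := distZ_ex (u - k%:R / 2 ^+ j).
have -> : decay (2 ^+ j * `|u - k%:R / 2 ^+ j - l%:~R|) =
    decay (2 ^+ j * u - 2 ^+ j * l%:~R - k%:R).
  have -> : 2 ^+ j * u - 2 ^+ j * l%:~R - k%:R =
     2 ^+ j * (u - k%:R / 2 ^+ j - l%:~R) by field; rewrite gt_eqF.
  by rewrite /decay !exprMn real_normK ?num_real.
have b1 := decay_ge0 (2 ^+ j * u - 2 ^+ j * -1 - k%:R).
have b2 := decay_ge0 (2 ^+ j * u - 2 ^+ j * 0 - k%:R).
have b3 := decay_ge0 (2 ^+ j * u - 2 ^+ j * 1 - k%:R).
have fl : Num.floor (u - k%:R / 2 ^+ j) = 0 \/ Num.floor (u - k%:R / 2 ^+ j) = -1.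
  have [h|h] := leP 0 (u - k%:R / 2 ^+ j).
    by left; apply: floor_def; rewrite h/=; lra.
  by right; apply: floor_def; rewrite mulrN1z addNr; lra.
have : [\/ l = -1, l = 0 | l = 1].
  by case: lE => ->; case: fl => ->; 
    [apply: Or32|apply: Or31|apply: Or33|apply: Or32].
by case=> ->; rewrite ?mulrN1z ?mulr0z ?mulr1z; lra.
Qed.

End LatticeSums.

Section Periodization.
Context {R : realType}.
Implicit Types (theta psi : R -> R) (x y z C : R) (j k n m N : nat).

Lemma cauchy_rate (u e : nat -> R) :
  (forall n m, (n <= m)%N -> `|u m - u n| <= e n) -> e n @[n --> \oo] --> 0 ->
  exists2 l, u n @[n --> \oo] --> l & forall n, `|l - u n| <= e n.
Proof.
move=> ue e0.
have cu : cvgn u.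
  apply/cauchy_cvgP/cauchy_exP => /= eps eps0.
  have /cvgrPdist_lt/(_ _ eps0)[n _ Hn] := e0.
  exists (u n); exists n => // m nm; rewrite /ball/= distrC.
  apply: le_lt_trans (ue _ _ nm) _; have := Hn n (leqnn n).
  by rewrite /= sub0r normrN; apply: le_lt_trans; exact: ler_norm.
exists (limn u) => // n.
have h : `|u m - u n| @[m --> \oo] --> `|limn u - u n|.
  by apply: cvg_norm; apply: cvgB => //; exact: cvg_cst.
apply: (ler_cvg_to h (cvg_cst (e n))).
by exists n => // m nm; exact: ue.
Qed.

Lemma cvg0_le (u e : nat -> R) : (forall n, `|u n| <= e n) ->
  e n @[n --> \oo] --> 0 -> u n @[n --> \oo] --> 0.
Proof.
move=> ue e0; apply/cvgrPdist_le => eps eps0.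
have /cvgrPdist_le/(_ _ eps0)[n _ Hn] := e0.
exists n => // m nm; rewrite /= sub0r normrN; apply: le_trans (ue m) _.
by have := Hn m nm; rewrite /= sub0r normrN; apply: le_trans; exact: ler_norm.
Qed.

Definition periodic_sum theta j k n x : R :=
  \sum_(i < n.*2.+1) theta (2 ^+ j * (x - (i%:R - n%:R)) - k%:R).

Definition decays C theta := forall y, `|theta y| <= C * decay y.

Lemma decay_shift z y : decay (z - y) <= 2 * (1 + z ^+ 2) * decay y.
Proof.
rewrite /decay ler_pdivlMr ?ltr_pwDl ?ltr01 ?sqr_ge0// mulrC.
rewrite ler_pdivrMr ?ltr_pwDl ?ltr01 ?sqr_ge0//.
have h := sqr_ge0 (2 * z - y).
have h' := mulr_ge0 (sqr_ge0 z) (sqr_ge0 (z - y)).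
have := sqr_ge0 z; lra.
Qed.

Lemma decay_nat n : decay n.+1%:R <= 2 * (n.+1%:R^-1 - n.+2%:R^-1) :> R.
Proof.
have n0 : 0 <= n%:R :> R by exact: ler0n.
have -> : 2 * (n.+1%:R^-1 - n.+2%:R^-1) = 2 / (n.+1%:R * n.+2%:R) :> R.
  rewrite -[n.+2%:R]natr1 -[n.+1%:R]natr1; field.
  by rewrite !gt_eqF//; lra.
rewrite /decay ler_pdivlMr ?mulr_gt0 ?ltr0n// mulrC ler_pdivrMr ?ltr_pwDl ?ltr01 ?sqr_ge0//.
rewrite -[n.+2%:R]natr1 -[n.+1%:R]natr1; nra.
Qed.

Lemma translate_decay C theta j k x y : decays C theta ->
  `|theta (2 ^+ j * (x - y) - k%:R)| <= C * decay (x - k%:R / 2 ^+ j - y).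
Proof.
move=> dC; apply: (le_trans (dC _)).
have C0 : 0 <= C.
  by have := dC 0; have := normr_ge0 (theta 0); rewrite /decay expr0n addr0 invr1 mulr1; lra.
apply: ler_wpM2l => //; apply: decay_mono.
have j1 : 1 <= 2 ^+ j :> R by rewrite exprn_ege1// ler1n.
have -> : 2 ^+ j * (x - y) - k%:R = 2 ^+ j * (x - k%:R / 2 ^+ j - y).
  by field; rewrite gt_eqF// (lt_le_trans _ j1).
by rewrite normrM ler_peMl// ger0_norm// (le_trans _ j1).
Qed.

Lemma periodic_sumS theta j k n x :
  periodic_sum theta j k n.+1 x = periodic_sum theta j k n x +
    (theta (2 ^+ j * (x - n.+1%:R) - k%:R) +
     theta (2 ^+ j * (x - - n.+1%:R) - k%:R)).
Proof.
pose F (m : nat) (i : nat) := theta (2 ^+ j * (x - (i%:R - m%:R)) - k%:R).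
rewrite /periodic_sum doubleS -!(big_mkord xpredT (F _)).
rewrite big_nat_recr// big_nat_recl//= [X in X + _]addrC -addrA; congr (_ + _).
  by apply: eq_bigr => i _; rewrite /F -[n.+1%:R]natr1 -[i.+1%:R]natr1;
    congr (theta (_ * _ - _)); ring.
rewrite addrC /F sub0r; congr (theta (_ * (_ - _) - _) + _).
by rewrite -addnn -addSn -addnS natrD addrK.
Qed.

(** Comparison with the telescoping series of [n.+1%:R^-1 - n.+2%:R^-1]. *)
Lemma periodic_sum_rate C theta j k x : decays C theta ->
  forall n m, (n <= m)%N ->
  `|periodic_sum theta j k m x - periodic_sum theta j k n x| <=
    8 * C * (1 + (x - k%:R / 2 ^+ j) ^+ 2) * n.+1%:R^-1.
Proof.
move=> dC n m nm; set z := x - k%:R / 2 ^+ j.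
have C0 : 0 <= C.
  by have := dC 0; have := normr_ge0 (theta 0); rewrite /decay expr0n addr0 invr1 mulr1; lra.
set B := 8 * C * (1 + z ^+ 2).
have z1 : 0 < 1 + z ^+ 2 by rewrite ltr_pwDl ?ltr01 ?sqr_ge0.
have B0 : 0 <= B by rewrite /B !mulr_ge0// ltW.
suff : `|periodic_sum theta j k m x - periodic_sum theta j k n x| <=
    B * (n.+1%:R^-1 - m.+1%:R^-1).
  move/le_trans; apply; rewrite ler_wpM2l// gerBl invr_ge0 ler0n//.
elim: m nm => [|m IH]; first by rewrite leqn0 => /eqP ->; rewrite !subrr normr0 mulr0.
rewrite leq_eqVlt => /predU1P[<-|]; first by rewrite !subrr normr0 mulr0.
rewrite ltnS => /IH{}IH.
rewrite periodic_sumS addrAC.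
apply: le_trans (ler_normD _ _) _.
have -> : B * (n.+1%:R^-1 - m.+2%:R^-1) = B * (n.+1%:R^-1 - m.+1%:R^-1) +
   B * (m.+1%:R^-1 - m.+2%:R^-1) by ring.
apply: lerD => //; apply: le_trans (ler_normD _ _) _.
have h1 := translate_decay j k x m.+1%:R dC.
have h2 := translate_decay j k x (- m.+1%:R) dC.
apply: (le_trans (lerD h1 h2)); rewrite -/z -mulrDr.
have h3 := decay_shift z m.+1%:R.
have h4 := decay_shift z (- m.+1%:R).
have h5 := @decay_nat m.
have h6 : decay (- m.+1%:R) = decay m.+1%:R :> R by rewrite /decay sqrrN.
rewrite h6 in h4.
apply: (@le_trans _ _ (C * (4 * (1 + z ^+ 2) * decay m.+1%:R))).
  by rewrite ler_wpM2l//; clear -h3 h4; lra.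
rewrite /B mulrA [8 * C]mulrC -!mulrA; apply: ler_wpM2l => //.
have := ler_wpM2l (ltW z1) h5.
set u := _^-1; set v := _^-1; clear; lra.
Qed.

Lemma cvg_rate (B : R) : B * n.+1%:R^-1 @[n --> \oo] --> 0.
Proof.
rewrite -[X in _ --> X](mulr0 B); apply: cvgM; first exact: cvg_cst.
exact: cvg_harmonic.
Qed.

Lemma periodic_sum_cvg C theta j k x : decays C theta ->
  periodic_sum theta j k n x @[n --> \oo] --> wavelet theta j k x.
Proof.
move=> dC.
have [l ul _] := cauchy_rate (@periodic_sum_rate C theta j k x dC) (@cvg_rate _).
by move: (ul); rewrite -(cvg_lim (@Rhausdorff R) ul).
Qed.

Lemma wavelet_rate C theta j k x n : decays C theta ->
  `|wavelet theta j k x - periodic_sum theta j k n x| <=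
    8 * C * (1 + (x - k%:R / 2 ^+ j) ^+ 2) * n.+1%:R^-1.
Proof.
move=> dC.
have [l ul le] := cauchy_rate (@periodic_sum_rate C theta j k x dC) (@cvg_rate _).
by rewrite (cvg_unique (@Rhausdorff R) (@periodic_sum_cvg _ theta j k x dC) ul).
Qed.

Lemma wavelet_periodic C theta j k : decays C theta ->
  periodic (wavelet theta j k) 1.
Proof.
move=> dC x.
have cv := @periodic_sum_cvg _ theta j k (x + 1) dC.
have cv' := @periodic_sum_cvg _ theta j k x dC.
suff d0 : periodic_sum theta j k n (x + 1) - periodic_sum theta j k n x @[n --> \oo] --> 0.
  have E := cvg_unique (@Rhausdorff R) (cvgB cv cv') d0.
  by apply/eqP; rewrite -subr_eq0; apply/eqP; exact: E.
have C0 : 0 <= C.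
  by have := dC 0; have := normr_ge0 (theta 0); rewrite /decay expr0n addr0 invr1 mulr1; lra.
set z := x - k%:R / 2 ^+ j.
apply: (@cvg0_le _ (fun n => C * (6 * (1 + z ^+ 2)) * n.+1%:R^-1)); last exact: cvg_rate.
move=> n.
pose F (y : R) (i : nat) := theta (2 ^+ j * (y - (i%:R - n%:R)) - k%:R).
rewrite /periodic_sum -!(big_mkord xpredT (F _)) big_nat_recl// big_nat_recr//=.
rewrite (eq_bigr (F x)); last first.
  by move=> i _; rewrite /F; congr (theta (_ * _ - _)); rewrite -[i.+1%:R]natr1; ring.
rewrite (_ : forall a b s : R, (a + s) - (s + b) = a - b) /F; last by move=> *; ring.
have -> : x + 1 - (0 - n%:R) = x - - n.+1%:R by rewrite -natr1; ring.
have -> : n.*2%:R - n%:R = n%:R :> R by rewrite -addnn natrD addrK.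
apply: le_trans (ler_normB _ _) _.
have h1 := translate_decay j k x (- n.+1%:R) dC.
have h2 := translate_decay j k x n%:R dC.
apply: (le_trans (lerD h1 h2)); rewrite -/z -mulrDr -mulrA; apply: ler_wpM2l => //.
have h3 := decay_shift z (- n.+1%:R).
have h4 := decay_shift z n%:R.
have n0 : 0 <= n%:R :> R by exact: ler0n.
have n1 : 0 < n.+1%:R :> R by rewrite ltr0n.
have h5 : decay (- n.+1%:R) <= n.+1%:R^-1 :> R.
  rewrite /decay sqrrN lef_pV2 ?posrE ?ltr_pwDl ?ltr01 ?sqr_ge0// -natr1; nra.
have h6 : decay n%:R <= 2 * n.+1%:R^-1 :> R.
  rewrite ler_pdivlMr// /decay mulrC ler_pdivrMr ?ltr_pwDl ?ltr01 ?sqr_ge0//.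
  rewrite -natr1; have := sqr_ge0 (n%:R - 1 : R); nra.
have z1 : 0 <= 1 + z ^+ 2 by rewrite addr_ge0 ?sqr_ge0.
have := ler_wpM2l z1 h5; have := ler_wpM2l z1 h6; move: h3 h4.
set u := _^-1; clear; lra.
Qed.

(** The decay of the wavelet is shared between the summability over the
    periods and the localization of the periodized wavelet. *)
Lemma wavelet_le C theta j k x N : 0 <= C ->
  (forall y, `|theta y| <= C * decay y ^+ N.+1) ->
  `|wavelet theta j k x| <= C * (3 * pi) * weight j k x ^+ N.
Proof.
move=> C0 dC.
have dC1 : decays C theta.
  move=> y; apply: le_trans (dC y) _; rewrite ler_wpM2l// exprS.
  by rewrite ler_piMr ?decay_ge0// exprn_ile1 ?decay_ge0 ?decay_le1.
have j1 : 1 <= 2 ^+ j :> R by rewrite exprn_ege1// ler1n.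
have cv : `|periodic_sum theta j k n x| @[n --> \oo] --> `|wavelet theta j k x|.
  by apply: cvg_norm; exact: (@periodic_sum_cvg _ theta j k x dC1).
apply: (ler_cvg_to cv (cvg_cst (C * (3 * pi) * weight j k x ^+ N))).
apply: nearW => n.
apply: le_trans (ler_norm_sum _ _ _) _.
set z := x - k%:R / 2 ^+ j.
apply: (@le_trans _ _ (\sum_(i < n.*2.+1)
   C * (weight j k x ^+ N * decay (z - (i%:R - n%:R))))).
  apply: ler_sum => i _; apply: le_trans (dC _) _; apply: ler_wpM2l => //.
  have -> : 2 ^+ j * (x - (i%:R - n%:R)) - k%:R = 2 ^+ j * (z - (i%:R - n%:R)).
    by rewrite /z; field; rewrite gt_eqF// (lt_le_trans _ j1).
  rewrite exprSr; apply: ler_pM; rewrite ?exprn_ge0 ?decay_ge0//.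
    rewrite lerXn2r ?nnegrE ?decay_ge0//; apply: decay_mono.
    rewrite !normrM ler_wpM2l// ger0_norm ?distZ_ge0//.
    have := distZ_le z (Posz i - Posz n).
    by rewrite intrD mulrNz -!pmulrn.
  apply: decay_mono; rewrite normrM ler_peMl//.
  by rewrite ger0_norm// (le_trans _ j1).
rewrite -mulr_sumr -mulr_sumr -mulrA; apply: ler_wpM2l => //.
by rewrite mulrC ler_wpM2r ?exprn_ge0 ?weight_ge0// sym_lattice_sum_le.
Qed.

Lemma is_derive_sum_fun n (f df : nat -> R -> R) x :
  (forall i, is_derive x 1 (f i) (df i x)) ->
  is_derive x 1 (fun y => \sum_(i < n) f i y) (\sum_(i < n) df i x).
Proof.
move=> hf.
have -> : (fun y => \sum_(i < n) f i y) = \sum_(i < n) f i.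
  by apply/funext => y; rewrite fct_sumE.
exact: is_derive_sum.
Qed.

Lemma is_derive_wavelet C C' theta dtheta j k x : decays C theta ->
  decays C' dtheta -> (forall y, is_derive y 1 theta (dtheta y)) ->
  is_derive x 1 (wavelet theta j k) (2 ^+ j * wavelet dtheta j k x).
Proof.
move=> dC dC' hth.
pose A := `|x - k%:R / 2 ^+ j| + 1.
have C0 : 0 <= C'.
  by have := dC' 0; have := normr_ge0 (dtheta 0); rewrite /decay expr0n addr0 invr1 mulr1; lra.
apply: (@is_derive_lim R (periodic_sum theta j k)
  (fun n y => 2 ^+ j * periodic_sum dtheta j k n y) _
  (fun y => 2 ^+ j * wavelet dtheta j k y)
  (fun n => (2 ^+ j * (8 * C' * (1 + A ^+ 2))) * n.+1%:R^-1)).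
- move=> n y; rewrite /periodic_sum mulr_sumr.
  apply: (@is_derive_sum_fun _
    (fun i y => theta (2 ^+ j * (y - (i%:R - n%:R)) - k%:R))
    (fun i y => 2 ^+ j * dtheta (2 ^+ j * (y - (i%:R - n%:R)) - k%:R))) => i.
  have hd := hth (2 ^+ j * y + (2 ^+ j * - (i%:R - n%:R) - k%:R)).
  have := is_derive_affine hd.
  have E (y' : R) : 2 ^+ j * y' + (2 ^+ j * - (i%:R - n%:R) - k%:R) =
      2 ^+ j * (y' - (i%:R - n%:R)) - k%:R by ring.
  by rewrite E; under eq_fun do rewrite E.
- by move=> y _; exact: periodic_sum_cvg dC.
- move=> n y yx; rewrite -mulrBr normrM ger0_norm ?exprn_ge0// -!mulrA.
  rewrite distrC ler_wpM2l ?exprn_ge0//.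
  apply: le_trans (@wavelet_rate _ dtheta j k y n dC') _; rewrite -!mulrA.
  apply: ler_wpM2l => //; apply: ler_wpM2l => //.
  rewrite ler_wpM2r ?invr_ge0// lerD2l -real_normK ?num_real// lerXn2r ?nnegrE//.
    by rewrite /A addr_ge0.
  have -> : y - k%:R / 2 ^+ j = (x - k%:R / 2 ^+ j) + (y - x) by ring.
  by apply: le_trans (ler_normD _ _) _; rewrite lerD2l.
- exact: cvg_rate.
Qed.

End Periodization.

Section SchwartzWavelets.
Context {R : realType}.
Implicit Types (psi : R -> R) (x y C : R) (j k n m N : nat).

Lemma schwartz_decay psi m N : schwartz psi ->
  exists2 C, 0 <= C & forall y, `|derive1n m psi y| <= C * decay y ^+ N.
Proof.
move=> [_ spsi].
have [C0 HC0] := spsi 0%N m; have [C1 HC1] := spsi N.*2 m.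
have C00 : 0 <= C0 by apply: le_trans (HC0 0); rewrite expr0 mul1r.
have C10 : 0 <= C1 by apply: le_trans (HC1 0); rewrite mulr_ge0 ?exprn_ge0.
exists (2 ^+ N * (C0 + C1)); first by rewrite mulr_ge0 ?exprn_ge0 ?addr_ge0.
move=> y; have y1 : 0 < 1 + y ^+ 2 by rewrite ltr_pwDl ?ltr01 ?sqr_ge0.
rewrite /decay exprVn ler_pdivlMr ?exprn_gt0// mulrC.
have h0 := HC0 y; have h1 := HC1 y; rewrite expr0 mul1r in h0.
set v := `|_ y| in h0 h1 *.
have v0 : 0 <= v by exact: normr_ge0.
have [y2|y2] := leP (y ^+ 2) 1.
  apply: (@le_trans _ _ (2 ^+ N * v)).
    by rewrite ler_wpM2r// lerXn2r ?nnegrE ?(ltW y1)//; lra.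
  by rewrite ler_wpM2l ?exprn_ge0//; lra.
apply: (@le_trans _ _ ((2 * y ^+ 2) ^+ N * v)).
  rewrite ler_wpM2r// lerXn2r ?nnegrE ?(ltW y1)//; last lra.
  by rewrite mulr_ge0 ?sqr_ge0.
rewrite exprMn -mulrA ler_wpM2l ?exprn_ge0//.
have -> : (y ^+ 2) ^+ N = `|y| ^+ N.*2 by rewrite -real_normK ?num_real// -exprM -mul2n.
clear -h1 C00; lra.
Qed.

Lemma schwartz_decays psi m : schwartz psi -> exists C, decays C (derive1n m psi).
Proof.
by move=> /(@schwartz_decay psi m 1)[C _ HC]; exists C => y; have := HC y; rewrite expr1.
Qed.

Lemma is_derive_schwartz_wavelet psi j k n x : schwartz psi ->
  is_derive x 1 (fun x => 2 ^+ (j * n) * wavelet (derive1n n psi) j k x)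
    (2 ^+ (j * n.+1) * wavelet (derive1n n.+1 psi) j k x).
Proof.
move=> spsi; have [C dC] := schwartz_decays n spsi.
have [C' dC'] := schwartz_decays n.+1 spsi.
have -> : 2 ^+ (j * n.+1) * wavelet (derive1n n.+1 psi) j k x =
    2 ^+ (j * n) *: (2 ^+ j * wavelet (derive1n n.+1 psi) j k x).
  by rewrite /GRing.scale/= mulrA -exprD mulnS addnC.
apply: is_deriveZ.
exact: (is_derive_wavelet j k x dC dC' (fun y => is_derive_smooth n y spsi.1)).
Qed.

Lemma derive1n_wavelet psi j k n : schwartz psi ->
  derive1n n (wavelet psi j k) =
  (fun x => 2 ^+ (j * n) * wavelet (derive1n n psi) j k x).
Proof.
move=> spsi.
pose F n x := 2 ^+ (j * n) * wavelet (derive1n n psi) j k x.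
have -> : wavelet psi j k = F 0%N.
  by apply/funext => x; rewrite /F muln0 expr0 mul1r.
exact: (@derive1n_family _ F (fun n x => is_derive_schwartz_wavelet j k n x spsi)).
Qed.

Lemma wavelet_test psi j k : schwartz psi -> periodic_test (wavelet psi j k).
Proof.
move=> spsi; split; last first.
  by have [C dC] := schwartz_decays 0 spsi; exact: (wavelet_periodic j k dC).
pose F n x := 2 ^+ (j * n) * wavelet (derive1n n psi) j k x.
have -> : wavelet psi j k = F 0%N.
  by apply/funext => x; rewrite /F muln0 expr0 mul1r.
exact: (@smooth_family _ F (fun n x => is_derive_schwartz_wavelet j k n x spsi)).
Qed.

(** Each derivative costs a factor [2 ^+ j] and keeps the localization. *)
Lemma derive1n_wavelet_le psi n N : schwartz psi ->
  exists2 C, 0 <= C & forall j k x,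
    `|derive1n n (wavelet psi j k) x| <= C * 2 ^+ (j * n) * weight j k x ^+ N.
Proof.
move=> spsi; have [C C0 HC] := schwartz_decay n N.+1 spsi.
exists (C * (3 * pi)); first by rewrite !mulr_ge0// ltW// pi_gt0.
move=> j k x; rewrite derive1n_wavelet// normrM ger0_norm ?exprn_ge0//.
rewrite [X in _ <= X * _]mulrC -mulrA.
by rewrite ler_wpM2l ?exprn_ge0// wavelet_le.
Qed.

End SchwartzWavelets.

(** * Integrals of continuous functions through primitives *)

Section Primitives.
Context {R : realType}.
Notation mu := (@lebesgue_measure R).
Implicit Types (f g : R -> R) (a b x : R).

Lemma continuous_integrable_itv f a b : continuous f ->
  mu.-integrable `[a, b] (EFin \o f).
Proof.
move=> cf; apply: continuous_compact_integrable; first exact: segment_compact.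
exact: continuous_subspaceT.
Qed.

Lemma primitive_ex f : continuous f ->
  exists F : R -> R, forall x, is_derive x 1 F (f x).
Proof.
move=> cf.
pose F x : R := if 0 <= x then \int[mu]_(t in `]0, x]) f t
                else - \int[mu]_(t in `]x, 0]) f t.
exists F => x0.
pose a : R := Num.min x0 0 - 1.
have ax0 : a < x0.
  have : Num.min x0 0 <= x0 by rewrite ge_min lexx.
  by rewrite /a; lra.
have a0 : a < 0.
  have : Num.min x0 0 <= 0 by rewrite ge_min lexx orbT.
  by rewrite /a; lra.
pose G x : R := \int[mu]_(t in `[a, x]) f t - \int[mu]_(t in `[a, 0]) f t.
have FG x : a <= x -> F x = G x.
  move=> ax; rewrite /F /G; case: (leP 0 x) => x0'.
    by rewrite Rintegral_itvB ?bnd_simp ?(ltW a0)//; exact: continuous_integrable_itv.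
  rewrite -[RHS]opprK opprB Rintegral_itvB ?bnd_simp ?(ltW x0')//.
  exact: continuous_integrable_itv.
have x01 : x0 < x0 + 1 by rewrite ltrDl.
have [dG GE] := continuous_FTC1_closed x01
  (continuous_integrable_itv a (x0 + 1) cf) ax0 (cf x0).
have HG : is_derive x0 1 G (f x0).
  rewrite -[f x0]subr0 /G; apply: is_deriveB.
  by apply: DeriveDef; [exact: dG|rewrite -derive1E].
apply: near_eq_is_derive HG => //.
near=> y; apply: esym; apply: FG; apply: ltW; near: y; exact: lt_nbhsr.
Unshelve. all: by end_near. Qed.

Definition primitive f : R -> R :=
  if pselect (exists F : R -> R, forall x, is_derive x 1 F (f x)) is left H
  then projT1 (cid H) else 0.

Lemma is_derive_primitive f x : continuous f -> is_derive x 1 (primitive f) (f x).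
Proof.
move=> cf; rewrite /primitive; case: pselect => [H|[]]; last exact: primitive_ex.
exact: (projT2 (cid H)).
Qed.

(** The oriented integral of a continuous function. Taken as the increment of a
    primitive, it is additive for all positions of the end points, and its
    properties are identities between derivatives. *)
Definition cint f a b : R := primitive f b - primitive f a.

Lemma cintE f F a b : (forall x, is_derive x 1 F (f x)) -> continuous f ->
  cint f a b = F b - F a.
Proof.
move=> dF cf.
have d0 x : is_derive x 1 (fun y => primitive f y - F y) 0.
  rewrite -[0](subrr (f x)); apply: is_deriveB.
  exact: is_derive_primitive.
have := is_derive_0_is_cst b a d0; rewrite /cint.
by move=> /(congr1 (fun u => u + F b - primitive f a)); rewrite subrK => ->; ring.
Qed.

Lemma cint_add f a b x : cint f a b + cint f b x = cint f a x.
Proof. by rewrite /cint; ring. Qed.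

Lemma integral_cint f a b : a < b -> continuous f ->
  (\int[mu]_(x in `[a, b]) (f x)%:E = (cint f a b)%:E)%E.
Proof.
move=> ab cf; rewrite (@continuous_FTC2 _ f (primitive f))//.
- exact: continuous_subspaceT.
- have cP x : {for x, continuous (primitive f)}.
    exact: is_derive_continuous (is_derive_primitive x cf).
  split.
  + by move=> x _; have := is_derive_primitive x cf.
  + exact/cvg_at_right_filter/cP.
  + exact/cvg_at_left_filter/cP.
- move=> x _; rewrite derive1E; have dP := is_derive_primitive x cf.
  exact: derive_val.
Qed.

Lemma cint_Rintegral f a b : a < b -> continuous f ->
  \int[mu]_(x in `[a, b]) f x = cint f a b.
Proof. by move=> ab cf; rewrite /Rintegral integral_cint. Qed.

Lemma cint_lincomb f g (k : R) a b : continuous f -> continuous g ->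
  cint (fun x => k * f x + g x) a b = k * cint f a b + cint g a b.
Proof.
move=> cf cg.
have dP x : is_derive x 1 (fun y => k * primitive f y + primitive g y) (k * f x + g x).
  have hf := is_derive_primitive x cf; have hg := is_derive_primitive x cg.
  exact: is_derive_lincomb.
rewrite (cintE a b dP); first by rewrite /cint; ring.
by move=> x; apply: cvgD; [apply: cvgM; [exact: cvg_cst|exact: cf]|exact: cg].
Qed.

Lemma cint_cst (k : R) a b : cint (cst k) a b = k * (b - a).
Proof.
have dP x : is_derive x 1 (fun y : R => k * y + 0) (cst k x).
  rewrite /cst -[X in is_derive _ _ _ X]addr0 -[X in X + _]mulr1.
  exact: is_derive_lincomb.
rewrite (cintE a b dP); first by ring.
by move=> x; exact: cvg_cst.
Qed.

Lemma cint_affine f (k d : R) a b : continuous f ->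
  k * cint (fun x => f (k * x + d)) a b = cint f (k * a + d) (k * b + d).
Proof.
move=> cf.
have caff : continuous (fun x : R => k * x + d).
  by move=> x; apply: cvgD; [apply: cvgM; [exact: cvg_cst|exact: cvg_id]|exact: cvg_cst].
have cc : continuous (fun x => f (k * x + d)).
  by move=> x; apply: (@continuous_comp _ _ _ (fun x : R => k * x + d) f); [exact: caff|exact: cf].
have c0 : continuous (cst 0 : R -> R) by move=> x; exact: cvg_cst.
have z : cint (cst 0) a b = 0.
  by rewrite cint_cst mul0r.
have <- : cint (fun x => k * f (k * x + d) + cst 0 x) a b = k * cint (fun x => f (k * x + d)) a b.
  by rewrite cint_lincomb// z addr0.
have dP x : is_derive x 1 (fun y => primitive f (k * y + d)) (k * f (k * x + d) + cst 0 x).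
  rewrite addr0; apply: is_derive_affine; exact: is_derive_primitive.
rewrite (cintE a b dP)//.
by move=> x; apply: cvgD; [apply: cvgM; [exact: cvg_cst|exact: cc]|exact: cvg_cst].
Qed.

Lemma cint_le f g a b : a <= b -> continuous f -> continuous g ->
  (forall x, a <= x <= b -> f x <= g x) -> cint f a b <= cint g a b.
Proof.
move=> ab cf cg fg.
pose H x := primitive g x - primitive f x.
have dH x : is_derive x 1 H (g x - f x).
  by apply: is_deriveB; exact: is_derive_primitive.
have cH : continuous H by move=> x; exact: is_derive_continuous (dH x).
have [z + HE] := MVT_segment ab (fun x _ => dH x) (continuous_subspaceT cH).
rewrite in_itv/= => zab.
have : 0 <= H b - H a.
  by rewrite HE mulr_ge0 ?subr_ge0//; apply: fg.
by rewrite /H /cint; lra.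
Qed.

Lemma normr_cint_le f g a b : a <= b -> continuous f -> continuous g ->
  (forall x, a <= x <= b -> `|f x| <= g x) -> `|cint f a b| <= cint g a b.
Proof.
move=> ab cf cg fg; rewrite ler_norml; apply/andP; split; last first.
  by apply: cint_le => // x /fg; rewrite ler_norml => /andP[].
have cN : continuous (fun x => (-1) * f x + 0) .
  by move=> x; apply: cvgD; [apply: cvgM; [exact: cvg_cst|exact: cf]|exact: cvg_cst].
have : cint (fun x => (-1) * f x + 0) a b <= cint g a b.
  by apply: cint_le => // x /fg; rewrite ler_norml => /andP[]; lra.
have c0 : continuous (cst 0 : R -> R) by move=> x; exact: cvg_cst.
have z : cint (cst 0) a b = 0.
  by rewrite cint_cst mul0r.
have := cint_lincomb (-1) a b cf c0; rewrite z => ->.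
lra.
Qed.

End Primitives.

(** * Vanishing moments *)

Section ImproperIntegrals.
Context {R : realType}.
Implicit Types (f g phi psi : R -> R) (a b x C B : R) (j k m n : nat).

Lemma continuous_decay : continuous (@decay R).
Proof. exact: continuous_oneDsqrV. Qed.

Lemma cint_decay a b : cint decay a b = atan b - atan a :> R.
Proof. by rewrite (cintE a b (@is_derive1_atan R))//; exact: continuous_decay. Qed.

Lemma normr_cint_decays C f a b : a <= b -> continuous f -> decays C f ->
  `|cint f a b| <= C * (atan b - atan a).
Proof.
move=> ab cf fC.
have cd := continuous_decay.
have cC : continuous (fun x => C * decay x + cst 0 x).
  by move=> x; apply: cvgD; [apply: cvgM; [exact: cvg_cst|exact: cd]|exact: cvg_cst].
have c0 : continuous (cst 0 : R -> R) by move=> x; exact: cvg_cst.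
apply: le_trans (normr_cint_le ab cf cC _) _.
  by move=> x _; rewrite /cst addr0; exact: fC.
by rewrite cint_lincomb// cint_decay cint_cst mul0r addr0.
Qed.

(** Used for functions with quadratic decay, for which all exhausting sequences
    of intervals give the same limit. *)
Definition line_int f : R := limn (fun n : nat => cint f (- n%:R) n%:R).

Lemma atan_nat_cvg C : C * (pi - 2 * atan n%:R) @[n --> \oo] --> (0 : R).
Proof.
have h : (fun n : nat => atan n%:R) @ \oo --> (pi / 2 : R).
  by apply: (cvg_comp _ _ (@cvgr_idn R) (@cvgy_atan R)).
have -> : 0 = C * (pi - 2 * (pi / 2)) :> R by field.
apply: cvgM; first exact: cvg_cst.
apply: cvgB; first exact: cvg_cst.
by apply: cvgM; [exact: cvg_cst|exact: h].
Qed.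

Lemma cint_window C f a b n : continuous f -> decays C f ->
  a <= - n%:R -> n%:R <= b ->
  `|cint f a b - cint f (- n%:R) n%:R| <= C * (pi - 2 * atan n%:R).
Proof.
move=> cf fC an nb.
have -> : cint f a b - cint f (- n%:R) n%:R = cint f a (- n%:R) + cint f n%:R b.
  by rewrite /cint; ring.
apply: le_trans (ler_normD _ _) _.
have h1 := normr_cint_decays an cf fC; have h2 := normr_cint_decays nb cf fC.
apply: (le_trans (lerD h1 h2)); rewrite -mulrDr atanN; apply: ler_wpM2l.
  by have := fC 0; have := normr_ge0 (f 0); rewrite /decay expr0n addr0 invr1 mulr1; lra.
have := atan_gtNpi2 a; have := atan_ltpi2 b; lra.
Qed.

Lemma line_int_cvg C f (a b : nat -> R) : continuous f -> decays C f ->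
  (forall n, a n <= - n%:R) -> (forall n, n%:R <= b n) ->
  cint f (a n) (b n) @[n --> \oo] --> line_int f.
Proof.
move=> cf fC an nb.
have [l ul _] : exists2 l, cint f (- n%:R) n%:R @[n --> \oo] --> l &
    forall n, `|l - cint f (- n%:R) n%:R| <= C * (pi - 2 * atan n%:R).
  apply: cauchy_rate; last exact: atan_nat_cvg.
  by move=> n m nm; apply: cint_window => //; rewrite ?lerN2 ler_nat.
have lE : line_int f = l by exact: (cvg_lim (@Rhausdorff R) ul).
rewrite lE -[l]addr0.
have -> : (fun n => cint f (a n) (b n)) = (fun n => cint f (- n%:R) n%:R +
    (cint f (a n) (b n) - cint f (- n%:R) n%:R)).
  by apply/funext => n; ring.
apply: cvgD => //; apply: cvg0_le (atan_nat_cvg C) => n.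
exact: cint_window.
Qed.

Lemma cint_sum n (F : nat -> R -> R) a b : (forall i, continuous (F i)) ->
  cint (fun x => \sum_(i < n) F i x) a b = \sum_(i < n) cint (F i) a b /\
  continuous (fun x => \sum_(i < n) F i x).
Proof.
move=> cF; elim: n => [|n [IH cn]].
  have -> : (fun x : R => \sum_(i < 0) F i x) = cst 0.
    by apply/funext => x; rewrite big_ord0.
  by rewrite cint_cst mul0r big_ord0; split=> // x; exact: cvg_cst.
have -> : (fun x => \sum_(i < n.+1) F i x) =
          (fun x => 1 * (\sum_(i < n) F i x) + F n x).
  by apply/funext => x; rewrite big_ord_recr/= mul1r.
rewrite cint_lincomb// mul1r IH big_ord_recr/=; split=> // x.
by apply: cvgD; [apply: cvgM; [exact: cvg_cst|exact: cn]|exact: cF].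
Qed.

Lemma periodic_int phi x (l : int) : periodic phi 1 -> phi (x + l%:~R) = phi x.
Proof.
move=> pphi.
have pn y (n : nat) : phi (y + n%:R) = phi y.
  by elim: n => [|n IH]; rewrite ?addr0// -natr1 addrA pphi IH.
case: l => n; first exact: pn.
by rewrite NegzE mulrNz -[in RHS](subrK n.+1%:R x) pn.
Qed.

Lemma periodic_bounded phi : continuous phi -> periodic phi 1 ->
  exists2 B, 0 <= B & forall x, `|phi x| <= B.
Proof.
move=> cphi pphi.
have cn : {within `[0, 1], continuous (fun x => `|phi x|)}.
  by apply: continuous_subspaceT => x; apply: cvg_norm; exact: cphi.
have [z _ Hz] := EVT_max ler01 cn.
exists `|phi z|; first exact: normr_ge0.
move=> x; have := Hz (frac_part x).
rewrite /frac_part -mulrNz periodic_int//; apply.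
by rewrite in_itv/= mulrNz frac_part_ge0 ltW ?frac_part_lt1.
Qed.

End ImproperIntegrals.

Section Moments.
Context {R : realType}.
Implicit Types (f g phi psi : R -> R) (a b x C B : R) (j k m n M : nat).

Lemma periodic_sum_continuous psi j k n : continuous psi ->
  continuous (periodic_sum psi j k n).
Proof.
move=> cpsi.
have cF i : continuous (fun x => psi (2 ^+ j * (x - (i%:R - n%:R)) - k%:R)).
  move=> x; apply: (@continuous_comp _ _ _
    (fun x : R => 2 ^+ j * (x - (i%:R - n%:R)) - k%:R) psi); last exact: cpsi.
  apply: cvgB; last exact: cvg_cst.
  by apply: cvgM; [exact: cvg_cst|apply: cvgB; [exact: cvg_id|exact: cvg_cst]].
exact: (@cint_sum R n.*2.+1
  (fun i x => psi (2 ^+ j * (x - (i%:R - n%:R)) - k%:R)) 0 1 cF).2.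
Qed.

Definition unfolded phi psi j k : R -> R :=
  fun y => phi ((2 ^+ j)^-1 * y + k%:R / 2 ^+ j) * psi y.

Lemma continuousM_fun f g : continuous f -> continuous g ->
  continuous (fun x => f x * g x).
Proof. by move=> cf cg x; apply: cvgM; [exact: cf|exact: cg]. Qed.

Lemma continuous_affine f a b : continuous f -> continuous (fun x => f (a * x + b)).
Proof.
move=> cf x; apply: (@continuous_comp _ _ _ (fun x : R => a * x + b) f); last exact: cf.
by apply: cvgD; [apply: cvgM; [exact: cvg_cst|exact: cvg_id]|exact: cvg_cst].
Qed.

Lemma unfolded_continuous phi psi j k : continuous phi -> continuous psi ->
  continuous (unfolded phi psi j k).
Proof. by move=> cphi cpsi; apply: continuousM_fun => //; exact: continuous_affine. Qed.

(** Periodicity turns the periodized wavelet over one period into the wavelet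
    over many periods. *)
Lemma cint_periodic_sum phi psi j k n : continuous phi -> periodic phi 1 ->
  continuous psi ->
  2 ^+ j * cint (fun x => phi x * periodic_sum psi j k n x) 0 1 =
  cint (unfolded phi psi j k) (- (2 ^+ j * n%:R) - k%:R)
    (2 ^+ j * n.+1%:R - k%:R).
Proof.
move=> cphi pphi cpsi.
have j0 : 2 ^+ j != 0 :> R by rewrite expf_neq0.
pose H := unfolded phi psi j k.
have cH : continuous H by exact: unfolded_continuous.
pose d (i : nat) : R := - (2 ^+ j * (i%:R - n%:R)) - k%:R.
have -> : (fun x => phi x * periodic_sum psi j k n x) =
    (fun x => \sum_(i < n.*2.+1) H (2 ^+ j * x + d i)).
  apply/funext => x; rewrite /periodic_sum mulr_sumr; apply: eq_bigr => i _.
  rewrite /H /unfolded.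
  have -> : (2 ^+ j)^-1 * (2 ^+ j * x + d i) + k%:R / 2 ^+ j =
     x + (Posz n - Posz i)%:~R.
    by rewrite intrD mulrNz -!pmulrn /d; field.
  rewrite periodic_int//; congr (_ * psi _).
  by rewrite /d; ring.
have [-> _] := @cint_sum R n.*2.+1 (fun i x => H (2 ^+ j * x + d i)) 0 1
  (fun i => @continuous_affine H (2 ^+ j) (d i) cH).
rewrite mulr_sumr.
under eq_bigr do rewrite cint_affine// mulr0 add0r mulr1.
have dS i : 2 ^+ j + d i.+1 = d i by rewrite /d -natr1; ring.
pose P i := primitive H (2 ^+ j + d i).
rewrite (eq_bigr (fun i : 'I_n.*2.+1 => - (P i.+1 - P i))); last first.
  by move=> i _; rewrite /P dS opprB.
rewrite sumrN -(big_mkord xpredT (fun i => P i.+1 - P i)) telescope_sumr// opprB.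
rewrite /P dS /cint /H; congr (primitive _ _ - primitive _ _); rewrite /d.
  by rewrite -natr1; ring.
by rewrite -addnn natrD; ring.
Qed.

Lemma unfold_cvg C phi psi j k : smooth phi -> periodic phi 1 ->
  continuous psi -> decays C psi -> continuous (wavelet psi j k) ->
  cint (unfolded phi psi j k) (- (2 ^+ j * n%:R) - k%:R)
    (2 ^+ j * n.+1%:R - k%:R) @[n --> \oo] -->
  2 ^+ j * cint (fun x => phi x * wavelet psi j k x) 0 1.
Proof.
move=> sphi pphi cpsi dC cw.
have cphi := smooth_continuous sphi.
have [B B0 HB] := periodic_bounded cphi pphi.
under eq_fun do rewrite -cint_periodic_sum//.
apply: cvgM; first exact: cvg_cst.
set L := cint _ 0 1; rewrite -[L]addr0.
have -> : (fun n => cint (fun x => phi x * periodic_sum psi j k n x) 0 1) =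
  (fun n => L + (cint (fun x => phi x * periodic_sum psi j k n x) 0 1 - L)).
  by apply/funext => n; ring.
apply: cvgD; first exact: cvg_cst.
have C0 : 0 <= C.
  by have := dC 0; have := normr_ge0 (psi 0); rewrite /decay expr0n addr0 invr1 mulr1; lra.
pose A : R := 1 + k%:R / 2 ^+ j.
have A0 : 0 <= k%:R / 2 ^+ j :> R by rewrite divr_ge0 ?exprn_ge0.
apply: (@cvg0_le _ _ (fun n => (B * (8 * C * (1 + A ^+ 2))) * n.+1%:R^-1)); last exact: cvg_rate.
move=> n.
have cP := @periodic_sum_continuous psi j k n cpsi.
have -> : cint (fun x => phi x * periodic_sum psi j k n x) 0 1 - L =
   - cint (fun x => (-1) * (phi x * periodic_sum psi j k n x) + phi x * wavelet psi j k x) 0 1.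
  by rewrite cint_lincomb -/L; [ring|exact: continuousM_fun|exact: continuousM_fun].
rewrite normrN.
apply: le_trans (@normr_cint_le R _ (cst ((B * (8 * C * (1 + A ^+ 2))) * n.+1%:R^-1)) 0 1 _ _ _ _) _.
- exact: ler01.
- move=> x; apply: cvgD; last exact: (continuousM_fun cphi cw).
  by apply: cvgM; [exact: cvg_cst|exact: (continuousM_fun cphi cP)].
- by move=> x; exact: cvg_cst.
- move=> x /andP[x0 x1].
  have -> : (-1) * (phi x * periodic_sum psi j k n x) + phi x * wavelet psi j k x =
    phi x * (wavelet psi j k x - periodic_sum psi j k n x) by ring.
  rewrite normrM -mulrA; apply: ler_pM => //.
  apply: le_trans (@wavelet_rate _ _ psi j k x n dC) _.
  rewrite ler_wpM2r ?invr_ge0// ler_wpM2l ?mulr_ge0// lerD2l.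
  rewrite -real_normK ?num_real// lerXn2r ?nnegrE//.
    by rewrite /A addr_ge0.
  apply: le_trans (ler_normB _ _) _; rewrite /A (ger0_norm A0) lerD2r.
  by rewrite ger0_norm.
- by rewrite cint_cst subr0 mulr1.
Qed.

Lemma cvg_sum_ord N (u : nat -> nat -> R) (l : nat -> R) :
  (forall i, u i n @[n --> \oo] --> l i) ->
  \sum_(i < N) u i n @[n --> \oo] --> \sum_(i < N) l i.
Proof.
move=> ul; elim: N => [|N IH].
  by rewrite big_ord0; under eq_fun do rewrite big_ord0; exact: cvg_cst.
rewrite big_ord_recr/=; under eq_fun do rewrite big_ord_recr/=.
by apply: cvgD; [exact: IH|exact: ul].
Qed.

Definition monomial_times psi m : R -> R := fun y => y ^+ m * psi y.

Definition moment psi m : R := line_int (monomial_times psi m).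

Lemma monomial_times_decays psi m : schwartz psi ->
  exists2 C, 0 <= C & decays C (monomial_times psi m).
Proof.
move=> /(@schwartz_decay R psi 0 m.+1)[C C0 HC]; exists C => // y.
rewrite /monomial_times normrM normrX.
apply: le_trans (ler_wpM2l (exprn_ge0 _ (normr_ge0 _)) (HC y)) _.
rewrite exprSr mulrCA ler_wpM2l// mulrA -exprMn ler_piMl ?decay_ge0//.
apply: exprn_ile1; first by rewrite mulr_ge0 ?decay_ge0.
rewrite /decay ler_pdivrMr ?ltr_pwDl ?ltr01 ?sqr_ge0// mul1r.
rewrite -(real_normK (num_real y)).
have := sqr_ge0 (`|y| - 1); have := normr_ge0 y; nra.
Qed.

Lemma monomial_times_continuous psi m : continuous psi ->
  continuous (monomial_times psi m).
Proof.
by move=> cpsi; apply: continuousM_fun => //; exact: exprn_continuous.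
Qed.

(** Taylor expansion of the test function at the centre of the wavelet. *)
Lemma coef_taylor psi M : schwartz psi -> exists2 K, 0 <= K &
  forall phi B j k, (k < 2 ^ j)%N -> smooth phi -> periodic phi 1 ->
  (forall x, `|derive1n M phi x| <= B) ->
  `|2 ^+ j * cint (fun x => phi x * wavelet psi j k x) 0 1 -
    \sum_(m < M) derive1n m phi (k%:R / 2 ^+ j) / m`!%:R * (2 ^+ j)^-1 ^+ m *
      moment psi m| <= B * (2 ^+ j)^-1 ^+ M * K.
Proof.
move=> spsi; have [C C0 HC] := monomial_times_decays M spsi.
exists (C * pi); first by rewrite mulr_ge0// ltW// pi_gt0.
move=> phi B j k kj sphi pphi phiB.
have cphi := smooth_continuous sphi; have cpsi := smooth_continuous spsi.1.
have [C' HC'] := schwartz_decays 0 spsi.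
have cw : continuous (wavelet psi j k).
  exact: (smooth_continuous (wavelet_test j k spsi).1).
set t : R := k%:R / 2 ^+ j; set q : R := (2 ^+ j)^-1.
have q0 : 0 <= q by rewrite /q invr_ge0 exprn_ge0.
pose a n : R := - (2 ^+ j * n%:R) - k%:R.
pose b n : R := 2 ^+ j * n.+1%:R - k%:R.
have j1 : 1 <= 2 ^+ j :> R by rewrite exprn_ege1// ler1n.
have an n : a n <= - n%:R.
  rewrite /a -opprD lerN2; have n0 := ler0n R n; have k0 := ler0n R k; nra.
have bn n : n%:R <= b n.
  have kj' : k%:R <= 2 ^+ j :> R by rewrite -natrX ler_nat ltnW.
  rewrite /b -natr1; have n0 := ler0n R n; nra.
have ab n : a n <= b n.
  apply: (le_trans (an n)); apply: le_trans (bn n).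
  by have := ler0n R n; lra.
have cm m := @monomial_times_continuous psi m cpsi.
have cvg1 := @unfold_cvg _ phi psi j k sphi pphi cpsi HC' cw.
pose co (m : nat) : R := derive1n m phi t / m`!%:R * q ^+ m.
have cvg2 : (\sum_(m < M) co m * cint (monomial_times psi m) (a n) (b n)) @[n --> \oo]
    --> \sum_(m < M) co m * moment psi m.
  apply: (@cvg_sum_ord M (fun m n => co m * cint (monomial_times psi m) (a n) (b n))
    (fun m => co m * moment psi m)) => m; apply: cvgM; first exact: cvg_cst.
  have [Cm _ HCm] := monomial_times_decays m spsi.
  exact: (line_int_cvg (cm m) HCm an bn).
have cvg3 := cvgB cvg1 cvg2.
have cvg4 : `|cint (unfolded phi psi j k) (a n) (b n) -
   \sum_(m < M) co m * cint (monomial_times psi m) (a n) (b n)| @[n --> \oo] -->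
   `|2 ^+ j * cint (fun x => phi x * wavelet psi j k x) 0 1 -
     \sum_(m < M) co m * moment psi m|.
  by apply: cvg_norm; exact: cvg3.
apply: (ler_cvg_to cvg4 (cvg_cst (B * q ^+ M * (C * pi)))).
apply: nearW => n.
have cF m : continuous (fun y => co m * monomial_times psi m y).
  by apply: continuousM_fun => //; move=> x; exact: cvg_cst.
have [sumE cs] := @cint_sum R M (fun m y => co m * monomial_times psi m y) (a n) (b n) cF.
have cint_scale m : cint (fun y => co m * monomial_times psi m y) (a n) (b n) =
    co m * cint (monomial_times psi m) (a n) (b n).
  have c0 : continuous (cst 0 : R -> R) by move=> x; exact: cvg_cst.
  have := cint_lincomb (co m) (a n) (b n) (cm m) c0.
  rewrite cint_cst mul0r addr0 => <-; congr (cint _ _ _).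
  by apply/funext => y; rewrite /cst addr0.
have -> : cint (unfolded phi psi j k) (a n) (b n) -
   \sum_(m < M) co m * cint (monomial_times psi m) (a n) (b n) =
   cint (fun y => (-1) * (\sum_(m < M) co m * monomial_times psi m y) +
          unfolded phi psi j k y) (a n) (b n).
  rewrite cint_lincomb//; last exact: unfolded_continuous.
  by rewrite sumE; under [in RHS]eq_bigr do rewrite cint_scale; ring.
have B0 : 0 <= B by apply: le_trans (phiB 0).
apply: le_trans (normr_cint_decays (C := B * q ^+ M * C) (ab n) _ _) _.
- move=> y; apply: cvgD; last exact: unfolded_continuous.
  by apply: cvgM; [exact: cvg_cst|exact: cs].
- move=> y.
  have -> : -1 * (\sum_(m < M) co m * monomial_times psi m y) + unfolded phi psi j k y =
     (phi (q * y + t) - (taylor_poly phi t M).[q * y + t]) * psi y.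
    rewrite mulN1r /unfolded -/q -/t addrC mulrBl; congr (_ - _).
    rewrite /taylor_poly horner_sum mulr_suml; apply: eq_bigr => m _.
    rewrite hornerZ horner_exp hornerXsubC addrK /co /monomial_times exprMn.
    by ring.
  rewrite normrM.
  have := @taylor_remainder_le R phi t (q * y + t) M B sphi (fun z _ => phiB z).
  rewrite addrK => h1.
  apply: le_trans (ler_wpM2r (normr_ge0 _) h1) _.
  rewrite normrM (ger0_norm q0) exprMn -!mulrA; apply: ler_wpM2l => //.
  apply: ler_wpM2l; first exact: exprn_ge0.
  by have := HC y; rewrite /monomial_times normrM normrX.
- rewrite -!mulrA; apply: ler_wpM2l => //; apply: ler_wpM2l; first exact: exprn_ge0.
  apply: ler_wpM2l => //.
  by have := atan_gtNpi2 (a n); have := atan_ltpi2 (b n); lra.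
Qed.

End Moments.

Section VanishingMoments.
Context {R : realType}.
Implicit Types (phi psi : R -> R) (x C B : R) (j k m n M : nat).

Lemma periodic_derive1n phi n : smooth phi -> periodic phi 1 ->
  periodic (derive1n n phi) 1.
Proof.
move=> sphi pphi.
pose F n x := derive1n n phi (1 * x + 1).
have dF k x : is_derive x 1 (F k) (F k.+1 x).
  have := is_derive_affine (is_derive_smooth k (1 * x + 1) sphi).
  by rewrite mul1r.
have F0 : F 0%N = phi by apply/funext => x; rewrite /F /= mul1r pphi.
have E := derive1n_family dF n.
by move=> x; rewrite -[in RHS]F0 E /F mul1r.
Qed.

Lemma inner01_cint (g h : R -> R) : continuous g -> continuous h ->
  inner01 g h = cint (fun x => g x * h x) 0 1.
Proof.
by move=> cg ch; rewrite /inner01 cint_Rintegral ?ltr01//; exact: continuousM_fun.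
Qed.

Lemma wavelet_continuous psi j k : schwartz psi -> continuous (wavelet psi j k).
Proof. by move=> spsi; exact: (smooth_continuous (wavelet_test j k spsi).1). Qed.

Lemma cint_scale (f : R -> R) (a u v : R) : continuous f ->
  cint (fun x => a * f x) u v = a * cint f u v.
Proof.
move=> cf; have c0 : continuous (cst 0 : R -> R) by move=> x; exact: cvg_cst.
have := cint_lincomb a u v cf c0; rewrite cint_cst mul0r addr0 => H; rewrite -[RHS]H.
by congr cint; apply/funext => x; rewrite /cst addr0.
Qed.

Lemma inner01_wavelet_unit psi (g : R -> R) j k : schwartz psi -> continuous g ->
  inner01 g (wavelet_unit psi j k) =
  2 `^ (j%:R / 2) * cint (fun x => g x * wavelet psi j k x) 0 1.
Proof.
move=> spsi cg; have cw := @wavelet_continuous psi j k spsi.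
rewrite inner01_cint//; last first.
  by apply: continuousM_fun => //; move=> x; exact: cvg_cst.
rewrite -cint_scale; last exact: continuousM_fun.
by congr cint; apply/funext => x; rewrite /wavelet_unit mulrCA.
Qed.

Lemma wavelet_unit00 psi : wavelet_unit psi 0 0 = wavelet psi 0 0.
Proof. by apply/funext => x; rewrite /wavelet_unit mul0r powRr0 mul1r. Qed.

Lemma mother_wavelet_facts psi : mother_wavelet psi ->
  [/\ cint (wavelet psi 0 0) 0 1 = 0,
      cint (fun x => wavelet psi 0 0 x * wavelet psi 0 0 x) 0 1 = 1
    & forall j k, (0 < j)%N -> (k < 2 ^ j)%N ->
      cint (fun x => wavelet psi 0 0 x * wavelet psi j k x) 0 1 = 0].
Proof.
move=> [spsi [orth1 orth] _].
have cw := @wavelet_continuous psi 0 0 spsi.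
split.
- have := orth1 0%N 0%N isT; rewrite wavelet_unit00 inner01_cint//; last first.
    by move=> x; exact: cvg_cst.
  by move=> H; rewrite -[RHS]H; congr cint; apply/funext => x; rewrite mulr1.
- have := orth 0%N 0%N 0%N 0%N isT isT; rewrite eqxx/= wavelet_unit00.
  by rewrite inner01_cint.
- move=> j k j0 kj; have := orth 0%N 0%N j k isT kj.
  rewrite eq_sym gtn_eqF//= wavelet_unit00 inner01_wavelet_unit// => /eqP.
  by rewrite mulf_eq0 gt_eqF ?powR_gt0//= => /eqP.
Qed.

(** A derivative of a periodic function has a vanishing integral over a period,
    so it vanishes as soon as it is constant. *)
Lemma periodic_derive1n_eq0 phi m : smooth phi -> periodic phi 1 ->
  (forall x, derive1n m.+1 phi x = 0) -> forall x, derive1n 1 phi x = 0.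
Proof.
move=> sphi pphi; elim: m => [//|m IH] d0.
apply: IH => x.
have dc y : derive1n m.+1 phi y = derive1n m.+1 phi x.
  apply: is_derive_0_is_cst => z; rewrite -(d0 z); exact: is_derive_smooth.
have dm (y : R) : is_derive y 1 (derive1n m phi) (cst (derive1n m.+1 phi x) y).
  by rewrite /cst -(dc y); exact: is_derive_smooth.
have := cintE 0 1 dm; rewrite cint_cst => /(_ (fun y => cvg_cst _)).
have := @periodic_derive1n phi m sphi pphi 0; rewrite add0r => ->.
by rewrite subrr subr0 mulr1.
Qed.

(** The periodized wavelet of scale [0] is orthogonal to all finer ones. By
    Taylor expansion at dyadic points, a first nonzero moment of order [m] would
    make its derivative of order [m] vanish on a dense set, hence everywhere. A
    periodic function with this property is constant, against the vanishing mean
    and the unit norm of the wavelet. *)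
Theorem moment_eq0 psi m : mother_wavelet psi -> moment psi m = 0.
Proof.
move=> mw; have [spsi _ _] := mw.
have [int0 norm1 orth] := mother_wavelet_facts mw.
elim/ltn_ind: m => m IH; apply/eqP/negPn/negP => mu0.
set Psi := wavelet psi 0 0 in int0 norm1 orth.
have [sPsi pPsi] := wavelet_test 0 0 spsi : periodic_test Psi.
have [B B0 HB] := periodic_bounded (smooth_continuous (@smooth_derive1n R Psi m.+1 sPsi))
  (@periodic_derive1n Psi m.+1 sPsi pPsi).
have [K K0 HK] := coef_taylor m.+1 spsi.
have f0 : 0 < m`!%:R :> R by rewrite ltr0n fact_gt0.
have mu1 : 0 < `|moment psi m| by rewrite normr_gt0.
pose D := B * K * m`!%:R / `|moment psi m|.
have dyadic_small j k : (0 < j)%N -> (k < 2 ^ j)%N ->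
    `|derive1n m Psi (k%:R / 2 ^+ j)| <= D * (2 ^+ j)^-1.
  move=> j0 kj; have := HK Psi B j k kj sPsi pPsi HB.
  rewrite orth// mulr0 sub0r normrN big_ord_recr/=.
  rewrite big1 ?add0r; last by move=> i _; rewrite IH ?mulr0.
  have q0 : 0 < (2 ^+ j)^-1 ^+ m :> R by rewrite exprn_gt0// invr_gt0 exprn_gt0.
  rewrite !normrM (gtr0_norm q0) normfV (gtr0_norm f0) exprS => h.
  rewrite -(ler_pM2r q0) -(ler_pM2r mu1) -(ler_pM2r (_ : 0 < m`!%:R^-1 :> R)) ?invr_gt0//.
  apply: le_trans (le_trans _ h) _.
    by rewrite le_eqVlt; apply/orP; left; apply/eqP; ring.
  rewrite le_eqVlt; apply/orP; left; apply/eqP; rewrite /D; field.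
  by rewrite expf_neq0// normr_eq0 mu0 gt_eqF.
have Psim0 x : derive1n m Psi x = 0.
  have -> : derive1n m Psi x = derive1n m Psi (frac_part x).
    rewrite /frac_part -mulrNz periodic_int//; exact: periodic_derive1n.
  have small j : `|derive1n m Psi (frac_part x)| <= (D + B) * 2 * j.+1%:R^-1.
    have h1 := dyadic_small j.+1 _ isT (dyadic_index_lt j.+1 x).
    set t := (_ / _) in h1.
    have /andP[t1 t2] := dyadic_index_itv j.+1 x.
    have q0 : 0 < (2 ^+ j.+1)^-1 :> R by rewrite invr_gt0 exprn_gt0.
    have ut : `|frac_part x - t| <= (2 ^+ j.+1)^-1.
      rewrite ger0_norm ?subr_ge0// lerBlDl; apply: ltW.
      by move: t2; rewrite -(natr1 (dyadic_index _ _)) mulrDl mul1r.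
    have h2 := @mvt_le R (derive1n m Psi) (derive1n m.+1 Psi) t (frac_part x) B
      (fun y => is_derive_smooth m y sPsi) (fun y _ => HB y).
    have h3 : `|derive1n m Psi (frac_part x)| <= (D + B) * (2 ^+ j.+1)^-1.
      rewrite -[derive1n m Psi (frac_part x)](subrKC (derive1n m Psi t)).
      apply: le_trans (ler_normD _ _) _; rewrite mulrDl lerD//.
      by apply: (le_trans h2); rewrite ler_wpM2l.
    apply: (le_trans h3); rewrite -mulrA ler_wpM2l//.
      rewrite addr_ge0// /D !mulr_ge0// invr_ge0 ltW//.
    rewrite ler_pdivlMr ?ltr0n// mulrC ler_pdivrMr ?exprn_gt0//.
    have : j.+1%:R <= 2 ^+ j.+1 :> R by rewrite -natrX ler_nat ltnW// ltn_expl.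
    by have := exprn_ge0 j.+1 (ler0n R 2); lra.
  apply/eqP; rewrite -normr_eq0 eq_le normr_ge0 andbT.
  have c1 := @cvg_rate R ((D + B) * 2).
  by apply: (ler_cvg_to (cvg_cst _) c1); exact: nearW.
have Psi0 x : Psi x = 0.
  case: m IH mu0 HB HK f0 mu1 D dyadic_small Psim0 => [|m] _ _ _ _ _ _ _ _ Psim0.
    exact: Psim0.
  have d1 := periodic_derive1n_eq0 sPsi pPsi Psim0.
  have cPsi y : Psi y = Psi x.
    by apply: is_derive_0_is_cst => z; rewrite -(d1 z); exact: (is_derive_smooth 0 z sPsi).
  move: int0; have -> : Psi = cst (Psi x) by apply/funext => y; exact: cPsi.
  by rewrite cint_cst subr0 mulr1.
have : cint (fun x => Psi x * Psi x) 0 1 = 0.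
  have -> : (fun x => Psi x * Psi x) = cst 0 by apply/funext => x; rewrite Psi0 mul0r.
  by rewrite cint_cst mul0r.
by rewrite norm1 => /eqP; rewrite oner_eq0.
Qed.

(** Only the remainder is left in the Taylor expansion of the coefficient, as
    the moments vanish. *)
Lemma wavelet_product_decay psi phi M : mother_wavelet psi ->
  smooth phi -> periodic phi 1 ->
  exists2 C, 0 <= C & forall j k, (k < 2 ^ j)%N ->
    `|cint (fun x => phi x * wavelet psi j k x) 0 1| <= C * (2 ^+ j)^-1 ^+ M.
Proof.
move=> mw sphi pphi; have [spsi _ _] := mw.
have [B B0 HB] := periodic_bounded (smooth_continuous (@smooth_derive1n R phi M sphi))
  (@periodic_derive1n phi M sphi pphi).
have [K K0 HK] := coef_taylor M spsi.
exists (B * K); first exact: mulr_ge0.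
move=> j k kj; have := HK phi B j k kj sphi pphi HB.
rewrite big1 ?subr0; last by move=> i _; rewrite moment_eq0// mulr0.
rewrite normrM mulrAC; apply: le_trans.
by rewrite ler_peMl// ger0_norm ?exprn_ge0// exprn_ege1// ler1n.
Qed.

End VanishingMoments.

(** * Wavelet expansion of periodic distributions *)

Section TestExpansion.
Context {R : realType}.
Implicit Types (phi psi : R -> R) (d : nat -> nat -> R) (x C B : R).
Implicit Types (j k m n M N : nat).

Lemma smooth_sum n (a : nat -> R) (F : nat -> R -> R) :
  (forall i, smooth (F i)) ->
  smooth (fun x => \sum_(i < n) a i * F i x) /\
  forall m, derive1n m (fun x => \sum_(i < n) a i * F i x) =
            (fun x => \sum_(i < n) a i * derive1n m (F i) x).
Proof.
move=> sF; elim: n => [|n [IHs IHd]].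
  have -> : (fun x : R => \sum_(i < 0) a i * F i x) = cst 0.
    by apply/funext => x; rewrite big_ord0.
  split=> [|[|m]]; first exact: smooth_cst.
    by apply/funext => x; rewrite big_ord0.
  by rewrite derive1n_cst; apply/funext => x; rewrite big_ord0.
have -> : (fun x => \sum_(i < n.+1) a i * F i x) =
          (fun x => a n * F n x + \sum_(i < n) a i * F i x).
  by apply/funext => x; rewrite big_ord_recr/= addrC.
split; first exact: smooth_lincomb.
move=> m; rewrite derive1n_lincomb// IHd; apply/funext => x.
by rewrite big_ord_recr/= addrC.
Qed.

Lemma periodic_lincomb phi chi (a : R) : periodic phi 1 -> periodic chi 1 ->
  periodic (fun x => a * phi x + chi x) 1.
Proof. by move=> pphi pchi x; rewrite pphi pchi. Qed.

Lemma periodic_sum_test n (a : nat -> R) (F : nat -> R -> R) :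
  (forall i, periodic_test (F i)) ->
  periodic_test (fun x => \sum_(i < n) a i * F i x).
Proof.
move=> tF; split; first by apply: (smooth_sum n a (fun i => (tF i).1)).1.
by move=> x; apply: eq_bigr => i _; rewrite (tF i).2.
Qed.

Lemma test_cst (a : R) : periodic_test (cst a : R -> R).
Proof. by split; [exact: smooth_cst|]. Qed.

Lemma distribution_sum (f : (R -> R) -> R) n (a : nat -> R) (F : nat -> R -> R) :
  periodic_distribution f -> (forall i, periodic_test (F i)) ->
  f (fun x => \sum_(i < n) a i * F i x) = \sum_(i < n) a i * f (F i).
Proof.
move=> [lin _] tF; elim: n => [|n IH].
  rewrite big_ord0.
  have -> : (fun x : R => \sum_(i < 0) a i * F i x) = cst 0.
    by apply/funext => x; rewrite big_ord0.
  have := lin 1 (cst 0) (cst 0) (test_cst 0) (test_cst 0).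
  have -> : (fun x : R => 1 * (cst 0 : R -> R) x + (cst 0 : R -> R) x) = (cst 0 : R -> R).
    by rewrite funeqE => x; rewrite /cst mulr0 addr0.
  lra.
have -> : (fun x => \sum_(i < n.+1) a i * F i x) =
          (fun x => a n * F n x + \sum_(i < n) a i * F i x).
  by apply/funext => x; rewrite big_ord_recr/= addrC.
by rewrite lin ?IH ?big_ord_recr/= 1?addrC//; exact: periodic_sum_test.
Qed.

Definition block psi d j x : R := \sum_(k < 2 ^ j) d j k * wavelet psi j k x.

Definition series_part psi d n x : R := \sum_(j < n) block psi d j x.

Lemma block_test psi d j : schwartz psi -> periodic_test (block psi d j).
Proof.
move=> spsi; apply: (@periodic_sum_test (2 ^ j) (d j) (wavelet psi j)) => k.
exact: wavelet_test.
Qed.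

Lemma derive1n_block psi d j m : schwartz psi ->
  derive1n m (block psi d j) =
  (fun x => \sum_(k < 2 ^ j) d j k * derive1n m (wavelet psi j k) x).
Proof.
move=> spsi; apply: (smooth_sum (2 ^ j) (d j) (fun k => (wavelet_test j k spsi).1)).2.
Qed.

Lemma series_part_mul psi d n :
  series_part psi d n = (fun x => \sum_(j < n) 1 * block psi d j x).
Proof. by rewrite funeqE => x; apply: eq_bigr => j _; rewrite mul1r. Qed.

Lemma series_part_test psi d n : schwartz psi -> periodic_test (series_part psi d n).
Proof.
move=> spsi; rewrite series_part_mul.
by apply: (@periodic_sum_test n (fun=> 1) (block psi d)) => j; exact: block_test.
Qed.

Lemma derive1n_series_part psi d n m : schwartz psi ->
  derive1n m (series_part psi d n) =
  (fun x => \sum_(j < n) derive1n m (block psi d j) x).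
Proof.
move=> spsi; rewrite series_part_mul.
rewrite (smooth_sum n (fun=> 1) (fun j => (block_test d j spsi).1)).2.
by apply/funext => x; apply: eq_bigr => j _; rewrite mul1r.
Qed.

End TestExpansion.

Section SmoothSeries.
Context {R : realType}.
Implicit Types (phi psi : R -> R) (x C B : R) (j k m n M N : nat).

Lemma half_pow_cvg C : C * (2 ^+ n)^-1 @[n --> \oo] --> (0 : R).
Proof.
apply: (@cvg0_le _ _ (fun n => `|C| * n.+1%:R^-1 * 2)) => [n|].
  rewrite normrM (ger0_norm (_ : 0 <= (2 ^+ n)^-1)) ?invr_ge0 ?exprn_ge0//=.
  rewrite -mulrA ler_wpM2l//.
  rewrite mulrC ler_pdivlMr ?ltr0n// mulrC ler_pdivrMr ?exprn_gt0//.
  rewrite -exprS -natrX ler_nat.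
  by apply: (@leq_trans (2 ^ n)); [exact: ltn_expl|rewrite leq_exp2l].
rewrite -[X in _ --> X](mul0r 2); apply: cvgM; last exact: cvg_cst.
exact: cvg_rate.
Qed.

Lemma geometric_partial (u : nat -> R) C n m : (n <= m)%N ->
  (forall j, `|u j| <= C * (2 ^+ j)^-1) ->
  `|\sum_(j < m) u j - \sum_(j < n) u j| <= 2 * C * (2 ^+ n)^-1.
Proof.
move=> nm uC.
have C0 : 0 <= C by have := uC 0%N; have := normr_ge0 (u 0%N); rewrite expr0 invr1; lra.
suff : `|\sum_(j < m) u j - \sum_(j < n) u j| <= 2 * C * ((2 ^+ n)^-1 - (2 ^+ m)^-1).
  move/le_trans; apply; rewrite ler_wpM2l ?mulr_ge0//.
  by rewrite gerBl invr_ge0 exprn_ge0.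
elim: m nm => [|m IH]; first by rewrite leqn0 => /eqP ->; rewrite !subrr normr0 mulr0.
rewrite leq_eqVlt => /predU1P[<-|]; first by rewrite !subrr normr0 mulr0.
rewrite ltnS => /IH{}IH.
rewrite big_ord_recr/= addrAC; apply: le_trans (ler_normD _ _) _.
apply: (le_trans (lerD IH (uC m))).
rewrite le_eqVlt; apply/orP; left; apply/eqP; rewrite exprS; field.
by rewrite !expf_neq0.
Qed.

(** The limits of the derivatives of the partial sums form a family in which
    each function is the derivative of the preceding one. *)
Lemma smooth_series (g : nat -> R -> R) : (forall j, smooth (g j)) ->
  (forall m, exists C, forall j x, `|derive1n m (g j) x| <= C * (2 ^+ j)^-1) ->
  exists2 G, smooth G & forall m, exists C, forall n x,
    `|derive1n m G x - \sum_(j < n) derive1n m (g j) x| <= C * (2 ^+ n)^-1.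
Proof.
move=> sg /boolp.choice[C HC].
have lim_ex m x : exists l, \sum_(j < n) derive1n m (g j) x @[n --> \oo] --> l /\
    forall n, `|l - \sum_(j < n) derive1n m (g j) x| <= 2 * C m * (2 ^+ n)^-1.
  have [l cl rl] := @cauchy_rate R (fun n => \sum_(j < n) derive1n m (g j) x)
    (fun n => 2 * C m * (2 ^+ n)^-1)
    (fun n k nk => @geometric_partial (fun j => derive1n m (g j) x) (C m) n k nk (fun j => HC m j x))
    (half_pow_cvg _).
  by exists l.
have /boolp.choice[F HF] : forall mx : nat * R, exists l,
    \sum_(j < n) derive1n mx.1 (g j) mx.2 @[n --> \oo] --> l /\
    forall n, `|l - \sum_(j < n) derive1n mx.1 (g j) mx.2| <= 2 * C mx.1 * (2 ^+ n)^-1.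
  by move=> [m x]; exact: lim_ex.
have dF m x : is_derive x 1 (fun y => F (m, y)) (F (m.+1, x)).
  apply: (@is_derive_lim R (fun n y => \sum_(j < n) derive1n m (g j) y)
    (fun n y => \sum_(j < n) derive1n m.+1 (g j) y) _ (fun y => F (m.+1, y))
    (fun n => 2 * C m.+1 * (2 ^+ n)^-1)).
  - move=> n y; apply: (@is_derive_sum_fun R n (fun j => derive1n m (g j))
      (fun j => derive1n m.+1 (g j))) => i.
    exact: is_derive_smooth.
  - by move=> y _; exact: (HF (m, y)).1.
  - by move=> n y _; rewrite distrC; exact: (HF (m.+1, y)).2.
  - exact: half_pow_cvg.
exists (fun x => F (0%N, x)).
  exact: (@smooth_family R (fun m x => F (m, x)) dF).
move=> m; exists (2 * C m) => n x.
rewrite (@derive1n_family R (fun m x => F (m, x)) dF).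
exact: (HF (m, x)).2.
Qed.

Lemma cint_sqr_eq0 (g : R -> R) a b : a < b -> continuous g ->
  cint (fun x => g x ^+ 2) a b <= 0 -> forall x, a < x < b -> g x = 0.
Proof.
move=> ab cg I0 x0 /andP[ax0 x0b].
have cg2 : continuous (fun x => g x ^+ 2).
  by move=> x; apply: cvgM; exact: cg.
have c0 : continuous (cst 0 : R -> R) by move=> x; exact: cvg_cst.
have pos u v : u <= v -> 0 <= cint (fun x => g x ^+ 2) u v.
  move=> uv; rewrite -[leLHS](mul0r (v - u)) -cint_cst.
  by apply: cint_le => // x _; exact: sqr_ge0.
have const y : a < y < b -> primitive (fun x => g x ^+ 2) y = primitive (fun x => g x ^+ 2) a.
  move=> /andP[ay yb]; have := pos a y (ltW ay); have := pos y b (ltW yb).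
  by move: I0; rewrite /cint; lra.
have dP := is_derive_primitive x0 cg2.
have dc : is_derive x0 1 (cst (primitive (fun x => g x ^+ 2) a) : R -> R) (g x0 ^+ 2).
  apply: near_eq_is_derive dP.
  near=> y; rewrite /cst; apply: const; apply/andP; split; near: y.
    exact: lt_nbhsr.
  exact: lt_nbhsl.
have : g x0 ^+ 2 = 0.
  have <- := @derive_val _ _ _ _ _ _ _ dc; exact: derive_cst.
by move/eqP; rewrite sqrf_eq0 => /eqP.
Unshelve. all: by end_near. Qed.

End SmoothSeries.

Section DistributionExpansion.
Context {R : realType}.
Variable psi : R -> R.
Hypothesis mw : mother_wavelet psi.
Let spsi : schwartz psi. Proof. by have [] := mw. Qed.
Implicit Types (phi : R -> R) (x C B : R) (j k m n M N : nat).

Definition test_coef phi j k : R := cint (fun x => phi x * wavelet psi j k x) 0 1.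

Lemma test_block_le phi m : periodic_test phi ->
  exists C, forall j x,
  `|derive1n m (block psi (fun j k => 2 ^+ j * test_coef phi j k) j) x| <= C * (2 ^+ j)^-1.
Proof.
move=> [sphi pphi].
have [C1 C10 HC1] := wavelet_product_decay m.+2 mw sphi pphi.
have [C2 C20 HC2] := derive1n_wavelet_le m 1 spsi.
exists (C1 * C2 * (9 * pi)) => j x; rewrite derive1n_block//.
have j0 : 0 < 2 ^+ j :> R by rewrite exprn_gt0.
set q := (2 ^+ j)^-1.
apply: le_trans (ler_norm_sum _ _ _) _.
apply: (@le_trans _ _ (\sum_(k < 2 ^ j) C1 * C2 * q * weight j k x)).
  apply: ler_sum => k _; rewrite !normrM (gtr0_norm j0).
  apply: (@le_trans _ _ ((2 ^+ j * (C1 * q ^+ m.+2)) * (C2 * 2 ^+ (j * m) * weight j k x))).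
    apply: ler_pM; rewrite ?mulr_ge0 ?(ltW j0)//.
    by rewrite ler_pM2l//; exact: HC1.
  rewrite le_eqVlt; apply/orP; left; apply/eqP.
  rewrite exprM exprSr exprSr /q exprVn; field.
  by rewrite ?expf_neq0.
rewrite -mulr_sumr [leRHS]mulrAC ler_wpM2l ?sum_weight_le// mulr_ge0 ?mulr_ge0//.
by rewrite /q invr_ge0 ltW.
Qed.

Lemma wavelet_partial_sumE phi n : continuous phi ->
  wavelet_partial_sum psi phi n = (fun y => 1 * cst (cint phi 0 1) y +
    series_part psi (fun j k => 2 ^+ j * test_coef phi j k) n y).
Proof.
move=> cphi; rewrite funeqE => x; rewrite /wavelet_partial_sum mul1r; congr (_ + _).
  rewrite inner01_cint//; last by move=> y; exact: cvg_cst.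
  by congr cint; rewrite funeqE => y; rewrite /cst mulr1.
apply: eq_bigr => j _; apply: eq_bigr => k _.
rewrite inner01_wavelet_unit// /wavelet_unit mulrACA mulrA; congr (_ * _).
by rewrite -!/(exp2 _) -exp2D -splitr exp2_nat.
Qed.

(** The rapid decay of the coefficients makes the series converge with all its
    derivatives; its sum is [phi] because the expansion converges to [phi] in
    L^2. *)
Lemma test_expansion_smooth phi : periodic_test phi ->
  forall m, exists C, forall n x,
    `|derive1n m phi x - derive1n m (fun y => 1 * cst (cint phi 0 1) y +
        series_part psi (fun j k => 2 ^+ j * test_coef phi j k) n y) x|
    <= C * (2 ^+ n)^-1.
Proof.
move=> tphi; have [sphi pphi] := tphi.
set d := fun j k => 2 ^+ j * test_coef phi j k.
set m0 := cint phi 0 1.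
have sblock j : smooth (block psi d j) by exact: (block_test d j spsi).1.
have [G sG HG] := @smooth_series R (block psi d) sblock (fun m => test_block_le m tphi).
suff GE : (fun y => 1 * cst m0 y + G y) = phi.
  move=> m; have [C HC] := HG m; exists C => n x.
  have E1 := derive1n_lincomb 1 m (@smooth_cst R m0) sG.
  have E2 := derive1n_lincomb 1 m (@smooth_cst R m0) (series_part_test d n spsi).1.
  rewrite GE in E1; rewrite E1 E2 derive1n_series_part// opprD addrACA subrr add0r.
  exact: HC.
pose S n y : R := 1 * cst m0 y + series_part psi d n y.
have sS n : smooth (S n).
  apply: smooth_lincomb; [exact: smooth_cst|exact: (series_part_test d n spsi).1].
have cS n := smooth_continuous (sS n).
pose H y : R := 1 * cst m0 y + G y.
have sH : smooth H by apply: smooth_lincomb; [exact: smooth_cst|].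
have cphi := smooth_continuous sphi; have cH := smooth_continuous sH.
have [C HC] := HG 0%N.
have C0 : 0 <= C.
  by have := HC 0%N 0; have := normr_ge0 (derive1n 0 G 0 - \sum_(j < 0) derive1n 0 (block psi d j) 0);
   rewrite expr0 invr1 mulr1; lra.
have HS n x : `|H x - S n x| <= C * (2 ^+ n)^-1.
  by rewrite /H /S opprD addrACA subrr add0r; exact: HC.
have cM (u v : R -> R) : continuous u -> continuous v -> continuous (fun x => (u x - v x) ^+ 2).
  by move=> cu cv x; apply: cvgM; apply: cvgB; [exact: cu|exact: cv|exact: cu|exact: cv].
(* the L^2 expansion identifies the limit *)
have L2 : cint (fun x => (phi x - S n x) ^+ 2) 0 1 @[n --> \oo] --> 0.
  have [_ _ /(_ phi)] := mw.
  have sq : square_integrable01 phi.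
    split.
      apply: subspace_continuous_measurable_fun => //.
      exact: continuous_subspaceT.
    rewrite integral_cint ?ltry//.
    by move=> x; apply: cvgM; exact: cphi.
  move=> /(_ sq) h.
  suff -> : (fun n => cint (fun x => (phi x - S n x) ^+ 2) 0 1) = fine \o
    (fun n => \int[lebesgue_measure]_(x in `[0%R, 1%R])
       ((phi x - wavelet_partial_sum psi phi n x) ^+ 2)%:E)%E by exact: fine_cvg.
  rewrite funeqE => n /=; rewrite -[LHS]/(fine (cint (fun x => (phi x - S n x) ^+ 2) 0 1)%:E).
  rewrite -integral_cint//; last exact: cM.
  congr fine; apply: eq_integral => x _.
  by rewrite wavelet_partial_sumE.
have I0 : cint (fun x => (phi x - H x) ^+ 2) 0 1 <= 0.
  have up n : cint (fun x => (phi x - H x) ^+ 2) 0 1 <=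
    2 * cint (fun x => (phi x - S n x) ^+ 2) 0 1 + 2 * (C * (2 ^+ n)^-1) ^+ 2.
    have -> : 2 * (C * (2 ^+ n)^-1) ^+ 2 = cint (cst (2 * (C * (2 ^+ n)^-1) ^+ 2)) 0 1.
      by rewrite cint_cst subr0 mulr1.
    have cc : continuous (cst (2 * (C * (2 ^+ n)^-1) ^+ 2) : R -> R).
      by move=> x; exact: cvg_cst.
    rewrite -cint_lincomb//; last exact: cM.
    apply: cint_le; [exact: ler01|exact: cM| |].
      by move=> x; apply: cvgD; [apply: cvgM; [exact: cvg_cst|exact: cM]|exact: cc].
    move=> x _; rewrite /cst.
    have h1 : (H x - S n x) ^+ 2 <= (C * (2 ^+ n)^-1) ^+ 2.
      by rewrite -real_normK ?num_real// lerXn2r ?nnegrE// mulr_ge0// invr_ge0 exprn_ge0.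
    have alg (u v w : R) : v ^+ 2 <= w -> (u - v) ^+ 2 <= 2 * u ^+ 2 + 2 * w.
      by have := sqr_ge0 (u + v); lra.
    have -> : phi x - H x = (phi x - S n x) - (H x - S n x) by ring.
    exact: alg.
  have lim0 : 2 * cint (fun x => (phi x - S n x) ^+ 2) 0 1 + 2 * (C * (2 ^+ n)^-1) ^+ 2
      @[n --> \oo] --> (2 * 0 + 2 * (0 * 0) : R).
    apply: cvgD; first by apply: cvgM; [exact: cvg_cst|exact: L2].
    apply: cvgM; first exact: cvg_cst.
    by apply: cvgM; exact: half_pow_cvg.
  rewrite !mulr0 addr0 in lim0.
  by apply: (ler_cvg_to (cvg_cst _) lim0); exact: nearW.
have pH : periodic H 1.
  move=> x; apply/eqP; rewrite -subr_eq0 -normr_eq0 eq_le normr_ge0 andbT.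
  apply: (ler_cvg_to (cvg_cst _) (half_pow_cvg (C + C))); apply: nearW => n.
  have -> : H (x + 1) - H x = (H (x + 1) - S n (x + 1)) - (H x - S n x).
    by rewrite [S n (x + 1)]/(S n (x + 1)) /S (series_part_test d n spsi).2; rewrite /cst; ring.
  by apply: le_trans (ler_normB _ _) _; rewrite mulrDl lerD.
have cg : continuous (fun x => phi x - H x).
  by move=> x; apply: cvgB; [exact: cphi|exact: cH].
have cg2 := cM _ _ cphi cH.
have I1 : cint (fun x => (phi x - H x) ^+ 2) (-1) 1 <= 0.
  rewrite -(cint_add _ (-1) 0 1).
  have <- : cint (fun x => (phi x - H x) ^+ 2) 0 1 = cint (fun x => (phi x - H x) ^+ 2) (-1) 0.
    have := cint_affine 1 (-1) 0 1 cg2; rewrite !mul1r add0r subrr => H1; rewrite -[RHS]H1.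
    congr cint; rewrite funeqE => x.
    have sh (u : R -> R) : periodic u 1 -> u (1 * x - 1) = u x.
      by move=> pu; rewrite -[in RHS](subrK 1 x) pu mul1r.
    by rewrite !sh.
  lra.
rewrite funeqE => x.
have N11 : -1 < 1 :> R by lra.
have H0 := cint_sqr_eq0 N11 cg I1.
have fx : phi (frac_part x) - H (frac_part x) = 0.
  apply: H0; rewrite frac_part_lt1 andbT.
  by apply: lt_le_trans (frac_part_ge0 x); rewrite oppr_lt0.
have sh (u : R -> R) : periodic u 1 -> u (frac_part x) = u x.
  by move=> pu; rewrite /frac_part -mulrNz periodic_int.
by move: fx; rewrite !sh// => /eqP; rewrite subr_eq0 => /eqP.
Qed.

End DistributionExpansion.

Section DistributionLimit.
Context {R : realType}.
Variables (psi : R -> R) (f : (R -> R) -> R).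
Hypotheses (mw : mother_wavelet psi) (hf : periodic_distribution f).
Let spsi : schwartz psi. Proof. by have [] := mw. Qed.
Implicit Types (phi : R -> R) (x C B : R) (j k m n M N : nat).

(** The constant component of [f] is not among its wavelet coefficients. *)
Definition recon n x : R :=
  f (cst 1) + series_part psi (wavelet_coef psi f) n x.

Lemma recon_continuous n : continuous (recon n).
Proof.
have cs := smooth_continuous (series_part_test (wavelet_coef psi f) n spsi).1.
by move=> x; apply: cvgD; [exact: cvg_cst|exact: cs].
Qed.

Lemma distribution_series_part phi n :
  f (series_part psi (fun j k => 2 ^+ j * test_coef psi phi j k) n) =
  \sum_(j < n) \sum_(k < 2 ^ j) wavelet_coef psi f j k * test_coef psi phi j k.
Proof.
rewrite series_part_mul (@distribution_sum R f n (fun=> 1)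
  (block psi (fun j k => 2 ^+ j * test_coef psi phi j k)) hf); last first.
  by move=> j; exact: block_test.
apply: eq_bigr => j _; rewrite mul1r.
rewrite (@distribution_sum R f (2 ^ j) (fun k => 2 ^+ j * test_coef psi phi j k)
  (wavelet psi j) hf); last by move=> k; exact: wavelet_test.
by apply: eq_bigr => k _; rewrite /wavelet_coef; ring.
Qed.

Lemma cint_recon phi n : continuous phi ->
  cint (fun x => phi x * recon n x) 0 1 = f (cst 1) * cint phi 0 1 +
  \sum_(j < n) \sum_(k < 2 ^ j) wavelet_coef psi f j k * test_coef psi phi j k.
Proof.
move=> cphi.
have cw j k : continuous (fun x => phi x * wavelet psi j k x).
  by apply: continuousM_fun => //; exact: wavelet_continuous.
pose W j k x := wavelet_coef psi f j k * (phi x * wavelet psi j k x).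
have cW j k : continuous (W j k).
  by apply: continuousM_fun => //; move=> x; exact: cvg_cst.
have blockE j := @cint_sum R (2 ^ j) (W j) 0 1 (cW j).
have [sE sc] := @cint_sum R n (fun j x => \sum_(k < 2 ^ j) W j k x) 0 1
  (fun j => (blockE j).2).
have -> : (fun x => phi x * recon n x) =
  (fun x => f (cst 1) * phi x + \sum_(j < n) \sum_(k < 2 ^ j) W j k x).
  rewrite funeqE => x; rewrite /recon mulrDr mulrC; congr (_ + _).
  rewrite /series_part mulr_sumr; apply: eq_bigr => j _.
  by rewrite /block mulr_sumr; apply: eq_bigr => k _; rewrite /W mulrCA.
rewrite cint_lincomb// sE; congr (_ + _); apply: eq_bigr => j _.
rewrite (blockE j).1; apply: eq_bigr => k _.
by rewrite /W cint_scale.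
Qed.

(** Pairing the partial sums with [phi] is the same as applying [f] to the
    partial sums of the expansion of [phi], to which the continuity of [f]
    applies. *)
Theorem recon_cvg phi : periodic_test phi ->
  cint (fun x => phi x * recon n x) 0 1 @[n --> \oo] --> f phi.
Proof.
move=> tphi; have [lin [N [C fC]]] := hf.
have /boolp.choice[D HD] := test_expansion_smooth mw tphi.
pose S n y : R := 1 * cst (cint phi 0 1) y +
  series_part psi (fun j k => 2 ^+ j * test_coef psi phi j k) n y.
have tc : periodic_test (cst (cint phi 0 1) : R -> R) by exact: test_cst.
have tser n := series_part_test (fun j k => 2 ^+ j * test_coef psi phi j k) n spsi.
have tS n : periodic_test (S n).
  split; first exact: smooth_lincomb tc.1 (tser n).1.
  exact: periodic_lincomb tc.2 (tser n).2.
have fS n : f (S n) = cint (fun x => phi x * recon n x) 0 1.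
  rewrite /S lin// mul1r distribution_series_part cint_recon; last first.
    exact: smooth_continuous tphi.1.
  congr (_ + _).
  have := lin (cint phi 0 1) (cst 1) (cst 0) (test_cst 1) (test_cst 0).
  have -> : (fun x : R => cint phi 0 1 * (cst 1 : R -> R) x + (cst 0 : R -> R) x) =
     (cst (cint phi 0 1) : R -> R).
    by rewrite funeqE => x; rewrite /cst mulr1 addr0.
  have := lin 1 (cst 0) (cst 0) (test_cst 0) (test_cst 0).
  have -> : (fun x : R => 1 * (cst 0 : R -> R) x + (cst 0 : R -> R) x) = (cst 0 : R -> R).
    by rewrite funeqE => x; rewrite /cst mulr0 addr0.
  by move=> h0 ->; rewrite mulrC; lra.
under eq_fun do rewrite -fS.
pose Dmax := \sum_(m < N.+1) `|D m|.
have Dm m : (m <= N)%N -> D m <= Dmax.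
  move=> mN; apply: le_trans (ler_norm _) _.
  rewrite /Dmax (bigD1 (Ordinal (mN : (m < N.+1)%N)))//= lerDl.
  by apply: sumr_ge0.
have diff n : `|f phi - f (S n)| <= C * (Dmax * (2 ^+ n)^-1).
  have := fC (fun x => (-1) * S n x + phi x) (Dmax * (2 ^+ n)^-1).
  rewrite lin// mulN1r addrC; apply.
    split; first exact: smooth_lincomb (tS n).1 tphi.1.
    exact: periodic_lincomb (tS n).2 tphi.2.
  move=> m x mN; rewrite derive1n_lincomb; [|exact: (tS n).1|exact: tphi.1].
  rewrite mulN1r addrC; apply: le_trans (HD m n x) _.
  by rewrite ler_wpM2r ?invr_ge0 ?exprn_ge0// Dm.
have -> : (fun n => f (S n)) = (fun n => f phi + - (f phi - f (S n))).
  by rewrite funeqE => n; ring.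
suff : (fun n => f phi + - (f phi - f (S n))) @ \oo --> f phi + 0 by rewrite addr0.
apply: cvgD; first exact: cvg_cst.
apply: (@cvg0_le _ _ (fun n => (C * Dmax) * (2 ^+ n)^-1)); last exact: half_pow_cvg.
by move=> n; rewrite normrN -mulrA.
Qed.

End DistributionLimit.

(** * Reconstruction in L^p *)

Section PowerSums.
Context {R : realType}.
Implicit Types (p x y a b C : R) (j k m n M N L : nat).

(** Each term is at most the [p]-th root of the sum of the [p]-th powers, which
    replaces Jensen's inequality. *)
Lemma power_sum_le (s : seq nat) p (u v : nat -> R) C : 0 < p ->
  (forall i, 0 <= u i) -> (forall i, 0 <= v i) -> \sum_(i <- s) v i <= C ->
  (\sum_(i <- s) u i * v i) `^ p <= C `^ p * \sum_(i <- s) u i `^ p.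
Proof.
move=> p0 u0 v0 vC.
have C0 : 0 <= C by apply: le_trans vC; exact: sumr_ge0.
set S := \sum_(i <- s) u i `^ p.
have S0 : 0 <= S by apply: sumr_ge0 => i _; exact: powR_ge0.
have uS i : i \in s -> u i <= S `^ p^-1.
  move=> iss; rewrite -[leLHS]powRr1// -(mulfV (lt0r_neq0 p0)) powRrM.
  apply: ge0_ler_powR; rewrite ?nnegrE ?invr_ge0 ?(ltW p0) ?powR_ge0//.
  rewrite /S (big_rem i)//= lerDl; apply: sumr_ge0 => ? _; exact: powR_ge0.
apply: (@le_trans _ _ ((C * S `^ p^-1) `^ p)); last first.
  by rewrite powRM ?powR_ge0// -powRrM mulVf ?gt_eqF// powRr1.
apply: ge0_ler_powR; rewrite ?(ltW p0) ?nnegrE ?mulr_ge0 ?powR_ge0//.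
  by apply: sumr_ge0 => i _; exact: mulr_ge0.
apply: (@le_trans _ _ (\sum_(i <- s) S `^ p^-1 * v i)).
  by rewrite big_seq [leRHS]big_seq; apply: ler_sum => i /uS h; exact: ler_wpM2r.
by rewrite -mulr_sumr mulrC ler_wpM2r ?powR_ge0.
Qed.

Lemma powR_add_le p x y : 0 < p -> 0 <= x -> 0 <= y ->
  (x + y) `^ p <= 2 `^ p * (x `^ p + y `^ p).
Proof.
move=> p0 x0 y0.
have := @power_sum_le [:: 0%N; 1%N] p (fun i => if i == 0%N then x else y) (fun=> 1) 2 p0 _ _ _.
rewrite !big_cons !big_nil /= !mulr1 !addr0; apply => //.
by case.
Qed.

(** The sum of the weights is bounded, so the [p]-th power can be moved inside
    the sum, at the expense of one factor [weight]. *)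
Lemma block_powR_le (psi : R -> R) p N : schwartz psi -> 1 <= p ->
  exists2 C, 0 <= C & forall d j x,
    `|block psi d j x| `^ p <= C * \sum_(k < 2 ^ j) `|d j k| `^ p * weight j k x ^+ N.
Proof.
move=> spsi p1; have p0 : 0 < p by exact: lt_le_trans p1.
have [C C0 HC] := derive1n_wavelet_le 0 N.+1 spsi.
exists (C `^ p * (9 * pi) `^ p); first by rewrite mulr_ge0 ?powR_ge0.
move=> d j x.
have h1 : `|block psi d j x| <= C * \sum_(k < 2 ^ j) (`|d j k| * weight j k x ^+ N) * weight j k x.
  rewrite mulr_sumr; apply: le_trans (ler_norm_sum _ _ _) _.
  apply: ler_sum => k _; rewrite normrM.
  have := HC j k x; rewrite /= muln0 expr0 mulr1 => h.
  apply: (le_trans (ler_wpM2l (normr_ge0 _) h)).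
  by rewrite exprSr mulrCA !mulrA.
have s0 : 0 <= \sum_(k < 2 ^ j) (`|d j k| * weight j k x ^+ N) * weight j k x.
  apply: sumr_ge0 => k _; rewrite !mulr_ge0 ?weight_ge0// exprn_ge0 ?weight_ge0//.
apply: le_trans (ge0_ler_powR (ltW p0) _ _ h1) _; rewrite ?nnegrE ?mulr_ge0//.
rewrite [(C * _) `^ _]powRM// -(mulrA (C `^ p)) ler_wpM2l ?powR_ge0//.
rewrite -!(big_mkord xpredT (fun k => (`|d j k| * weight j k x ^+ N) * weight j k x)).
rewrite -!(big_mkord xpredT (fun k => `|d j k| `^ p * weight j k x ^+ N)).
apply: le_trans (@power_sum_le _ p (fun k => `|d j k| * weight j k x ^+ N)
  (fun k => weight j k x) (9 * pi) p0 _ _ _) _.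
- by move=> k; rewrite mulr_ge0// exprn_ge0 ?weight_ge0.
- by move=> k; exact: weight_ge0.
- by rewrite big_mkord; exact: sum_weight_le.
rewrite ler_wpM2l ?powR_ge0//; apply: ler_sum => k _.
rewrite powRM ?exprn_ge0 ?weight_ge0// ler_wpM2l ?powR_ge0//.
apply: ge1r_powR => //; rewrite exprn_gt0 ?decay_gt0//=.
by rewrite exprn_ile1 ?weight_ge0 ?weight_le1.
Qed.

Lemma weight_le_periodic_sum L j k x : (k < 2 ^ j)%N -> - L%:R <= x <= L%:R ->
  weight j k x <= periodic_sum decay j k L.+2 x.
Proof.
move=> kj /andP[Lx xL].
have j0 : 0 < 2 ^+ j :> R by rewrite exprn_gt0.
have k0 : 0 <= k%:R / 2 ^+ j :> R by rewrite divr_ge0// ltW.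
have k1 : k%:R / 2 ^+ j < 1 :> R by rewrite ltr_pdivrMr// mul1r -natrX ltr_nat.
set z := x - k%:R / 2 ^+ j.
have [l dl lz] := distZ_ex z.
have fz1 := floor_le z; have fz2 := floorD1_gt z.
have lL : (`|l| <= L.+2)%N.
  have h1 : (Num.floor z)%:~R < (L.+1)%:Z%:~R :> R.
    by rewrite -pmulrn -natr1; rewrite /z in fz1 *; lra.
  have h2 : (- (L.+2)%:Z)%:~R < (Num.floor z)%:~R :> R.
    by move: fz2; rewrite intrD mulrNz -pmulrn -natr1 -natr1 /z; lra.
  by move: h1 h2; rewrite !ltr_int => h1 h2; case: lz => ->; lia.
have [i iE il] := nat_of_shifted_int lL.
rewrite /periodic_sum (bigD1 (Ordinal il))//=.
have -> : 2 ^+ j * (x - (i%:R - L.+2%:R)) - k%:R = 2 ^+ j * (z - l%:~R).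
  have -> : l%:~R = i%:R - L.+2%:R :> R.
    by rewrite -[i%:R]/(i%:Z%:~R) iE intrD -[L.+2%:R]/(L.+2%:Z%:~R) addrK.
  by rewrite /z; field; rewrite gt_eqF.
have -> : weight j k x = decay (2 ^+ j * (z - l%:~R)).
  by rewrite /weight -/z dl /decay !exprMn real_normK ?num_real.
by rewrite lerDl; apply: sumr_ge0 => *; exact: decay_ge0.
Qed.

Lemma cint_periodic_decay L j k a b : a <= b ->
  cint (periodic_sum decay j k L) a b <= L.*2.+1%:R * pi / 2 ^+ j :> R.
Proof.
move=> ab.
have j0 : 0 < 2 ^+ j :> R by rewrite exprn_gt0.
have E i : (fun x : R => decay (2 ^+ j * (x - (i%:R - L%:R)) - k%:R)) =
    (fun x => decay (2 ^+ j * x + (- (2 ^+ j * (i%:R - L%:R)) - k%:R))).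
  by rewrite funeqE => x; congr decay; ring.
have cF i : continuous (fun x : R => decay (2 ^+ j * (x - (i%:R - L%:R)) - k%:R)).
  by rewrite E; apply: continuous_affine; exact: continuous_decay.
have [-> _] := @cint_sum R L.*2.+1 _ a b cF.
apply: (@le_trans _ _ (\sum_(i < L.*2.+1) pi / 2 ^+ j)); last first.
  by rewrite sumr_const card_ord -[X in X <= _]mulr_natl mulrA.
apply: ler_sum => i _; rewrite E ler_pdivlMr// mulrC cint_affine; last exact: continuous_decay.
rewrite cint_decay.
set u := (X in atan X - _); set v := (X in _ - atan X).
by have := atan_ltpi2 u; have := atan_gtNpi2 v; lra.
Qed.

(** The interval meets finitely many periods; on each, a weight is at most a
    translate of [decay] contracted by [2 ^+ j], whose integral over the line is
    [pi / 2 ^+ j]. *)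
Lemma integral_weight_le L j (e : nat -> R) (h : R -> R) a b : a < b ->
  - L%:R <= a -> b <= L%:R -> (forall k, 0 <= e k) ->
  measurable_fun (`[a, b]%classic : set R) h -> (forall x, 0 <= h x) ->
  (forall x, a <= x <= b -> h x <= \sum_(k < 2 ^ j) e k * weight j k x) ->
  (\int[lebesgue_measure]_(x in `[a, b]) (h x)%:E <=
    ((L.+2.*2.+1%:R * pi) / 2 ^+ j * \sum_(k < 2 ^ j) e k)%:E)%E.
Proof.
move=> ab La bL e0 mh h0 hU.
pose U x : R := \sum_(k < 2 ^ j) e k * periodic_sum decay j k L.+2 x.
have cP k : continuous (fun x : R => e k * periodic_sum decay j k L.+2 x).
  apply: continuousM_fun; first by move=> x; exact: cvg_cst.
  by apply: periodic_sum_continuous; exact: continuous_decay.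
have [UE cU] := @cint_sum R (2 ^ j) (fun k x => e k * periodic_sum decay j k L.+2 x) a b cP.
apply: (@le_trans _ _ (\int[lebesgue_measure]_(x in `[a, b]) (U x)%:E)%E).
  apply: ge0_le_integral => //.
  - by move=> x _; rewrite lee_fin.
  - exact/measurable_EFinP.
  - apply/measurable_EFinP.
    apply: subspace_continuous_measurable_fun => //.
    exact: continuous_subspaceT.
  - move=> x; rewrite /= in_itv/= => /andP[ax xb]; rewrite lee_fin.
    apply: (le_trans (hU x _)); first by rewrite ax.
    apply: ler_sum => k _; apply: ler_wpM2l => //.
    by apply: weight_le_periodic_sum => //; rewrite (le_trans La)//= (le_trans xb).
rewrite integral_cint// lee_fin UE mulr_sumr; apply: ler_sum => k _.
rewrite cint_scale; last by apply: periodic_sum_continuous; exact: continuous_decay.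
by rewrite mulrC ler_wpM2r// cint_periodic_decay// ltW.
Qed.

End PowerSums.

Section LpLimit.
Context {R : realType}.
Variables (psi : R -> R) (f : (R -> R) -> R).
Hypothesis spsi : schwartz psi.
Notation mu := (@lebesgue_measure R).
Notation c := (wavelet_coef psi f).
Notation recon := (@recon R psi f).
Implicit Types (p x kappa M : R) (j k m n : nat).

(** The limit superior makes the function measurable; it is the sum of the
    wavelet series wherever this series converges. *)
Definition recon_lim x : R := fine (limn_esup (fun n => (recon n x)%:E)).

Lemma recon_diff n m x : (n <= m)%N ->
  recon m x - recon n x = \sum_(n <= j < m) block psi c j x.
Proof.
move=> nm; rewrite /recon opprD addrACA subrr add0r /series_part.
rewrite -!(big_mkord xpredT (fun j => block psi c j x)).
by rewrite (@big_cat_nat _ _ _ n)//= addrAC subrr add0r.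
Qed.

Definition tail_term p kappa n j x : R :=
  if (n <= j)%N then exp2 (kappa * j%:R) * `|block psi c j x| `^ p else 0.

Lemma tail_term_ge0 p kappa n j x : 0 <= tail_term p kappa n j x.
Proof. by rewrite /tail_term; case: ifP => // _; rewrite mulr_ge0 ?exp2_ge0 ?powR_ge0. Qed.

Definition geom_const kappa : R := (1 - exp2 (- kappa))^-1.

Lemma geom_const_gt0 kappa : 0 < kappa -> 0 < geom_const kappa.
Proof. by move=> k0; rewrite invr_gt0 subr_gt0 -exp20 ltr_exp2 oppr_lt0. Qed.

(** The weights [exp2 (kappa * j%:R)] pay for the interchange of the sum over
    the scales with the [p]-th power. *)
Lemma abs_sum_powR_le p kappa n m x : 0 < p -> 0 < kappa ->
  (\sum_(n <= j < m) `|block psi c j x|) `^ p <=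
  geom_const (kappa / p) `^ p *
  \sum_(n <= j < m) exp2 (kappa * j%:R) * `|block psi c j x| `^ p.
Proof.
move=> p0 k0; have kp : 0 < kappa / p by rewrite divr_gt0.
pose u j := exp2 (kappa / p * j%:R) * `|block psi c j x|.
pose v j : R := exp2 (- (kappa / p * j%:R)).
have -> : \sum_(n <= j < m) `|block psi c j x| = \sum_(n <= j < m) u j * v j.
  apply: eq_bigr => j _; rewrite /u /v mulrAC -exp2D subrr exp20 mul1r//.
have -> : \sum_(n <= j < m) exp2 (kappa * j%:R) * `|block psi c j x| `^ p =
    \sum_(n <= j < m) u j `^ p.
  apply: eq_bigr => j _; rewrite /u powRM ?exp2_ge0// exp2_powR.
  by congr (exp2 _ * _); field; rewrite gt_eqF.
apply: power_sum_le => //.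
- by move=> j; rewrite mulr_ge0 ?exp2_ge0.
- by move=> j; exact: exp2_ge0.
apply: le_trans (geometric_exp2_le n m kp) _.
have g0 := ltW (geom_const_gt0 kp).
rewrite -[leRHS]mul1r; apply: (ler_wpM2r g0).
by rewrite -[leRHS]exp20 ler_exp2 oppr_le0 mulr_ge0 ?(ltW kp).
Qed.

(** At every point, by the weighted tail of the [p]-th powers of the blocks,
    which may be infinite. *)
Lemma recon_lim_tail p kappa n x : 0 < p -> 0 < kappa ->
  ((`|recon_lim x - recon n x| `^ p)%:E <=
   (geom_const (kappa / p) `^ p)%:E * \sum_(j <oo) (tail_term p kappa n j x)%:E)%E.
Proof.
move=> p0 k0; have kp : 0 < kappa / p by rewrite divr_gt0.
have Q0 := geom_const_gt0 kp.
set Q := geom_const (kappa / p) in Q0 *.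
have V0 : (0 <= \sum_(j <oo) (tail_term p kappa n j x)%:E)%E.
  by apply: nneseries_ge0 => j _ _; rewrite lee_fin tail_term_ge0.
case VE : (\sum_(j <oo) (tail_term p kappa n j x)%:E)%E => [v| |]; last by rewrite VE in V0.
2: by rewrite gt0_muley ?leey// lte_fin powR_gt0.
rewrite VE lee_fin in V0; rewrite -EFinM lee_fin.
have part m : \sum_(n <= j < m) exp2 (kappa * j%:R) * `|block psi c j x| `^ p <= v.
  rewrite -lee_fin -VE.
  apply: le_trans (nneseries_lim_ge m (u_ := fun j => (tail_term p kappa n j x)%:E)
    (m := 0%N) (P := xpredT) _); last by move=> *; rewrite lee_fin tail_term_ge0.
  rewrite sumEFin lee_fin.
  have [nm|mn] := leqP n m; last first.
    by rewrite big_geq ?(ltnW mn)//; apply: sumr_ge0 => *; exact: tail_term_ge0.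
  rewrite [leRHS](@big_cat_nat _ _ _ n)//=.
  apply: ler_wpDl; first by apply: sumr_ge0 => *; exact: tail_term_ge0.
  by rewrite big_nat_cond [leRHS]big_nat_cond; apply: ler_sum => j /andP[/andP[nj _] _];
    rewrite /tail_term nj.
pose B := Q * v `^ p^-1.
have absB m : \sum_(n <= j < m) `|block psi c j x| <= B.
  have s0 : 0 <= \sum_(n <= j < m) `|block psi c j x| by apply: sumr_ge0.
  have := abs_sum_powR_le n m x p0 k0; rewrite -/Q => h.
  have h' := le_trans h (ler_wpM2l (powR_ge0 _ _) (part m)).
  rewrite -[leLHS]powRr1// -(mulfV (lt0r_neq0 p0)) powRrM.
  rewrite /B -[Q]powRr1 ?(ltW Q0)// -[1](mulfV (lt0r_neq0 p0)) powRrM -powRM ?powR_ge0//.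
  by apply: ge0_ler_powR; rewrite ?nnegrE ?invr_ge0 ?(ltW p0) ?mulr_ge0 ?powR_ge0.
have cvg_recon : cvgn (fun m => recon m x).
  have cabs : cvgn [normed series (fun j => block psi c j x)].
    apply: nondecreasing_is_cvgn.
      by apply: nondecreasing_series => * ; exact: normr_ge0.
    exists (\sum_(0 <= j < n) `|block psi c j x| + B) => _ [m _ <-].
    rewrite /series/=; have [nm|mn] := leqP n m.
      by rewrite [leLHS](@big_cat_nat _ _ _ n)//= lerD2l.
    apply: ler_wpDr; first by apply: le_trans (absB n); rewrite big_geq.
    rewrite [leRHS](@big_cat_nat _ _ _ m)//= ?(ltnW mn)// lerDl.
    by apply: sumr_ge0.
  have cs := normed_cvg cabs.
  have -> : (fun m => recon m x) = (fun m => f (cst 1) + series (fun j => block psi c j x) m).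
    by rewrite funeqE => m; rewrite /recon /series_part /series/= big_mkord.
  by apply: is_cvgD => //; exact: is_cvg_cst.
have limE : recon_lim x = limn (fun m => recon m x).
  have cE : (recon m x)%:E @[m --> \oo] --> (limn (fun m => recon m x))%:E.
    by apply: cvg_EFin; [exact: nearW|exact: cvg_recon].
  by rewrite /recon_lim (cvg_limn_einf_sup cE).2.
have cvgD : `|recon m x - recon n x| @[m --> \oo] --> `|recon_lim x - recon n x|.
  by rewrite limE; apply: cvg_norm; apply: cvgB => //; exact: cvg_cst.
have le : `|recon_lim x - recon n x| <= B.
  apply: (ler_cvg_to cvgD (cvg_cst B)); exists n => // m nm /=.
  by rewrite recon_diff//; apply: le_trans (ler_norm_sum _ _ _) (absB m).
apply: (@le_trans _ _ (B `^ p)).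
  by apply: ge0_ler_powR; rewrite ?nnegrE ?(ltW p0)// /B mulr_ge0 ?powR_ge0 ?(ltW Q0).
by rewrite /B powRM ?powR_ge0 ?(ltW Q0)// -powRrM mulVf ?gt_eqF// powRr1.
Qed.

End LpLimit.

Section LpReconstruction.
Context {R : realType}.
Notation mu := (@lebesgue_measure R).
Implicit Types (u v : R -> R) (D : set R) (p x kappa M C a b : R).
Implicit Types (j k m n : nat).

Definition Lp_int p D u : \bar R := (\int[mu]_(x in D) (`|u x| `^ p)%:E)%E.

Lemma measurable_abs_powR p D u : measurable_fun D u ->
  measurable_fun D (fun x => (`|u x| `^ p)%:E).
Proof.
move=> hu; apply/measurable_EFinP.
apply: (measurableT_comp (measurable_powR p)).
exact: measurableT_comp.
Qed.

Lemma Lp_int_ge0 p D u : (0 <= Lp_int p D u)%E.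
Proof. by apply: integral_ge0 => x _; rewrite lee_fin powR_ge0. Qed.

Lemma Lp_int_le p D u v : 0 < p -> measurable D ->
  measurable_fun D u -> measurable_fun D v ->
  (forall x, D x -> `|u x| <= `|v x|) -> (Lp_int p D u <= Lp_int p D v)%E.
Proof.
move=> p0 mD hu mv uv; apply: ge0_le_integral => //.
- exact: measurable_abs_powR.
- exact: measurable_abs_powR.
- by move=> x Dx; rewrite lee_fin; apply: ge0_ler_powR; rewrite ?nnegrE ?(ltW p0)// uv.
Qed.

Lemma Lp_int_add_le p D u v : 0 < p -> measurable D ->
  measurable_fun D u -> measurable_fun D v ->
  (Lp_int p D (fun x => u x + v x)%R <=
   (2 `^ p)%:E * (Lp_int p D u + Lp_int p D v))%E.
Proof.
move=> p0 mD hu mv.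
have mu' := measurable_abs_powR p hu; have mv' := measurable_abs_powR p mv.
have m2 : measurable_fun D (fun x => (`|u x| `^ p)%:E + (`|v x| `^ p)%:E)%E.
  exact: emeasurable_funD.
have -> : (Lp_int p D u + Lp_int p D v =
    \int[mu]_(x in D) ((`|u x| `^ p)%:E + (`|v x| `^ p)%:E))%E.
  by rewrite ge0_integralD// => *; rewrite lee_fin powR_ge0.
have -> : ((2 `^ p)%:E * \int[mu]_(x in D) ((`|u x| `^ p)%:E + (`|v x| `^ p)%:E) =
    \int[mu]_(x in D) ((2 `^ p)%:E * ((`|u x| `^ p)%:E + (`|v x| `^ p)%:E)))%E.
  rewrite ge0_integralZl_EFin ?powR_ge0// => *.
  by rewrite adde_ge0// lee_fin powR_ge0.
apply: ge0_le_integral => //.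
- by apply: measurable_abs_powR; exact: measurable_funD.
- by apply: measurable_funeM.
move=> x Dx; rewrite -EFinD -EFinM lee_fin.
apply: le_trans (powR_add_le p0 (normr_ge0 _) (normr_ge0 _)).
by apply: ge0_ler_powR; rewrite ?nnegrE ?(ltW p0) ?addr_ge0 ?ler_normD.
Qed.

Lemma Lp_int_cst p a b (z : R) : a < b ->
  Lp_int p `[a, b] (cst z) = (`|z| `^ p * (b - a))%:E.
Proof.
move=> ab; have -> : Lp_int p `[a, b] (cst z) =
    (\int[mu]_(x in `[a, b]) cst (`|z| `^ p)%R%:E x)%E by [].
rewrite integral_cst//= lebesgue_measure_itv/= lte_fin ab.
by rewrite -EFinB -EFinM.
Qed.

(** A substitute for Hoelder's inequality, with a free threshold [d]. *)
Lemma abs_le_powR p (d y : R) : 1 <= p -> 0 < d -> 0 <= y ->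
  y <= d + d `^ (1 - p) * y `^ p.
Proof.
move=> p1 d0 y0; have [yd|dy] := leP y d.
  by apply: ler_wpDr => //; rewrite mulr_ge0 ?powR_ge0.
have y0' := lt_trans d0 dy.
apply: ler_wpDl (ltW d0) _.
have {1}-> : y = y `^ (1 - p) * y `^ p.
  have y1 : y != 0 by rewrite gt_eqF.
  by rewrite -powRD ?y1 ?implybT// subrK powRr1.
rewrite ler_wpM2r ?powR_ge0// /powR !gt_eqF// ler_expR.
have : ln d <= ln y by rewrite ler_ln ?posrE// ltW.
by move=> h; rewrite ler_wnM2l// subr_le0.
Qed.

Variables (psi : R -> R) (f : (R -> R) -> R).
Hypothesis mw : mother_wavelet psi.
Let spsi : schwartz psi. Proof. by have [] := mw. Qed.
Notation c := (wavelet_coef psi f).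
Notation recon := (@recon R psi f).
Notation recon_lim := (@recon_lim R psi f).

Lemma measurable_continuous u D : measurable D -> continuous u -> measurable_fun D u.
Proof.
move=> mD cu; apply: (measurable_funS measurableT) => //.
exact: continuous_measurable_fun.
Qed.

Lemma block_continuous d j : continuous (block psi d j).
Proof. exact: smooth_continuous (block_test d j spsi).1. Qed.

Lemma measurable_recon_lim : measurable_fun setT recon_lim.
Proof.
apply: measurableT_comp; first exact: fine_measurable.
apply: measurable_fun_limn_esup => n; apply/measurable_EFinP.
by apply: continuous_measurable_fun; exact: recon_continuous.
Qed.

Lemma recon_periodic n : periodic (recon n) 1.
Proof.
move=> x; rewrite /recon /=; congr (_ + _).
by rewrite (series_part_test c n spsi).2.
Qed.

Lemma recon_lim_periodic : periodic recon_lim 1.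
Proof.
move=> x; rewrite /recon_lim; congr (fine (limn_esup _)).
by rewrite funeqE => n; rewrite recon_periodic.
Qed.

Lemma measurable_recon_diff n D : measurable D ->
  measurable_fun D (fun x => recon_lim x - recon n x).
Proof.
move=> mD; apply: measurable_funB.
  by apply: (measurable_funS measurableT) => //; exact: measurable_recon_lim.
by apply: measurable_continuous => //; exact: recon_continuous.
Qed.

(** A decay [exp2 (- (2 * kappa * j%:R))] of the blocks is spent once on the
    weights of the tail and once on summing the integrals. *)
Lemma tail_integral_le p kappa n D M : measurable D -> 0 < p -> 0 < kappa ->
  0 <= M ->
  (forall j, (n <= j)%N ->
     (Lp_int p D (block psi c j) <= (M * exp2 (- (2 * kappa * j%:R)))%:E)%E) ->
  (Lp_int p D (fun x => recon_lim x - recon n x)%R <=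
   (geom_const (kappa / p) `^ p * (M * geom_const kappa * exp2 (- (kappa * n%:R))))%:E)%E.
Proof.
move=> mD p0 k0 M0 HM.
have mt j : measurable_fun D (fun x => (tail_term psi f p kappa n j x)%:E).
  rewrite /tail_term; case: (n <= j)%N => //.
  apply/measurable_EFinP; apply: measurable_funM => //.
  have := measurable_abs_powR p (measurable_continuous mD (@block_continuous c j)).
  by move/measurable_EFinP.
have t0 j x : D x -> (0 <= (tail_term psi f p kappa n j x)%:E)%E.
  by move=> _; rewrite lee_fin; exact: tail_term_ge0.
have ms : measurable_fun D (fun x => \sum_(j <oo) (tail_term psi f p kappa n j x)%:E)%E.
  have := @ge0_emeasurable_sum _ _ R D (fun j x => (tail_term psi f p kappa n j x)%:E) xpredT.
  by apply => // j x Dx _; exact: t0.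
have s0 x : D x -> (0 <= \sum_(j <oo) (tail_term psi f p kappa n j x)%:E)%E.
  by move=> Dx; apply: nneseries_ge0 => *; exact: t0.
apply: (@le_trans _ _ (\int[mu]_(x in D) ((geom_const (kappa / p) `^ p)%:E *
    \sum_(j <oo) (tail_term psi f p kappa n j x)%:E)%E)%E).
  apply: ge0_le_integral => //.
  - by apply: measurable_abs_powR; exact: measurable_recon_diff.
  - by apply: measurable_funeM.
  - by move=> x Dx; exact: recon_lim_tail.
rewrite ge0_integralZl_EFin ?powR_ge0// EFinM lee_wpmul2l ?lee_fin ?powR_ge0//.
rewrite integral_nneseries//; apply: nneseries_le.
  by move=> j; apply: integral_ge0 => x; exact: t0.
move=> m.
have step j : (\int[mu]_(x in D) (tail_term psi f p kappa n j x)%:E <=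
    (if (n <= j)%N then M * exp2 (- (kappa * j%:R)) else 0)%:E)%E.
  rewrite /tail_term; case: leqP => nj; last by rewrite integral0.
  under eq_integral do rewrite EFinM.
  rewrite ge0_integralZl_EFin ?exp2_ge0//; last first.
    by apply: measurable_abs_powR; apply: measurable_continuous => //; exact: block_continuous.
  apply: (le_trans (lee_wpmul2l _ (HM j nj))); first by rewrite lee_fin exp2_ge0.
  rewrite -EFinM lee_fin mulrCA -exp2D.
  by have -> : kappa * j%:R + - (2 * kappa * j%:R) = - (kappa * j%:R) by ring.
apply: (le_trans (lee_sum _ (fun j _ => step j))); rewrite sumEFin lee_fin.
apply: (@le_trans _ _ (\sum_(n <= j < m) M * exp2 (- (kappa * j%:R)))).
  have [nm|mn] := leqP n m; last first.
    rewrite [leRHS]big_geq ?(ltnW mn)// big_nat_cond big1// => j /andP[/andP[_ jm] _].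
    by rewrite leqNgt (leq_trans jm (ltnW mn)).
  rewrite (@big_cat_nat _ _ _ n)//= big_nat_cond big1 ?add0r; last first.
    by move=> j /andP[/andP[_ jn] _]; rewrite leqNgt jn.
  by rewrite big_nat_cond [leRHS]big_nat_cond; apply: ler_sum => j /andP[/andP[-> _] _].
rewrite -mulr_sumr -mulrA ler_wpM2l// mulrC.
exact: geometric_exp2_le.
Qed.

End LpReconstruction.

Lemma exp2_cvg0 (R : realType) (kappa C : R) : 0 < kappa ->
  C * exp2 (- (kappa * n%:R)) @[n --> \oo] --> (0 : R).
Proof.
move=> k0; rewrite -[X in _ --> X](mulr0 C); apply: cvgM; first exact: cvg_cst.
have -> : (fun n : nat => exp2 (- (kappa * n%:R))) = (fun n => exp2 (- kappa) ^+ n).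
  by rewrite funeqE => n; rewrite -powR_mulrn ?exp2_ge0// exp2_powR mulNr.
apply: cvg_expr; rewrite ger0_norm ?exp2_ge0//.
by rewrite -[ltRHS]exp20 ltr_exp2 oppr_lt0.
Qed.

Section GlobalReconstruction.
Context {R : realType}.
Notation mu := (@lebesgue_measure R).
Implicit Types (x kappa M C a b : R) (j k m n L : nat).
Variables (psi : R -> R) (f : (R -> R) -> R) (p eta : R).
Hypotheses (mw : mother_wavelet psi) (hf : periodic_distribution f).
Hypotheses (p1 : 1 <= p) (eta0 : 0 < eta).
Notation c := (wavelet_coef psi f).
Notation sym_itv L := (`[- L%:R, L%:R]%classic : set R).
Notation recon := (@recon R psi f).
Notation recon_lim := (@recon_lim R psi f).
Hypothesis moment_le : exists J, forall j, (J <= j)%N ->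
  \sum_(k < 2 ^ j) `|c j k| `^ p <= exp2 ((1 - eta) * j%:R).
Let spsi : schwartz psi. Proof. by have [] := mw. Qed.
Let p0 : 0 < p. Proof. exact: lt_le_trans p1. Qed.

Lemma moment_le_all : exists2 A, 0 <= A & forall j,
  \sum_(k < 2 ^ j) `|c j k| `^ p <= A * exp2 ((1 - eta) * j%:R).
Proof.
have [J HJ] := moment_le.
pose t j := (\sum_(k < 2 ^ j) `|c j k| `^ p) * exp2 (- ((1 - eta) * j%:R)).
have t0 j : 0 <= t j.
  by rewrite mulr_ge0 ?exp2_ge0//; apply: sumr_ge0 => *; exact: powR_ge0.
exists (1 + \sum_(j < J) t j); first by rewrite addr_ge0 ?sumr_ge0.
move=> j; have [Jj|jJ] := leqP J j.
  by apply: (le_trans (HJ j Jj)); rewrite ler_peMl ?exp2_ge0// lerDl sumr_ge0.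
have -> : \sum_(k < 2 ^ j) `|c j k| `^ p = t j * exp2 ((1 - eta) * j%:R).
  by rewrite /t -mulrA -exp2D addNr exp20 mulr1.
rewrite ler_wpM2r ?exp2_ge0//; apply: ler_wpDl => //.
by rewrite (bigD1 (Ordinal jJ))//= lerDl sumr_ge0.
Qed.

Lemma block_integral_le L : (0 < L)%N -> exists2 M, 0 <= M & forall j,
  (Lp_int p (sym_itv L) (block psi c j) <= (M * exp2 (- (eta * j%:R)))%:E)%E.
Proof.
move=> L0; have [A A0 HA] := moment_le_all.
have [C C0 HC] := block_powR_le 1 spsi p1.
pose K : R := L.+2.*2.+1%:R * pi.
have K0 : 0 <= K by rewrite /K; apply: mulr_ge0 => //; exact: pi_ge0.
exists (K * C * A); first by rewrite (mulr_ge0 (mulr_ge0 K0 C0)).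
move=> j.
have mh : measurable_fun (sym_itv L) (fun x => `|block psi c j x| `^ p).
  apply/measurable_EFinP; apply: measurable_abs_powR.
  by apply: measurable_continuous => //; exact: block_continuous.
have LL : - L%:R < L%:R :> R.
  by have : 0 < L%:R :> R; [rewrite ltr0n|lra].
apply: le_trans (@integral_weight_le R L j (fun k => C * `|c j k| `^ p)
  (fun x => `|block psi c j x| `^ p) _ _ LL _ _ _ mh _ _) _ => //.
- by move=> k; rewrite mulr_ge0 ?powR_ge0.
- move=> x _; apply: le_trans (HC _ _ _) _.
  by rewrite mulr_sumr; apply: ler_sum => k _; rewrite expr1 mulrA.
rewrite lee_fin -mulr_sumr -/K.
have -> : K * C * A * exp2 (- (eta * j%:R)) =
    K / 2 ^+ j * (C * (A * exp2 ((1 - eta) * j%:R))).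
  have -> : - (eta * j%:R) = (1 - eta) * j%:R - j%:R by ring.
  by rewrite exp2D exp2_natN; ring.
by rewrite ler_wpM2l ?divr_ge0 ?exprn_ge0// ler_wpM2l.
Qed.

Lemma recon_integral_le L : (0 < L)%N ->
  exists kappa M, [/\ 0 < kappa, 0 <= M & forall n,
    (Lp_int p (sym_itv L) (fun x => recon_lim x - recon n x)%R <=
     (M * exp2 (- (kappa * n%:R)))%:E)%E].
Proof.
move=> L0; have [M M0 HM] := block_integral_le L0.
have k0 : 0 < eta / 2 by rewrite divr_gt0.
exists (eta / 2), (geom_const (eta / 2 / p) `^ p * (M * geom_const (eta / 2))).
have g0 := ltW (geom_const_gt0 k0).
split=> // [|n]; first by rewrite !mulr_ge0 ?powR_ge0.
rewrite -mulrA; apply: (@tail_integral_le _ _ _ mw p (eta / 2) n (sym_itv L) M) => //.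
move=> j _; have -> : 2 * (eta / 2) = eta by field.
exact: HM.
Qed.

Lemma recon_lim_Lp : locally_Lp p recon_lim.
Proof.
split; first exact: (@measurable_recon_lim R psi f mw).
move=> a b.
pose L := (Num.truncn (`|a| + `|b|)).+1.
have L0 : (0 < L)%N by [].
have abL : `|a| + `|b| < L%:R by exact: truncnS_gt.
have sub : `[a, b]%classic `<=` (sym_itv L).
  move=> x /=; rewrite !in_itv/= => /andP[ax xb]; apply/andP; split.
    by move: abL; have := ler_norm (- a); rewrite normrN; have := normr_ge0 b; lra.
  by move: abL; have := ler_norm b; have := normr_ge0 a; lra.
have mF : measurable_fun (sym_itv L) recon_lim.
  by apply: (measurable_funS measurableT) => //; exact: (@measurable_recon_lim R psi f mw).
apply: (@le_lt_trans _ _ (Lp_int p (sym_itv L) recon_lim)).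
  apply: ge0_subset_integral => //; exact: measurable_abs_powR.
have LL : - L%:R < L%:R :> R.
  by have : 0 < L%:R :> R; [rewrite ltr0n|lra].
have [kappa [M [_ _ /(_ 0%N) HM]]] := recon_integral_le L0.
have E0 : recon 0 = cst (f (cst 1)).
  by rewrite funeqE => x; rewrite /recon /series_part big_ord0 addr0.
have -> : recon_lim = (fun x => (recon_lim x - recon 0 x) + recon 0 x).
  by rewrite funeqE => x; rewrite subrK.
apply: le_lt_trans (Lp_int_add_le p0 _ _ _) _ => //.
- exact: (@measurable_recon_diff R psi f mw).
- by rewrite E0.
rewrite {2}E0 Lp_int_cst//.
apply: (@le_lt_trans _ _ ((2 `^ p)%:E * ((M * exp2 (- (kappa * 0%:R)))%:E +
  (`|f (cst 1)| `^ p * (L%:R - - L%:R))%:E))%E).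
  by apply: lee_wpmul2l; rewrite ?lee_fin ?powR_ge0//; exact: leeD2r.
by rewrite -EFinD -EFinM ltry.
Qed.

(** The series converges in L^1 on a period because
    [y <= d + d `^ (1 - p) * y `^ p], with [d] decreasing geometrically. *)
Lemma recon_lim_represents : represents recon_lim f.
Proof.
split; first exact: (@recon_lim_periodic R psi f mw).
move=> phi tphi.
have cphi := smooth_continuous tphi.1.
have [B B0 HB] := periodic_bounded cphi tphi.2.
have [kappa [M [k0 M0 HM]]] := recon_integral_le (isT : (0 < 1)%N).
have m01 : measurable (`[0, 1]%classic : set R) by [].
have kp0 : 0 < kappa / p by rewrite divr_gt0.
pose d n : R := exp2 (- (kappa / p * n%:R)).
have sub : `[0, 1]%classic `<=` (sym_itv 1).
  by move=> x /=; rewrite !in_itv/= => /andP[x0 x1]; rewrite x1 andbT (le_trans _ x0)// lerN10.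
have m11 : measurable (sym_itv 1) by [].
have mdiff n D : measurable D -> measurable_fun D (fun x => recon_lim x - recon n x).
  exact: (@measurable_recon_diff R psi f mw).
have mphi : measurable_fun (`[0, 1]%classic : set R) phi by exact: measurable_continuous.
have L1 n : (\int[mu]_(x in `[0%R, 1%R]) (`|phi x * (recon_lim x - recon n x)|%R)%:E <=
    (B * (d n * (1 + M)))%:E)%E.
  pose y x := `|recon_lim x - recon n x|.
  have my : measurable_fun (`[0, 1]%classic : set R) (fun x => (y x `^ p)%:E).
    by apply: measurable_abs_powR; exact: mdiff.
  have mz : measurable_fun (`[0, 1]%classic : set R)
      (fun x => (d n `^ (1 - p))%:E * (y x `^ p)%:E)%E by exact: measurable_funeM.
  have ms : measurable_fun (`[0, 1]%classic : set R)
      (fun x => ((d n)%:E + (d n `^ (1 - p))%:E * (y x `^ p)%:E)%E).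
    exact: emeasurable_funD.
  apply: (@le_trans _ _ (\int[mu]_(x in `[0%R, 1%R])
      (B%:E * ((d n)%:E + (d n `^ (1 - p))%:E * (y x `^ p)%:E)))%E).
    apply: ge0_le_integral => //.
    - apply/measurable_EFinP; apply: measurableT_comp => //; apply: measurable_funM => //.
      exact: mdiff.
    - exact: measurable_funeM.
    - move=> x _.
      rewrite -[leRHS]/((B * (d n + d n `^ (1 - p) * y x `^ p))%R%:E) lee_fin normrM.
      apply: ler_pM => //; apply: abs_le_powR => //; exact: exp2_gt0.
  have d0 : (0 <= (d n)%:E)%E by rewrite lee_fin exp2_ge0.
  have dy0 x : (0 <= (d n `^ (1 - p))%:E * (y x `^ p)%:E)%E.
    by rewrite -EFinM lee_fin mulr_ge0 ?powR_ge0.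
  rewrite ge0_integralZl_EFin//; last by move=> x _; rewrite adde_ge0.
  rewrite EFinM; apply: lee_wpmul2l; first by rewrite lee_fin.
  rewrite ge0_integralD//.
  have -> : (\int[mu]_(x in `[0%R, 1%R]) (d n)%:E = (d n)%:E)%E.
    have -> : (\int[mu]_(x in `[0%R, 1%R]) (d n)%:E =
      \int[mu]_(x in `[0%R, 1%R]) cst (d n)%:E x)%E by [].
    by rewrite integral_cst//= lebesgue_measure_itv/= lte_fin ltr01 -EFinB subr0 mule1.
  have -> : d n * (1 + M) = d n + d n * M by ring.
  rewrite ge0_integralZl_EFin ?powR_ge0//; last by move=> x _; rewrite lee_fin powR_ge0.
  rewrite EFinD; apply: leeD2l.
  have h : (\int[mu]_(x in `[0%R, 1%R]) (y x `^ p)%:E <= (M * exp2 (- (kappa * n%:R)))%:E)%E.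
    apply: le_trans (HM n); apply: ge0_subset_integral => //.
      by apply: measurable_abs_powR; exact: mdiff.
    by move=> x _; rewrite lee_fin powR_ge0.
  apply: (le_trans (lee_wpmul2l _ h)); first by rewrite lee_fin powR_ge0.
  rewrite -EFinM lee_fin /d exp2_powR mulrCA mulrC -exp2D.
  rewrite ler_wpM2r// ler_exp2 le_eqVlt; apply/orP; left; apply/eqP.
  by field; rewrite gt_eqF.
have int_recon n : mu.-integrable `[0, 1] (fun x => (phi x * recon n x)%:E).
  apply: continuous_integrable_itv; apply: continuousM_fun => //.
  exact: recon_continuous.
have int_diff n : mu.-integrable `[0, 1] (fun x => (phi x * (recon_lim x - recon n x))%:E).
  apply/integrableP; split; last by apply: le_lt_trans (L1 n) _; exact: ltry.
  by apply/measurable_EFinP; apply: measurable_funM => //; exact: mdiff.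
have split_int n : inner01 phi recon_lim = cint (fun x => phi x * recon n x) 0 1 +
    \int[mu]_(x in `[0%R, 1%R]) (phi x * (recon_lim x - recon n x)).
  rewrite -cint_Rintegral//; last by apply: continuousM_fun => //; exact: recon_continuous.
  rewrite -RintegralD//; [|exact: int_recon|exact: int_diff].
  by rewrite /inner01; apply: eq_Rintegral => x _; ring.
have cv := recon_cvg mw hf tphi.
suff : cint (fun x => phi x * recon n x) 0 1 @[n --> \oo] --> inner01 phi recon_lim.
  by move=> h; exact: (cvg_unique (@Rhausdorff R) cv h).
have -> : (fun n => cint (fun x => phi x * recon n x) 0 1) =
  (fun n => inner01 phi recon_lim +
     - \int[mu]_(x in `[0%R, 1%R]) (phi x * (recon_lim x - recon n x))).
  by rewrite funeqE => n; rewrite (split_int n) addrK.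
rewrite -[X in _ --> X]addr0; apply: cvgD; first exact: cvg_cst.
apply: (@cvg0_le _ _ (fun n => B * (1 + M) * exp2 (- (kappa / p * n%:R)))).
  move=> n; rewrite normrN; apply: le_trans (le_normr_Rintegral _ (int_diff n)) _ => //.
  rewrite -lee_fin /Rintegral fineK; last first.
    rewrite ge0_fin_numE; last by apply: integral_ge0 => x _; rewrite lee_fin.
    by apply: le_lt_trans (L1 n) _; exact: ltry.
  apply: le_trans (L1 n) _; rewrite lee_fin le_eqVlt; apply/orP; left; apply/eqP.
  by rewrite /d; ring.
exact: exp2_cvg0.
Qed.

End GlobalReconstruction.

(** * Local regularity of the wavelet series *)

(** The integer [l] accounts for the passage from one end of the period to the
    other. *)
Lemma mem_neighbours (M q k : nat) (l : int) : (q < M)%N -> (k < M)%N ->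
  (- 1 <= l <= 1)%R -> (- 2 < q%:Z + l * M%:Z - k%:Z < 2)%R ->
  q \in [:: ((k + M.-1) %% M)%N; k; (k.+1 %% M)%N].
Proof.
move=> qM kM l1 h; rewrite !inE prev_modE// next_modE//.
have : (l = -1 \/ l = 0 \/ l = 1)%R by lia.
by case=> [lE|[lE|lE]]; move: h; rewrite lE; do ![case: ifP => [/eqP|/eqP]]; lia.
Qed.

Section NearFar.
Context {R : realType}.
Implicit Types (x y : R) (d : nat -> R) (i j k J N : nat).
Variable x0 : R.

Definition near_point J j k : bool := near3 J (dyadic_index J x0) j k.

(** Otherwise the dyadic interval of scale [J] above [k] would be the one of
    [x0] or a cyclic neighbour of it. *)
Lemma far_distZ J j k : (J <= j)%N -> (k < 2 ^ j)%N -> ~~ near_point J j k ->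
  exp2 (- J%:R) <= distZ (x0 - k%:R / 2 ^+ j).
Proof.
move=> Jj kj; apply: contraNT; rewrite -ltNge.
have j0 : 0 < 2 ^+ j :> R by rewrite exprn_gt0.
have J0 : 0 < 2 ^+ J :> R by rewrite exprn_gt0.
set y := frac_part x0.
have -> : x0 - k%:R / 2 ^+ j = y - k%:R / 2 ^+ j + (Num.floor x0)%:~R.
  by rewrite /y /frac_part; ring.
rewrite distZ_shift.
have [l -> lE] := distZ_ex (y - k%:R / 2 ^+ j).
have k0 : 0 <= k%:R / 2 ^+ j :> R by rewrite divr_ge0// ltW.
have k1 : k%:R / 2 ^+ j < 1 :> R by rewrite ltr_pdivrMr// mul1r -natrX ltr_nat.
have y0 : 0 <= y := frac_part_ge0 x0.
have y1 : y < 1 := frac_part_lt1 x0.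
have l1 : (- 1 <= l <= 1)%R.
  have f1 := floor_le (y - k%:R / 2 ^+ j); have f2 := floorD1_gt (y - k%:R / 2 ^+ j).
  have h1 : (Num.floor (y - k%:R / 2 ^+ j))%:~R < 1%:~R :> R by rewrite mulr1z; lra.
  have h2 : (-2)%:~R < (Num.floor (y - k%:R / 2 ^+ j))%:~R :> R.
    by move: f2; rewrite intrD mulrNz; lra.
  by move: h1 h2; rewrite !ltr_int => h1 h2; case: lE => ->; lia.
rewrite exp2_natN -(ltr_pM2l J0) mulfV ?gt_eqF// -[X in X * `|_|]ger0_norm ?(ltW J0)//.
rewrite -normrM ltr_norml => /andP[h1 h2].
rewrite /near_point /near3.
set D := (2 ^ (j - J))%N; set q := (k %/ D)%N.
have D0 : 0 < D%:R :> R by rewrite ltr0n expn_gt0.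
have kE : k%:R / 2 ^+ j * 2 ^+ J = k%:R / D%:R :> R.
  rewrite -[in LHS](subnK Jj) exprD /D natrX.
  by field; rewrite !expf_neq0// pnatr_eq0.
have q1 : q%:R <= k%:R / D%:R :> R.
  by rewrite ler_pdivlMr// -natrM ler_nat leq_divM.
have q2 : k%:R / D%:R < q%:R + 1 :> R.
  by rewrite ltr_pdivrMr// natr1 -natrM ltr_nat ltn_ceil// expn_gt0.
have /andP[d1 d2] := dyadic_index_itv J x0.
move: d1 d2; rewrite -/y ler_pdivrMr// ltr_pdivlMr// -natr1 => d1 d2.
apply: (@mem_neighbours (2 ^ J) q (dyadic_index J x0) l) => //.
- exact: div_near_lt.
- exact: dyadic_index_lt.
have hE : 2 ^+ J * (y - k%:R / 2 ^+ j - l%:~R) =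
    y * 2 ^+ J - k%:R / D%:R - l%:~R * 2 ^+ J :> R by rewrite -kE; ring.
rewrite hE in h1 h2.
have E : (q%:Z + l * (2 ^ J)%N%:Z - (dyadic_index J x0)%:Z)%:~R =
    q%:R + l%:~R * 2 ^+ J - (dyadic_index J x0)%:R :> R.
  by rewrite rmorphB rmorphD rmorphM /= -!pmulrn natrX.
rewrite -!(ltr_int R) E mulrNz; clear - h1 h2 q1 q2 d1 d2.
by apply/andP; split; lra.
Qed.

Lemma weight_far_le J j k x : (J <= j)%N -> (k < 2 ^ j)%N -> ~~ near_point J j k ->
  `|x - x0| <= exp2 (- J.+1%:R) ->
  weight j k x <= 4 * exp2 (- (2 * (j%:R - J%:R))).
Proof.
move=> Jj kj far xx0; have h := far_distZ Jj kj far.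
have h1 : exp2 (- J.+1%:R) <= distZ (x - k%:R / 2 ^+ j).
  have := distZ_lip (x0 - k%:R / 2 ^+ j) (x - k%:R / 2 ^+ j).
  have -> : x0 - k%:R / 2 ^+ j - (x - k%:R / 2 ^+ j) = - (x - x0) by ring.
  rewrite normrN => h2.
  have : exp2 (- J%:R) = exp2 (- J.+1%:R) + exp2 (- J.+1%:R) :> R.
    have -> : - J%:R = - J.+1%:R + 1 :> R by rewrite -[J.+1%:R]natr1; ring.
    by rewrite exp2D exp21; ring.
  by clear -h h2 xx0; lra.
set t := 2 ^+ j * distZ (x - k%:R / 2 ^+ j).
have t1 : exp2 (j%:R - J%:R - 1) <= t.
  have -> : j%:R - J%:R - 1 = j%:R + - J.+1%:R :> R by rewrite -[J.+1%:R]natr1; ring.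
  by rewrite exp2D exp2_nat ler_wpM2l ?exprn_ge0.
have u0 : 0 < exp2 (j%:R - J%:R - 1) :> R by exact: exp2_gt0.
have t0 := lt_le_trans u0 t1.
rewrite /weight -/t /decay.
have -> : 4 * exp2 (- (2 * (j%:R - J%:R))) = (exp2 (j%:R - J%:R - 1) ^+ 2)^-1 :> R.
  rewrite -[X in X^-1](@powR_mulrn R _ 2) ?exp2_ge0// exp2_powR -exp2N.
  have -> : - ((j%:R - J%:R - 1) * 2) = 2%:R + - (2 * (j%:R - J%:R)) :> R by ring.
  by rewrite exp2D exp2_nat; congr (_ * _); ring.
rewrite lef_pV2 ?posrE ?exprn_gt0// ?ltr_pwDl ?ltr01 ?sqr_ge0//.
apply: ler_wpDl => //; rewrite lerXn2r ?nnegrE// ltW//.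
Qed.

(** All factors of the weight except one damp the coefficients far from [x0];
    the last one is kept for summation or integration over [x]. *)
Lemma near_far_sum d J j N x : (forall k, 0 <= d k) -> (J <= j)%N ->
  `|x - x0| <= exp2 (- J.+1%:R) ->
  \sum_(k < 2 ^ j) d k * weight j k x ^+ N.+1 <=
  \sum_(k < 2 ^ j) (d k * (if near_point J j k then 1
     else (4 * exp2 (- (2 * (j%:R - J%:R)))) ^+ N)) * weight j k x.
Proof.
move=> d0 Jj xx0; apply: ler_sum => k _; rewrite exprSr mulrA.
rewrite ler_wpM2r ?weight_ge0// ler_wpM2l//; case: ifPn => far.
  by rewrite exprn_ile1 ?weight_ge0 ?weight_le1.
by rewrite lerXn2r ?nnegrE ?weight_ge0 ?mulr_ge0 ?exp2_ge0// weight_far_le.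
Qed.

End NearFar.

Section LocalBounds.
Context {R : realType}.
Implicit Types (x y z : R) (i j k m n L : nat).
Variables (psi : R -> R) (f : (R -> R) -> R) (p eta g delta x0 A : R) (N J0 : nat).
Notation c := (wavelet_coef psi f).
Notation recon := (@recon R psi f).
Notation recon_lim := (@recon_lim R psi f).
Notation sym_itv L := (`[- L%:R, L%:R]%classic : set R).
Hypotheses (mw : mother_wavelet psi) (p1 : 1 <= p) (eta0 : 0 < eta).
Hypotheses (gp0 : 0 < g * p + 1) (d0 : 0 < delta) (d1 : delta < 1).
Hypotheses (Nd : g * p + 1 <= 2 * N%:R * delta) (A0 : 0 <= A).
Hypothesis moment_le : forall j,
  \sum_(k < 2 ^ j) `|c j k| `^ p <= A * exp2 ((1 - eta) * j%:R).
Hypothesis moment_ev : exists J, forall j, (J <= j)%N ->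
  \sum_(k < 2 ^ j) `|c j k| `^ p <= exp2 ((1 - eta) * j%:R).
Hypothesis small_leader : forall j j', (J0 <= j)%N -> (j <= j')%N ->
  leader_sum c p j (dyadic_index j x0) j' <= exp2 (- (g * p) * j%:R).
Let spsi : schwartz psi. Proof. by have [] := mw. Qed.
Let p0 : 0 < p. Proof. exact: lt_le_trans p1. Qed.

(** A scale slightly coarser than [i]: coefficients of scale [j >= i] that are
    not near [x0] at this scale are damped by a negative power of [2 ^ j]. *)
Definition coarse i : nat := Num.truncn ((1 - delta) * i%:R).

Let loc := (g * p + 1) * (1 - delta).

Let loc_gt0 : 0 < loc.
Proof. by rewrite mulr_gt0// subr_gt0. Qed.

Let loc_le : loc <= g * p + 1.
Proof. by rewrite /loc; move: gp0 d0; nra. Qed.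

Lemma coarse_le i : (coarse i)%:R <= (1 - delta) * i%:R.
Proof. by rewrite truncn_le// mulr_ge0// subr_ge0 ltW. Qed.

Lemma coarse_gt i : (1 - delta) * i%:R < (coarse i).+1%:R.
Proof. exact: truncnS_gt. Qed.

Lemma coarse_lt i : (0 < i)%N -> (coarse i < i)%N.
Proof.
move=> i0; rewrite -(ltr_nat R); apply: le_lt_trans (coarse_le i) _.
have : 0 < i%:R :> R by rewrite ltr0n.
by move: d0; nra.
Qed.

Lemma coarse_large J : exists I, forall i, (I <= i)%N -> (0 < i)%N /\ (J <= coarse i)%N.
Proof.
pose I := (Num.truncn (J%:R / (1 - delta))).+1.
exists I => i Ii; split; first exact: leq_trans Ii.
have e0 : 0 < 1 - delta by rewrite subr_gt0.
have h : J%:R / (1 - delta) < i%:R.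
  by apply: (lt_le_trans (truncnS_gt _)); rewrite ler_nat.
rewrite ltr_pdivrMr// mulrC in h.
by have := lt_trans h (coarse_gt i); rewrite ltr_nat.
Qed.

Let far i j : R := (4 * exp2 (- (2 * (j%:R - (coarse i)%:R)))) ^+ N.

Let far_ge0 i j : 0 <= far i j.
Proof. by rewrite exprn_ge0 ?mulr_ge0 ?exp2_ge0. Qed.

Lemma far_factor_le i j : (i <= j)%N ->
  far i j <= 4 ^+ N * exp2 (- ((g * p + 1) * j%:R)).
Proof.
move=> ij; rewrite /far exprMn ler_wpM2l ?exprn_ge0//.
rewrite -(powR_mulrn N (exp2_ge0 _)) exp2_powR ler_exp2.
have ijR : i%:R <= j%:R :> R by rewrite ler_nat.
have h : delta * j%:R <= j%:R - (coarse i)%:R.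
  by have := coarse_le i; move: d0 d1; nra.
have := ler_wpM2r (ler0n R j) Nd; have := ler_wpM2l (ler0n R N) h.
by nra.
Qed.

Let window_le i : (0 < i)%N -> exp2 (- i%:R) <= exp2 (- (coarse i).+1%:R) :> R.
Proof. by move=> i0; rewrite ler_exp2 lerN2 ler_nat coarse_lt. Qed.

Lemma coarse_exp_le i : exp2 (- ((g * p + 1) * (coarse i)%:R)) <=
  exp2 (g * p + 1) * exp2 (- (loc * i%:R)).
Proof.
rewrite -exp2D ler_exp2 /loc.
have := coarse_gt i; rewrite -natr1 => h.
by have := ler_wpM2l (ltW gp0) (ltW h); nra.
Qed.

(** The smallness of the leaders enters here and nowhere else. *)
Lemma near_moment_le i j : (J0 <= coarse i)%N -> (i <= j)%N ->
  \sum_(k < 2 ^ j | near_point x0 (coarse i) j k) `|c j k| `^ p <=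
  exp2 (g * p + 1) * exp2 (j%:R - loc * i%:R).
Proof.
move=> Ji ij.
have cj : (coarse i <= j)%N.
  rewrite -(ler_nat R); apply: le_trans (coarse_le i) _.
  have : i%:R <= j%:R :> R by rewrite ler_nat.
  by have : 0 <= i%:R :> R by []; move: d0; nra.
have := small_leader Ji cj.
rewrite /leader_sum /leader_part.
under eq_bigl do rewrite andbT.
rewrite -mulr_suml -exp2_natN natrB// => h.
have h' := ler_wpM2r (exp2_ge0 (j%:R - (coarse i)%:R)) h.
rewrite -mulrA -!exp2D addNr exp20 mulr1 in h'; apply: (le_trans h').
have -> : - (g * p) * (coarse i)%:R + (j%:R - (coarse i)%:R) =
  j%:R + - ((g * p + 1) * (coarse i)%:R) by ring.
have -> : exp2 (g * p + 1) * exp2 (j%:R - loc * i%:R) =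
  exp2 j%:R * (exp2 (g * p + 1) * exp2 (- (loc * i%:R))) by rewrite [exp2 (j%:R - _)]exp2D mulrCA.
by rewrite [leLHS]exp2D ler_wpM2l ?exp2_ge0// coarse_exp_le.
Qed.

Lemma local_moment_le i j : (J0 <= coarse i)%N -> (i <= j)%N ->
  \sum_(k < 2 ^ j) `|c j k| `^ p *
    (if near_point x0 (coarse i) j k then 1 else far i j) <=
  (exp2 (g * p + 1) + 4 ^+ N * A) * exp2 (j%:R - loc * i%:R).
Proof.
move=> Ji ij; rewrite mulrDl.
apply: (@le_trans _ _ (\sum_(k < 2 ^ j | near_point x0 (coarse i) j k) `|c j k| `^ p +
    \sum_(k < 2 ^ j) `|c j k| `^ p * far i j)).
  rewrite [X in _ <= X + _]big_mkcond -big_split/=; apply: ler_sum => k _.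
  case: ifP => _; first by rewrite mulr1 lerDl mulr_ge0 ?powR_ge0.
  by rewrite add0r.
apply: lerD; first exact: near_moment_le.
rewrite -mulr_suml.
have ijR : i%:R <= j%:R :> R by rewrite ler_nat.
apply: le_trans (ler_pM _ _ (moment_le j) (far_factor_le ij)) _ => //.
  by apply: sumr_ge0 => *; exact: powR_ge0.
rewrite mulrACA [A * _]mulrC -exp2D ler_wpM2l ?mulr_ge0 ?exprn_ge0//.
rewrite ler_exp2.
have h1 : loc * i%:R <= (g * p + 1) * j%:R.
  by apply: ler_pM; rewrite ?(ltW loc_gt0) ?loc_le.
have h2 : 0 <= eta * j%:R by rewrite mulr_ge0// ltW.
have -> : (1 - eta) * j%:R + - ((g * p + 1) * j%:R) =
  j%:R - eta * j%:R - (g * p + 1) * j%:R by ring.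
by apply: lerB => //; rewrite gerBl.
Qed.

Notation ball_itv i := (`[x0 - exp2 (- i%:R), x0 + exp2 (- i%:R)]%classic : set R).

Let ball_itvP i x : ball_itv i x -> `|x - x0| <= exp2 (- i%:R).
Proof. by rewrite /= in_itv/= => h; rewrite ler_distl. Qed.

Lemma ball_itv_sub i L : `|x0| + 1 <= L%:R -> ball_itv i `<=` sym_itv L.
Proof.
move=> xL x /ball_itvP; rewrite ler_distl /= in_itv/= => /andP[h1 h2].
have e1 : exp2 (- i%:R) <= 1 :> R by rewrite -[leRHS]exp20 ler_exp2 oppr_le0.
have := ler_norm x0; have := ler_norm (- x0); rewrite normrN => h3 h4.
by apply/andP; split; lra.
Qed.

Lemma local_block_integral_le : exists2 M, 0 <= M & forall i j,
  (0 < i)%N -> (J0 <= coarse i)%N -> (i <= j)%N ->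
  (Lp_int p (ball_itv i) (block psi c j) <= (M * exp2 (- (loc * i%:R)))%:E)%E.
Proof.
have [C C0 HC] := block_powR_le N.+1 spsi p1.
pose L := (Num.truncn (`|x0| + 1)).+1.
have xL : `|x0| + 1 <= L%:R by apply/ltW/truncnS_gt.
pose K : R := L.+2.*2.+1%:R * pi.
have K0 : 0 <= K by rewrite mulr_ge0 ?pi_ge0.
pose B := exp2 (g * p + 1) + 4 ^+ N * A.
have B0 : 0 <= B by rewrite addr_ge0 ?exp2_ge0// mulr_ge0 ?exprn_ge0.
exists (K * C * B); first by rewrite (mulr_ge0 (mulr_ge0 K0 C0)).
move=> i j i0 Ji ij.
have mh : measurable_fun (ball_itv i) (fun x => `|block psi c j x| `^ p).
  apply/measurable_EFinP; apply: measurable_abs_powR.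
  by apply: measurable_continuous => //; exact: block_continuous.
have LL : x0 - exp2 (- i%:R) < x0 + exp2 (- i%:R).
  by have := @exp2_gt0 R (- i%:R); lra.
have end1 : ball_itv i (x0 - exp2 (- i%:R)) by rewrite /= in_itv/= lexx ltW.
have end2 : ball_itv i (x0 + exp2 (- i%:R)) by rewrite /= in_itv/= lexx ltW.
have := ball_itv_sub xL end1; rewrite /= in_itv/= => /andP[L1 _].
have := ball_itv_sub xL end2; rewrite /= in_itv/= => /andP[_ L2].
have cj : (coarse i <= j)%N by rewrite (leq_trans (ltnW (coarse_lt i0))).
apply: le_trans (@integral_weight_le R L j (fun k => C * (`|c j k| `^ p *
  (if near_point x0 (coarse i) j k then 1 else far i j)))
  (fun x => `|block psi c j x| `^ p) _ _ LL L1 L2 _ mh _ _) _ => //.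
- by move=> k; rewrite !mulr_ge0 ?powR_ge0//; case: ifP.
- move=> x xb; apply: le_trans (HC _ _ _) _.
  under [leRHS]eq_bigr do rewrite -mulrA.
  rewrite -mulr_sumr ler_wpM2l//.
  apply: (@near_far_sum R x0 (fun k => `|c j k| `^ p) (coarse i) j N x) => //.
  by apply: le_trans (window_le i0); apply: ball_itvP; rewrite /= in_itv.
rewrite lee_fin -mulr_sumr -/K.
have -> : K * C * B * exp2 (- (loc * i%:R)) =
    K / 2 ^+ j * (C * (B * exp2 (j%:R - loc * i%:R))).
  have -> : exp2 (- (loc * i%:R)) = exp2 (j%:R - loc * i%:R) / 2 ^+ j.
    by rewrite -exp2_natN -exp2D; congr exp2; ring.
  ring.
by rewrite ler_wpM2l ?divr_ge0 ?exprn_ge0// ler_wpM2l// local_moment_le.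
Qed.

(** Interpolation between the local bound, which does not improve with [j],
    and the global decay in [j]. *)
Lemma local_tail_integral_le :
  exists D, exists2 I, 0 <= D & forall i, (I <= i)%N ->
  (Lp_int p (ball_itv i) (fun x => recon_lim x - recon i x)%R <=
   (D * exp2 (- ((1 - delta) * loc * i%:R)))%:E)%E.
Proof.
have [M M0 HM] := local_block_integral_le.
pose L := (Num.truncn (`|x0| + 1)).+1.
have xL : `|x0| + 1 <= L%:R by apply/ltW/truncnS_gt.
have [M' M'0 HM'] := @block_integral_le R psi f p eta mw p1 moment_ev L isT.
pose Q := Num.max M M'.
have Q0 : 0 <= Q by rewrite le_max M0.
have [I HI] := coarse_large J0.
have k0 : 0 < delta * eta / 2 by rewrite divr_gt0// mulr_gt0.
exists (geom_const (delta * eta / 2 / p) `^ p * (Q * geom_const (delta * eta / 2))), I.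
  by rewrite !mulr_ge0 ?powR_ge0// ltW// geom_const_gt0.
move=> i Ii; have [i0 Ji] := HI i Ii.
have mB : measurable (ball_itv i) by [].
set e := exp2 (- ((1 - delta) * loc * i%:R)).
apply: le_trans (@tail_integral_le R psi f mw p (delta * eta / 2) i (ball_itv i)
  (Q * e) mB p0 k0 _ _) _.
- by rewrite mulr_ge0 ?exp2_ge0.
- move=> j ij.
  have h1 := HM i j i0 Ji ij.
  have h2 : (Lp_int p (ball_itv i) (block psi c j) <=
             (M' * exp2 (- (eta * j%:R)))%:E)%E.
    apply: le_trans (HM' j); apply: ge0_subset_integral => //.
      apply: measurable_abs_powR; apply: measurable_continuous => //.
      exact: block_continuous.
    exact: ball_itv_sub.
  have E : Q * e * exp2 (- (2 * (delta * eta / 2) * j%:R)) =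
      Q * exp2 ((1 - delta) * - (loc * i%:R) + delta * - (eta * j%:R)).
    by rewrite /e -mulrA -exp2D; congr (_ * exp2 _); field.
  rewrite E.
  have [uv|vu] := leP (- (loc * i%:R)) (- (eta * j%:R)).
    apply: (le_trans h1); rewrite lee_fin.
    apply: ler_pM => //; rewrite ?exp2_ge0// ?le_max ?lexx// ler_exp2.
    by move: uv d0 d1; move: (- (loc * i%:R)) (- (eta * j%:R)) => u v; nra.
  apply: (le_trans h2); rewrite lee_fin.
  apply: ler_pM => //; rewrite ?exp2_ge0// ?le_max ?lexx ?orbT// ler_exp2.
  by move: vu d0 d1; move: (- (loc * i%:R)) (- (eta * j%:R)) => u v; nra.
rewrite lee_fin.
rewrite -[X in _ <= X]mulrA ler_wpM2l ?powR_ge0//.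
have -> : Q * e * geom_const (delta * eta / 2) * exp2 (- (delta * eta / 2 * i%:R)) =
  Q * geom_const (delta * eta / 2) * e * exp2 (- (delta * eta / 2 * i%:R)) by ring.
rewrite ler_piMr//.
  by rewrite mulr_ge0 ?exp2_ge0// mulr_ge0// ltW// geom_const_gt0.
by rewrite -[leRHS]exp20 ler_exp2 oppr_le0 mulr_ge0// ltW.
Qed.

(** The size of a near coefficient is read off the [p]-th moment of the near
    coefficients; a far one is damped below the same size by the factors of
    the weight. *)
Lemma local_coef_le j k : (k < 2 ^ j)%N -> (J0 <= coarse j)%N ->
  `|c j k| * (if near_point x0 (coarse j) j k then 1 else far j j) <=
  (exp2 ((g * p + 1) / p) + 4 ^+ N * A `^ p^-1) * exp2 ((j%:R - loc * j%:R) / p).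
Proof.
move=> kj Jj.
have rootp y : 0 <= y -> y = (y `^ p) `^ p^-1.
  by move=> y0; rewrite -powRrM mulfV ?gt_eqF// powRr1.
have ip0 : 0 <= p^-1 by rewrite invr_ge0 ltW.
have ge0 : 0 <= 4 ^+ N * A `^ p^-1 by rewrite mulr_ge0 ?exprn_ge0 ?powR_ge0.
case: ifPn => near.
  have h : `|c j k| `^ p <= exp2 (g * p + 1 + (j%:R - loc * j%:R)).
    rewrite exp2D; apply: le_trans (near_moment_le Jj (leqnn j)).
    rewrite (bigD1 (Ordinal kj))//= lerDl; apply: sumr_ge0 => *; exact: powR_ge0.
  rewrite mulr1 (rootp _ (normr_ge0 (c j k))).
  apply: le_trans (ge0_ler_powR ip0 _ _ h) _; rewrite ?nnegrE ?powR_ge0 ?exp2_ge0//.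
  rewrite exp2_powR mulrDl exp2D ler_wpM2r ?exp2_ge0// lerDl//.
have h : `|c j k| `^ p <= A * exp2 ((1 - eta) * j%:R).
  apply: le_trans (moment_le j).
  rewrite (bigD1 (Ordinal kj))//= lerDl; apply: sumr_ge0 => *; exact: powR_ge0.
have h' : `|c j k| <= A `^ p^-1 * exp2 ((1 - eta) * j%:R / p).
  rewrite (rootp _ (normr_ge0 (c j k))).
  apply: le_trans (ge0_ler_powR ip0 _ _ h) _; rewrite ?nnegrE ?powR_ge0 ?mulr_ge0 ?exp2_ge0//.
  by rewrite powRM ?exp2_ge0// exp2_powR.
apply: le_trans (ler_pM _ _ h' (far_factor_le (leqnn j))) _ => //.
apply: (@le_trans _ _ (4 ^+ N * A `^ p^-1 * exp2 ((j%:R - loc * j%:R) / p))); last first.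
  by rewrite ler_wpM2r ?exp2_ge0// lerDr exp2_ge0.
rewrite mulrACA [A `^ _ * _]mulrC -exp2D ler_wpM2l// ler_exp2.
have j0 : 0 <= j%:R :> R by [].
have h1 : loc * j%:R / p <= (g * p + 1) * j%:R.
  rewrite ler_pdivrMr//; apply: (@le_trans _ _ ((g * p + 1) * j%:R)).
    by rewrite ler_wpM2r// loc_le.
  by rewrite ler_peMr// mulr_ge0// ltW.
have h2 : 0 <= eta * j%:R / p by rewrite !mulr_ge0// ltW.
have -> : (1 - eta) * j%:R / p + - ((g * p + 1) * j%:R) =
  j%:R / p - eta * j%:R / p - (g * p + 1) * j%:R by ring.
have -> : (j%:R - loc * j%:R) / p = j%:R / p - loc * j%:R / p by ring.
by apply: lerB => //; rewrite gerBl.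
Qed.

(** With [loc >= a p + 1] the bound is a constant times [2 ^ ((m - a) j)], as
    for a function with Hoelder exponent [a] at [x0]. *)
Lemma local_block_derive_le m : exists2 C, 0 <= C & forall j x,
  (0 < j)%N -> (J0 <= coarse j)%N -> `|x - x0| <= exp2 (- j%:R) ->
  `|derive1n m (block psi c j) x| <=
     C * exp2 (m%:R * j%:R + (j%:R - loc * j%:R) / p).
Proof.
have [C C0 HC] := derive1n_wavelet_le m N.+1 spsi.
pose B := exp2 ((g * p + 1) / p) + 4 ^+ N * A `^ p^-1.
have B0 : 0 <= B by rewrite addr_ge0 ?exp2_ge0// mulr_ge0 ?exprn_ge0 ?powR_ge0.
exists (C * (B * (9 * pi))); first by rewrite !mulr_ge0// pi_ge0.
move=> j x j0 Jj xx0; rewrite derive1n_block//.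
apply: le_trans (ler_norm_sum _ _ _) _.
apply: (@le_trans _ _ (C * 2 ^+ (j * m) *
    \sum_(k < 2 ^ j) `|c j k| * weight j k x ^+ N.+1)).
  rewrite mulr_sumr; apply: ler_sum => k _; rewrite normrM.
  by apply: (le_trans (ler_wpM2l (normr_ge0 _) (HC j k x))); rewrite mulrCA.
have near_far := @near_far_sum R x0 (fun k => `|c j k|) (coarse j) j N x
  (fun k => normr_ge0 _) (ltnW (coarse_lt j0)) (le_trans xx0 (window_le j0)).
have sum_le : \sum_(k < 2 ^ j) `|c j k| * weight j k x ^+ N.+1 <=
    B * exp2 ((j%:R - loc * j%:R) / p) * (9 * pi).
  apply: (le_trans near_far).
  apply: (@le_trans _ _ (\sum_(k < 2 ^ j) B * exp2 ((j%:R - loc * j%:R) / p) * weight j k x)).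
    by apply: ler_sum => k _; rewrite ler_wpM2r ?weight_ge0//; apply: local_coef_le.
  by rewrite -mulr_sumr ler_wpM2l ?mulr_ge0 ?exp2_ge0// sum_weight_le.
have C2 : 0 <= C * 2 ^+ (j * m) by rewrite mulr_ge0 ?exprn_ge0.
apply: (le_trans (ler_wpM2l C2 sum_le)).
rewrite -exp2_nat natrM exp2D [m%:R * _]mulrC le_eqVlt; apply/orP; left; apply/eqP; ring.
Qed.

End LocalBounds.

Section TaylorSeries.
Context {R : realType}.
Implicit Types (x y r : R) (i j k m J : nat).

(** The geometric sum is dominated by its last terms. *)
Lemma exp2_sum_le (kappa : R) J : 0 < kappa ->
  \sum_(j < J) exp2 (kappa * j%:R) <= geom_const kappa * exp2 (kappa * J%:R).
Proof.
move=> k0; have g0 := geom_const_gt0 k0.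
elim: J => [|J IH]; first by rewrite big_ord0 mulr_ge0 ?exp2_ge0 ?ltW.
rewrite big_ord_recr/=; apply: le_trans (lerD IH (lexx _)) _.
have -> : kappa * J.+1%:R = kappa * J%:R + kappa by rewrite -natr1; ring.
rewrite exp2D -[X in _ + X <= _]mul1r -mulrDl mulrCA [leRHS]mulrC.
rewrite ler_wpM2r ?exp2_ge0//.
have q1 : exp2 (- kappa) < 1 by rewrite -[ltRHS]exp20 ltr_exp2 oppr_lt0.
have gE : geom_const kappa * (1 - exp2 (- kappa)) = 1.
  by rewrite mulVf// gt_eqF// subr_gt0.
have qE : exp2 kappa * exp2 (- kappa) = 1 by rewrite -exp2D subrr exp20.
have e0 := @exp2_gt0 R kappa.
move: g0 q1 gE qE e0; move: (geom_const kappa) (exp2 kappa) (exp2 (- kappa)) => G u q.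
move=> g0 q1 gE qE e0.
have uq : 2 <= u + q.
  have : 0 <= q * (u - 1) ^+ 2.
    rewrite mulr_ge0 ?sqr_ge0//; apply: ltW; rewrite -(pmulr_rgt0 _ e0) qE ltr01//.
  have -> : q * (u - 1) ^+ 2 = u * q * (u - 2) + q by ring.
  by rewrite qE; lra.
have : 0 <= G * (u + q - 2) by rewrite mulr_ge0 ?subr_ge0// ltW.
by nra.
Qed.

Lemma geometric_limit (t : nat -> R) (kappa C : R) : 0 < kappa ->
  (forall j, `|t j| <= C * exp2 (- (kappa * j%:R))) ->
  exists e, forall J, `|e - \sum_(j < J) t j| <=
    C * geom_const kappa * exp2 (- (kappa * J%:R)).
Proof.
move=> k0 tC.
have C0 : 0 <= C.
  by have := le_trans (normr_ge0 _) (tC 0%N); rewrite mulr0 oppr0 exp20 mulr1.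
have [|l _ Hl] := @cauchy_rate _ (fun J => \sum_(j < J) t j)
  (fun J => C * geom_const kappa * exp2 (- (kappa * J%:R))) _ (exp2_cvg0 _ k0).
  move=> n m nm.
  rewrite -!(big_mkord xpredT t) (@big_cat_nat _ _ _ n)//= addrAC subrr add0r.
  apply: le_trans (ler_norm_sum _ _ _) _.
  apply: (@le_trans _ _ (\sum_(n <= j < m) C * exp2 (- (kappa * j%:R)))).
    by apply: ler_sum => j _.
  rewrite -mulr_sumr -mulrA ler_wpM2l// mulrC.
  exact: geometric_exp2_le.
by exists l.
Qed.

Variables (u : nat -> R -> R) (p a x0 C : R) (n : nat).
Hypotheses (p0 : 0 < p) (su : forall j, smooth (u j)).
Hypotheses (na : forall m, (m < n)%N -> m%:R < a) (an : a < n%:R) (C0 : 0 <= C).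
Hypothesis uC : forall j m x, (m <= n)%N -> `|x - x0| <= exp2 (- j%:R) ->
  `|derive1n m (u j) x| <= C * exp2 ((m%:R - a) * j%:R).

(** The Taylor coefficients of order [m < n] of the partial sums converge
    because [m < a], and the remainders of order [n] are summable up to the
    scale of the radius because [a < n]. *)
Lemma taylor_series_ex : exists P : {poly R}, exists2 E, 0 <= E &
  (size P <= n)%N /\
  forall J x, `|x - x0| <= exp2 (- J%:R) ->
    `|\sum_(j < J) u j x - P.[x]| <= E * exp2 (- (a * J%:R)).
Proof.
have x00 J : `|x0 - x0| <= exp2 (- J%:R) by rewrite subrr normr0 exp2_ge0.
have /boolp.choice[e He] : forall m, exists e, (m < n)%N -> forall J,
    `|e - \sum_(j < J) derive1n m (u j) x0 / m`!%:R| <=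
    C * geom_const (a - m%:R) * exp2 (- ((a - m%:R) * J%:R)).
  move=> m; have [mn|nm] := ltnP m n; last by exists 0.
  have k0 : 0 < a - m%:R by rewrite subr_gt0 na.
  have [j|e He] := @geometric_limit (fun j => derive1n m (u j) x0 / m`!%:R) (a - m%:R) C k0.
    rewrite normrM; apply: (@le_trans _ _ `|derive1n m (u j) x0|).
      rewrite ler_piMr// normfV ger0_norm// invf_le1 ?ltr0n ?fact_gt0//.
      by rewrite ler1n fact_gt0.
    apply: le_trans (uC (ltnW mn) (x00 j)) _.
    by have -> : (m%:R - a) * j%:R = - ((a - m%:R) * j%:R) by ring.
  by exists e.
pose P : {poly R} := \sum_(m < n) e m *: ('X - x0%:P) ^+ m.
pose E := C * geom_const (n%:R - a) + \sum_(m < n) C * geom_const (a - m%:R).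
have g0 : 0 <= geom_const (n%:R - a) by rewrite ltW// geom_const_gt0// subr_gt0.
have gm0 (m : 'I_n) : 0 <= geom_const (a - m%:R) by rewrite ltW// geom_const_gt0// subr_gt0 na.
exists P, E; first by rewrite addr_ge0 ?mulr_ge0//; apply: sumr_ge0 => m _; rewrite mulr_ge0.
split.
  apply: (leq_trans (size_sum _ _ _)); apply/bigmax_leqP => m _.
  apply: leq_trans (size_scale_leq _ _) _.
  by rewrite size_exp_XsubC.
move=> J x xJ.
have Px : P.[x] = \sum_(m < n) e m * (x - x0) ^+ m.
  rewrite /P horner_sum; apply: eq_bigr => m _.
  by rewrite hornerZ horner_exp hornerXsubC.
have Tx : \sum_(j < J) (taylor_poly (u j) x0 n).[x] =
    \sum_(m < n) (\sum_(j < J) derive1n m (u j) x0 / m`!%:R) * (x - x0) ^+ m.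
  under [RHS]eq_bigr do rewrite mulr_suml.
  rewrite exchange_big/=; apply: eq_bigr => j _.
  rewrite /taylor_poly horner_sum; apply: eq_bigr => m _.
  by rewrite hornerZ horner_exp hornerXsubC.
have -> : \sum_(j < J) u j x - P.[x] =
    \sum_(j < J) (u j x - (taylor_poly (u j) x0 n).[x]) +
    (\sum_(j < J) (taylor_poly (u j) x0 n).[x] - P.[x]) by rewrite sumrB; ring.
apply: le_trans (ler_normD _ _) _; rewrite /E mulrDl; apply: lerD.
  apply: le_trans (ler_norm_sum _ _ _) _.
  apply: (@le_trans _ _ (\sum_(j < J) C * exp2 (- (n%:R * J%:R)) * exp2 ((n%:R - a) * j%:R))).
    apply: ler_sum => j _.
    have dz z : `|z - x0| <= `|x - x0| ->
        `|derive1n n (u j) z| <= C * exp2 ((n%:R - a) * j%:R).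
      move=> zx; apply: uC => //; apply: (le_trans zx); apply: (le_trans xJ).
      by rewrite ler_exp2 lerN2 ler_nat ltnW.
    apply: (le_trans (taylor_remainder_le (@su j) dz)).
    rewrite -[leRHS]mulrA [exp2 (- _) * _]mulrC mulrA.
    apply: ler_wpM2l; first by rewrite mulr_ge0 ?exp2_ge0.
    have -> : - (n%:R * J%:R) = - J%:R * n%:R :> R by ring.
    by rewrite -exp2_powR powR_mulrn ?exp2_ge0// lerXn2r ?nnegrE ?exp2_ge0.
  rewrite -mulr_sumr -!mulrA ler_wpM2l//.
  have k0 : 0 < n%:R - a by rewrite subr_gt0.
  apply: (le_trans (ler_wpM2l (exp2_ge0 _) (exp2_sum_le J k0))).
  by rewrite mulrCA -exp2D; have -> : - (n%:R * J%:R) + (n%:R - a) * J%:R = - (a * J%:R) by ring.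
rewrite Tx Px -sumrB mulr_suml.
apply: le_trans (ler_norm_sum _ _ _) _; apply: ler_sum => m _.
rewrite -mulrBl normrM distrC normrX.
have h1 := He m (ltn_ord m) J.
have h2 : `|x - x0| ^+ m <= exp2 (- (m%:R * J%:R)).
  have -> : - (m%:R * J%:R) = - J%:R * m%:R :> R by ring.
  by rewrite -exp2_powR powR_mulrn ?exp2_ge0// lerXn2r ?nnegrE ?exp2_ge0.
apply: (le_trans (ler_pM _ _ h1 h2)); rewrite ?exprn_ge0//.
rewrite -[leLHS]mulrA -exp2D.
by have -> : - ((a - m%:R) * J%:R) + - (m%:R * J%:R) = - (a * J%:R) by ring.
Qed.

Notation ball_itv i := (`[x0 - exp2 (- i%:R), x0 + exp2 (- i%:R)]%classic : set R).

(** The part of the series at the scales coarser than the radius is replaced by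
    its Taylor polynomial, the other part is bounded in L^p. *)
Lemma Tspace_series (F : R -> R) (D : R) (I : nat) : measurable_fun setT F -> 0 <= D ->
  (forall i, (I <= i)%N ->
    (Lp_int p (ball_itv i) (fun x => F x - \sum_(j < i) u j x)%R <=
     (D * exp2 (- ((a * p + 1) * i%:R)))%:E)%E) ->
  Tspace p a x0 F.
Proof.
move=> mF D0 HD.
have [P [E E0 [sP HP]]] := taylor_series_ex.
pose W := 2 `^ p * (D + E `^ p * 2).
have W0 : 0 <= W by rewrite mulr_ge0 ?powR_ge0// addr_ge0 ?mulr_ge0 ?powR_ge0.
have mP : measurable_fun setT (fun x => F x - P.[x]).
  apply: measurable_funB => //; apply: continuous_measurable_fun => x.
  exact: continuous_horner.
have W1 i : (I <= i)%N -> (Lp_int p (ball_itv i) (fun x => F x - P.[x])%R <=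
    (W * exp2 (- ((a * p + 1) * i%:R)))%:E)%E.
  move=> Ii.
  have mB : measurable (ball_itv i) by [].
  have cS : continuous (fun x => \sum_(j < i) u j x).
    by apply: (@cint_sum R i u 0 1 _).2 => j; apply: smooth_continuous.
  have m1 : measurable_fun (ball_itv i) (fun x => F x - \sum_(j < i) u j x).
    apply: measurable_funB; last exact: measurable_continuous.
    exact: (measurable_funS measurableT).
  have m2 : measurable_fun (ball_itv i) (fun x => \sum_(j < i) u j x - P.[x]).
    apply: measurable_continuous => // x; apply: cvgB; first exact: cS.
    exact: continuous_horner.
  have -> : (fun x => F x - P.[x]) =
    (fun x => (F x - \sum_(j < i) u j x) + (\sum_(j < i) u j x - P.[x])).
    by rewrite funeqE => x; ring.
  apply: (le_trans (Lp_int_add_le p0 mB m1 m2)).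
  have ei0 := @exp2_gt0 R (- i%:R).
  have ball_lt : x0 - exp2 (- i%:R) < x0 + exp2 (- i%:R) by lra.
  have h2 : (Lp_int p (ball_itv i) (fun x => \sum_(j < i) u j x - P.[x])%R <=
      (E `^ p * 2 * exp2 (- ((a * p + 1) * i%:R)))%:E)%E.
    apply: (@le_trans _ _ (Lp_int p (ball_itv i) (cst (E * exp2 (- (a * i%:R)))))).
      apply: Lp_int_le => // x; rewrite /= in_itv/= => xi.
      rewrite [leRHS]ger0_norm ?mulr_ge0 ?exp2_ge0//; apply: HP.
      by rewrite ler_distl.
    rewrite Lp_int_cst// lee_fin ger0_norm ?mulr_ge0 ?exp2_ge0//.
    rewrite powRM ?exp2_ge0// exp2_powR.
    have -> : - ((a * p + 1) * i%:R) = - (a * i%:R) * p + - i%:R by ring.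
    rewrite exp2D le_eqVlt; apply/orP; left; apply/eqP; ring.
  have h1 := HD i Ii.
  apply: (@le_trans _ _ ((2 `^ p)%:E * ((D * exp2 (- ((a * p + 1) * i%:R)))%:E +
     (E `^ p * 2 * exp2 (- ((a * p + 1) * i%:R)))%:E))%E).
    by apply: lee_wpmul2l; rewrite ?lee_fin ?powR_ge0//; exact: leeD.
  by rewrite -EFinD -EFinM lee_fin -mulrDl mulrA.
have ip0 : 0 <= p^-1 by rewrite invr_ge0 ltW.
pose G := (2 * W) `^ p^-1 * exp2 `|a|.
exists (G + 1), P, (exp2 (- I%:R)); split.
- by rewrite ltr_wpDl// /G mulr_ge0 ?powR_ge0 ?exp2_ge0.
- move=> PN0; have sP0 : (0 < size P)%N by rewrite size_poly_gt0.
  by apply: na; move: sP sP0; lia.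
- exact: exp2_gt0.
move=> r r0 rI.
have [t rE] := exp2_ex r0.
have tI : t <= - I%:R by rewrite -ler_exp2 -rE.
have t0 : 0 <= - t by rewrite lerNr oppr0; apply: (le_trans tI); rewrite oppr_le0.
pose i := Num.truncn (- t).
have it : i%:R <= - t by rewrite truncn_le.
have ti : - t < i%:R + 1 by rewrite natr1 truncnS_gt.
have Ii : (I <= i)%N.
  by rewrite truncn_ge_nat// lerNr.
have ri : r <= exp2 (- i%:R) by rewrite rE ler_exp2 lerNr.
have ir : r^-1 <= exp2 (i%:R + 1) by rewrite rE -exp2N ler_exp2 ltW.
have mball : measurable (ball x0 r) by exact: measurable_ball.
have sub : ball x0 r `<=` ball_itv i.
  move=> x; rewrite /ball/= in_itv/= -ler_distl distrC => h.
  exact: le_trans (ltW h) ri.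
have h : ((r^-1)%:E * Lp_int p (ball x0 r) (fun x => F x - P.[x])%R <=
    (2 * W * exp2 (- (a * i%:R)) `^ p)%:E)%E.
  apply: (@le_trans _ _ ((r^-1)%:E * (W * exp2 (- ((a * p + 1) * i%:R)))%:E)%E).
    apply: lee_wpmul2l; first by rewrite lee_fin invr_ge0 ltW.
    apply: le_trans (W1 i Ii); apply: ge0_subset_integral => //.
    by apply: measurable_abs_powR; exact: (measurable_funS measurableT).
  rewrite -EFinM lee_fin.
  have We0 : 0 <= W * exp2 (- ((a * p + 1) * i%:R)) by rewrite mulr_ge0 ?exp2_ge0.
  apply: (le_trans (ler_wpM2r We0 ir)).
  rewrite exp2_powR exp2D exp21.
  have -> : - ((a * p + 1) * i%:R) = - (a * i%:R) * p - i%:R by ring.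
  rewrite exp2B le_eqVlt; apply/orP; left; apply/eqP; field.
  by rewrite gt_eqF ?exp2_gt0.
have lhs0 : (0 <= (r^-1)%:E * Lp_int p (ball x0 r) (fun x => F x - P.[x])%R)%E.
  by rewrite mule_ge0 ?lee_fin ?invr_ge0 ?(ltW r0)// Lp_int_ge0.
have W2 : 0 <= 2 * W by rewrite mulr_ge0.
have rhs0 : 0 <= 2 * W * exp2 (- (a * i%:R)) `^ p by rewrite mulr_ge0 ?powR_ge0.
apply: le_trans (gt0_ler_poweR ip0 _ _ h) _.
- by rewrite in_itv/= lhs0 leey.
- by rewrite in_itv/= leey andbT lee_fin.
rewrite poweR_EFin lee_fin [X in X <= _]powRM ?powR_ge0// -[_ `^ p `^ _]powRrM mulfV ?gt_eqF//.
rewrite powRr1 ?exp2_ge0//.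
apply: (@le_trans _ _ (G * r `^ a)); last first.
  by apply: ler_wpM2r; rewrite ?powR_ge0 ?lerDl ?ler01.
rewrite /G -mulrA ler_wpM2l ?powR_ge0// rE exp2_powR -exp2D ler_exp2.
have s1 : - t - i%:R <= 1 by rewrite lerBlDl ltW.
have s0 : 0 <= - t - i%:R by rewrite subr_ge0.
have : a * (- t - i%:R) <= `|a|.
  apply: le_trans (ler_norm _) _; rewrite normrM (ger0_norm s0).
  by rewrite ler_piMr.
have -> : a * (- t - i%:R) = - (t * a) - a * i%:R by ring.
by move: (t * a) (a * i%:R) `|a| => u1 u2 u3; lra.
Qed.

End TaylorSeries.

Section PointwiseRegularity.
Context {R : realType}.
Implicit Types (x y : R) (i j k m n : nat).
Variables (psi : R -> R) (f : (R -> R) -> R) (p eta : R).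
Notation c := (wavelet_coef psi f).
Notation recon := (@recon R psi f).
Notation recon_lim := (@recon_lim R psi f).
Hypotheses (mw : mother_wavelet psi) (hf : periodic_distribution f).
Hypotheses (p1 : 1 <= p) (eta0 : 0 < eta).
Hypothesis moment_ev : exists J, forall j, (J <= j)%N ->
  \sum_(k < 2 ^ j) `|c j k| `^ p <= exp2 ((1 - eta) * j%:R).
Let spsi : schwartz psi. Proof. by have [] := mw. Qed.
Let p0 : 0 < p. Proof. exact: lt_le_trans p1. Qed.

(** The constant component is counted with the scale [0]. *)
Definition scale_part j x : R := (j == 0%N)%:R * f (cst 1) + block psi c j x.

Lemma scale_part_test j : periodic_test (scale_part j).
Proof.
have tb := block_test c j spsi; have tc := @test_cst R (f (cst 1)).
split; first exact: smooth_lincomb tc.1 tb.1.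
exact: periodic_lincomb tc.2 tb.2.
Qed.

Lemma sum_scale_part i x : (0 < i)%N -> \sum_(j < i) scale_part j x = recon i x.
Proof.
case: i => // i _; rewrite /scale_part big_split/= /recon /series_part; congr (_ + _).
by rewrite big_ord_recl/= mul1r big1 ?addr0// => j _; rewrite mul0r.
Qed.

Lemma scale_part_block j : (0 < j)%N -> scale_part j = block psi c j.
Proof. by case: j => // j _; rewrite funeqE => x; rewrite /scale_part mul0r add0r. Qed.

(** The finitely many scales that are too coarse for the local bound only
    contribute smooth periodic functions, which are bounded. *)
Lemma derive_scale_part_le (a loc x0 : R) I n :
  (1 - loc) / p <= - a ->
  (forall m, exists2 C, 0 <= C & forall j x, (I <= j)%N -> (0 < j)%N ->
     `|x - x0| <= exp2 (- j%:R) ->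
     `|derive1n m (block psi c j) x| <= C * exp2 (m%:R * j%:R + (j%:R - loc * j%:R) / p)) ->
  exists2 C, 0 <= C & forall j m x, (m <= n)%N -> `|x - x0| <= exp2 (- j%:R) ->
    `|derive1n m (scale_part j) x| <= C * exp2 ((m%:R - a) * j%:R).
Proof.
move=> la Hb.
have /boolp.choice[B HB] : forall mj : nat * nat, exists B,
    0 <= B /\ forall x, `|derive1n mj.1 (scale_part mj.2) x| <= B.
  move=> [m j]; have [sg pg] := scale_part_test j.
  have [|B B0 HB] := @periodic_bounded R (derive1n m (scale_part j)) _
    (periodic_derive1n m sg pg); last by exists B.
  by apply: smooth_continuous; exact: smooth_derive1n.
have /boolp.choice[Cm HC] : forall m, exists C, 0 <= C /\ forall j x, (I <= j)%N ->
     (0 < j)%N -> `|x - x0| <= exp2 (- j%:R) ->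
     `|derive1n m (block psi c j) x| <= C * exp2 (m%:R * j%:R + (j%:R - loc * j%:R) / p).
  by move=> m; have [C C0 HC] := Hb m; exists C.
pose S m := \sum_(j < I.+1) B (m, val j) * exp2 (- ((m%:R - a) * j%:R)).
have S0 m : 0 <= S m.
  by apply: sumr_ge0 => j _; rewrite mulr_ge0 ?exp2_ge0// (HB (m, val j)).1.
have CS0 m : 0 <= Cm m + S m by rewrite addr_ge0// (HC m).1.
exists (\sum_(m < n.+1) (Cm m + S m)); first exact: sumr_ge0.
move=> j m x mn xj.
have CSm : Cm m + S m <= \sum_(m < n.+1) (Cm m + S m).
  by rewrite (bigD1 (Ordinal (mn : (m < n.+1)%N)))//= lerDl; apply: sumr_ge0.
apply: le_trans (ler_wpM2r (exp2_ge0 _) CSm).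
have [/andP[Ij j0]|jI] := boolP ((I <= j)%N && (0 < j)%N).
  rewrite scale_part_block//; apply: le_trans ((HC m).2 j x Ij j0 xj) _.
  apply: ler_pM; rewrite ?exp2_ge0 ?(HC m).1 ?lerDl// ler_exp2.
  have := ler_wpM2r (ler0n R j) la.
  have -> : (1 - loc) / p * j%:R = (j%:R - loc * j%:R) / p by ring.
  by have -> : (m%:R - a) * j%:R = m%:R * j%:R + - a * j%:R; [ring|rewrite lerD2l].
have jI' : (j < I.+1)%N by move: jI; rewrite negb_and; lia.
apply: (le_trans ((HB (m, j)).2 x)).
apply: (@le_trans _ _ (B (m, j) * exp2 (- ((m%:R - a) * j%:R)) * exp2 ((m%:R - a) * j%:R))).
  by rewrite -mulrA -exp2D addNr exp20 mulr1.
rewrite ler_wpM2r ?exp2_ge0//; apply: ler_wpDl; first exact: (HC m).1.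
rewrite /S (bigD1 (Ordinal jI'))//= lerDl; apply: sumr_ge0 => i _.
by rewrite mulr_ge0 ?exp2_ge0// (HB (m, val i)).1.
Qed.

(** The sum of the wavelet series is a function representing [f] for which an
    exponent of approximation larger than [h] is reached. *)
Lemma pexponent_gt (g h x0 : R) : - p^-1 <= h -> h < g ->
  (exists J, forall j, (J <= j)%N -> ~~ large_leader c p g j (dyadic_index j x0)) ->
  (h%:E < pexponent psi f p x0)%E.
Proof.
move=> ph hg [J0 HJ].
have [A A0 HA] := moment_le_all moment_ev.
(* [a] is between [h] and [g], and it is not an integer: [n - 1 < a < n] *)
pose n := if h < 0 then 0%N else (Num.truncn h).+1.
have hn : h < n%:R.
  by rewrite /n; case: ifPn => // _; exact: truncnS_gt.
have nh m : (m < n)%N -> m%:R <= h.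
  rewrite /n; case: ifPn => // h0; rewrite ltnS -leNgt in h0 *.
  by rewrite truncn_ge_nat.
pose a := (h + Num.min g n%:R) / 2.
have hmin : h < Num.min g n%:R by rewrite lt_min hg.
have ha : h < a by rewrite /a; lra.
have amin : a < Num.min g n%:R by rewrite /a; lra.
have [ag an] : a < g /\ a < n%:R by move: amin; rewrite lt_min => /andP.
have ap0 : 0 < a * p + 1.
  have : - p^-1 < a := le_lt_trans ph ha.
  by rewrite -(ltr_pM2r p0) mulNr mulVf ?gt_eqF//; move: (a * p) => v; lra.
have gap : 0 < (g - a) * p.
  by apply: mulr_gt0 => //; rewrite subr_gt0; exact: ag.
have gp0 : 0 < g * p + 1 by move: gap; rewrite mulrBl; lra.
(* as [(1 - delta)^2 >= 1 - 2 delta], the two losses by the factor [1 - delta]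
   leave the exponent [a p + 1] *)
pose delta := (g - a) * p / (2 * (g * p + 1)).
have gp2 : 0 < 2 * (g * p + 1) by rewrite mulr_gt0.
have d0 : 0 < delta by rewrite divr_gt0.
have d1 : delta < 1.
  by rewrite /delta ltr_pdivrMr// mul1r; move: gap ap0 gp0; rewrite mulrBl; lra.
have dE : delta * (2 * (g * p + 1)) = (g - a) * p by rewrite /delta divfK ?gt_eqF.
have d2 : 0 < 2 * delta by rewrite pmulr_rgt0.
pose N := (Num.truncn ((g * p + 1) / (2 * delta))).+1.
have Nd : g * p + 1 <= 2 * N%:R * delta.
  have : (g * p + 1) / (2 * delta) < N%:R by exact: truncnS_gt.
  by rewrite ltr_pdivrMr// => /ltW; rewrite mulrCA mulrA.
have small j j' : (J0 <= j)%N -> (j <= j')%N ->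
    leader_sum c p j (dyadic_index j x0) j' <= exp2 (- (g * p) * j%:R).
  move=> Jj jj'; rewrite leNgt; apply: contra (HJ j Jj) => lt_sum.
  by apply/asboolP; exists j'.
set loc := (g * p + 1) * (1 - delta).
have loc1 : a * p + 1 <= (1 - delta) * loc.
  have -> : (1 - delta) * loc = g * p + 1 - delta * (2 * (g * p + 1)) +
      (g * p + 1) * delta ^+ 2 by rewrite /loc; ring.
  have : 0 <= (g * p + 1) * delta ^+ 2 by apply: mulr_ge0; [exact: ltW|exact: sqr_ge0].
  by rewrite dE mulrBl; lra.
have loc2 : a * p + 1 <= loc.
  apply: (le_trans loc1); apply: ler_piMl; last by rewrite gerBl ltW.
  by apply: mulr_ge0; rewrite ?subr_ge0 ltW.
have [I HI] := coarse_large d1 J0.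
have la : (1 - loc) / p <= - a by rewrite ler_pdivrMr// mulNr; lra.
have block_le m : exists2 C, 0 <= C & forall j x, (I <= j)%N -> (0 < j)%N ->
    `|x - x0| <= exp2 (- j%:R) ->
    `|derive1n m (block psi c j) x| <= C * exp2 (m%:R * j%:R + (j%:R - loc * j%:R) / p).
  have [Cm Cm0 HCm] := @local_block_derive_le R psi f p eta g delta x0 A N J0
    mw p1 eta0 gp0 d0 d1 Nd A0 HA small m.
  by exists Cm => // j x Ij j0 xj; apply: HCm => //; have [] := HI j Ij.
have [C C0 HC] := @derive_scale_part_le a loc x0 I n la block_le.
have [D [I' D0 HD]] := @local_tail_integral_le R psi f p eta g delta x0 A N J0
  mw p1 eta0 gp0 d0 d1 Nd A0 HA moment_ev small.
have T : Tspace p a x0 recon_lim.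
  apply: (@Tspace_series R scale_part p a x0 C n p0 _ _ an C0 HC recon_lim D (maxn 1 I')) => //.
  - by move=> j; exact: (scale_part_test j).1.
  - by move=> m mn; apply: le_lt_trans ha; exact: nh.
  - exact: (@measurable_recon_lim R psi f mw).
  move=> i; rewrite geq_max => /andP[i0 Ii].
  have -> : (fun x => recon_lim x - \sum_(j < i) scale_part j x) =
    (fun x => recon_lim x - recon i x).
    by rewrite funeqE => x; rewrite sum_scale_part.
  apply: (le_trans (HD i Ii)); rewrite lee_fin ler_wpM2l// ler_exp2 lerN2.
  by rewrite ler_wpM2r.
rewrite /pexponent p1; apply: (@lt_le_trans _ _ a%:E); first by rewrite lte_fin.
apply: ereal_sup_ubound; exists a => //; split; first exact: le_trans ph (ltW ha).
exists recon_lim; split=> //.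
- exact: (@recon_lim_Lp R psi f p eta).
- exact: (@recon_lim_represents R psi f p eta).
Qed.

End PointwiseRegularity.

(** * The upper bound of the spectrum *)

Section SpectrumUpperBound.
Context {R : realType}.
Variables (psi : R -> R) (f : (R -> R) -> R) (p eta h : R).
Notation c := (wavelet_coef psi f).
Hypotheses (mw : mother_wavelet psi) (hf : periodic_distribution f).
Hypotheses (p0 : 0 < p) (eta0 : 0 < eta) (ph : - p^-1 <= h).
Hypothesis moment_ev : exists J, forall j, (J <= j)%N ->
  \sum_(k < 2 ^ j) `|c j k| `^ p <= exp2 ((1 - eta) * j%:R).

(** For [p < 1] because the exponent is defined by the leaders, for [1 <= p]
    because small leaders give a good local approximation. *)
Lemma large_leader_io g x : h < g -> pexponent psi f p x = h%:E ->
  forall J, exists2 j, (J <= j)%N & large_leader c p g j (dyadic_index j x).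
Proof.
move=> hg xh J; apply: contrapT => none.
have small j : (J <= j)%N -> ~~ large_leader c p g j (dyadic_index j x).
  by move=> Jj; apply/negP => large; apply: none; exists j.
have [p1|p1] := leP 1 p.
  have := pexponent_gt mw hf p1 eta0 moment_ev ph hg (ex_intro _ J small).
  by rewrite xh ltxx.
have := pleader_exponent_ge p0 small.
move: xh; rewrite /pexponent leNgt p1/= => ->.
by rewrite lee_fin leNgt hg.
Qed.

Lemma pspectrum_le (s0 : R) :
  (forall alpha r, wavelet_density c alpha = r%:E -> 0 <= r ->
     - p^-1 < alpha <= h -> (h + p^-1) * (r / (alpha + p^-1)) <= s0) ->
  (forall alpha r, wavelet_density c alpha = r%:E -> 0 <= r ->
     h <= alpha < 0 -> (r - 1) * (h / alpha) + 1 <= s0) ->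
  forall s, s0 < s -> (pspectrum psi f p h <= s%:E)%E.
Proof.
move=> left_le right_le s s0s.
have [g hg [J HJ]] := large_leader_count p0 eta0 moment_ev left_le right_le s0s.
apply: (@hausdorff_dim_limsup R _ (large_leader c p g)) => [x xh|]; last by exists J.
exact: large_leader_io.
Qed.

(** A spectrum larger than the bound would leave room for real numbers
    [s0 < s] between the two, to which the counting of large leaders applies. *)
Lemma pspectrum_le_max :
  (pspectrum psi f p h <=
     maxe
       (ereal_sup [set (wavelet_density c alpha - 1) * (h / alpha)%:E + 1
                  | alpha in [set alpha : R | (h <= alpha < 0)%R]])
       (mul_ninfty (h + p^-1)%:E
          (ereal_sup [set wavelet_density c alpha * ((alpha + p^-1)^-1)%:E
                     | alpha in [set alpha : R |
                         (- p^-1 < alpha <= h)%R]])))%E.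
Proof.
set X := maxe _ _; rewrite leNgt; apply/negP => Xd.
have d1 : (pspectrum psi f p h <= 1)%E by exact: hausdorff_dim_le1.
case dE : (pspectrum psi f p h) Xd d1 => [d| |] Xd d1 //; last by rewrite ltNge leNye in Xd.
have [s0 Xs0 s0d] : exists2 s0 : R, (X <= s0%:E)%E & s0 < d.
  case XE : X Xd => [x| |] //; first by rewrite lte_fin; exists x.
  by exists (d - 1); [exact: leNye|rewrite gtrBl].
have [s s0s sd] : exists2 s : R, s0 < s & s < d.
  by exists ((s0 + d) / 2); lra.
suff : (pspectrum psi f p h <= s%:E)%E by rewrite dE lee_fin leNgt sd.
apply: (pspectrum_le _ _ s0s) => alpha r rhoE r0.
  move=> /andP[pa ah]; rewrite -lee_fin; apply: le_trans Xs0.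
  rewrite /X le_max; apply/orP; right.
  have h0 : 0 < h + p^-1 by rewrite -(opprK p^-1) subr_gt0; exact: lt_le_trans pa ah.
  rewrite /mul_ninfty eqe gt_eqF//= EFinM.
  apply: lee_wpmul2l; first by rewrite lee_fin ltW.
  by apply: ereal_sup_ubound; exists alpha; rewrite /= ?pa// rhoE -EFinM.
move=> ha; rewrite -lee_fin; apply: le_trans Xs0.
rewrite /X le_max; apply/orP; left.
by apply: ereal_sup_ubound; exists alpha => //=; rewrite rhoE.
Qed.

End SpectrumUpperBound.

Theorem theorem1p4 (R : realType) (psi : R -> R) (f : (R -> R) -> R)
    (hpsi : mother_wavelet psi) (hf : periodic_distribution f)
    (hp0 : (0 < critical_exponent (wavelet_coef psi f))%E)
    (p : R) (p_gt0 : 0 < p)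
    (hp : (p%:E < critical_exponent (wavelet_coef psi f))%E) :
  let rho := wavelet_density (wavelet_coef psi f) in
  (forall h : R, - p^-1 <= h ->
     (pspectrum psi f p h <=
        mine
          (maxe
             (ereal_sup [set (rho alpha - 1) * (h / alpha)%:E + 1
                        | alpha in [set alpha : R | (h <= alpha < 0)%R]])
             (mul_ninfty (h + p^-1)%:E
                (ereal_sup [set rho alpha * ((alpha + p^-1)^-1)%:E
                           | alpha in [set alpha : R |
                               (- p^-1 < alpha <= h)%R]])))
          1)%E) /\
  (forall h : R, 0 <= h ->
     (pspectrum psi f p h <=
        mine
          (mul_ninfty (h + p^-1)%:E
             (ereal_sup [set rho alpha * ((alpha + p^-1)^-1)%:E
                        | alpha in [set alpha : R |
                            (- p^-1 < alpha <= h)%R]]))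
          1)%E).

Proof.
move=> rho.
have [eta eta0 moment_ev] := critical_exponent_gt p_gt0 hp.
have main h : - p^-1 <= h -> (pspectrum psi f p h <= mine (maxe
    (ereal_sup [set (rho alpha - 1) * (h / alpha)%:E + 1
               | alpha in [set alpha : R | (h <= alpha < 0)%R]])
    (mul_ninfty (h + p^-1)%:E
       (ereal_sup [set rho alpha * ((alpha + p^-1)^-1)%:E
                  | alpha in [set alpha : R | (- p^-1 < alpha <= h)%R]]))) 1)%E.
  move=> ph; rewrite le_min; apply/andP; split; last exact: hausdorff_dim_le1.
  exact: pspectrum_le_max hpsi hf p_gt0 eta0 ph moment_ev.
split=> // h h0.
have ph : - p^-1 <= h by apply: le_trans h0; rewrite oppr_le0 invr_ge0 ltW.
have := main h ph.
have -> : [set alpha : R | h <= alpha < 0] = set0.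
  apply/seteqP; split=> // alpha /= /andP[ha a0].
  by have := lt_le_trans a0 (le_trans h0 ha); rewrite ltxx.
by rewrite image_set0 ereal_sup0 maxNye.
Qed.
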